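(* Let $X$ be a normal quasi-projective variety over $\mathbb{C}$ with canonical singularities (in the sense given in the context) whose canonical ring $\mathscr{R}_X(K_X)=\bigoplus_{m\ge0}\mathcal{O}_X(mK_X)$ is a finitely generated $\mathcal{O}_X$-algebra. Then the relative canonical model $X_{can}:=\mathrm{Proj}_X(\mathscr{R}_X(K_X))$ exists and it has canonical singularities.
   Context: $X$ is not assumed $\mathbb{Q}$-Gorenstein. For a Weil divisor $D$ on a normal variety $X$, $\mathcal{O}_X(D)$ is the sheaf of rational functions $\phi$ with $\mathrm{div}(\phi)+D\ge0$. For a divisorial valuation $v=\mathrm{val}_F$ ($F$ a prime divisor over $X$) with center $c_X(v)$ and a fractional ideal sheaf $\mathcal{I}$, $v(\mathcal{I})=\min\{v(\phi)\mid\phi\in\mathcal{I}(U),\ U\cap c_X(v)\ne\emptyset\}$. For an integral Weil divisor $D$, $v^{\natural}(D)=v(\mathcal{O}_X(-D))$; for a $\mathbb{Q}$-divisor $D$, $v(D)=\lim_{k\to\infty}\frac{v^{\natural}(k!D)}{k!}=\inf_{k\ge1}\frac{v^{\natural}(kD)}{k}$. For a proper (projective) birational morphism $f:Y\to X$ with $Y$ normal, $f^*D=\sum_E\mathrm{val}_E(D)\cdot E$ (sum over prime divisors $E$ on $Y$) and $K_{Y/X}=K_Y+f^*(-K_X)$, with canonical divisors chosen so that $K_X=f_*K_Y$. A normal variety $X$ is canonical (has canonical singularities) if $\mathrm{ord}_F(K_{Y/X})+1\ge1$ for every exceptional prime divisor $F$ over $X$, where $Y\to X$ is a proper birational morphism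 with $Y$ normal and $F$ a divisor on $Y$. *)

(* Defs.v *)
From HB Require Import structures.
From mathcomp Require Import all_boot all_order all_algebra.
From mathcomp Require Import all_classical all_reals all_analysis.
From mathcomp Require Export complex.
From mathcomp Require mpoly.
Import Order.TTheory GRing.Theory Num.Theory numFieldNormedType.Exports.

Set Implicit Arguments.
Unset Strict Implicit.
Unset Printing Implicit Defensive.

Local Open Scope classical_set_scope.
Local Open Scope ring_scope.

(* Varieties are treated as models in the sense of Zariski and Chevalley: an
   integral separated scheme of finite type over k with function field K is
   identified with the set of its local rings, each a k-subalgebra of K; the
   local ring P stands for the (not necessarily closed) point at which it is the
   local ring.  The generic point is K itself, and Q `<=` P means that P is a
   generization of Q.  Every variety is isomorphic to one of this form, and
   birational morphisms Y -> X become statements about two sets of subrings of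
   the same field K (a morphism inducing the identity on K is unique). *)

Section Rings.
Variable T : comNzRingType.
Implicit Types A S p : set T.

Definition is_subring A : Prop :=
  [/\ A 1, forall x y, A x -> A y -> A (x - y)
         & forall x y, A x -> A y -> A (x * y)].

Definition gen_subring S : set T :=
  \bigcap_(A in [set A | is_subring A /\ S `<=` A]) A.

Definition prime_ideal A p : Prop :=
  [/\ p `<=` A,
      p 0 /\ (forall x y, p x -> p y -> p (x + y)),
      forall a x, A a -> p x -> p (a * x),
      ~ p 1
    & forall x y, A x -> A y -> p (x * y) -> p x \/ p y].

End Rings.

Section Models.
Variables (k K : fieldType) (iota : {rmorphism k -> K}).
Implicit Types (A P Q E V : set K) (U X Y : set (set K)).

Definition gen_subalg (S : set K) : set K := gen_subring (range iota `|` S).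

Definition fraction_field A : set K :=
  [set x | exists a b, [/\ A a, A b, b != 0 & x = a / b]].

Definition localization A (p : set K) : set K :=
  [set x | exists a b, [/\ A a, A b, ~ p b & x = a / b]].

Definition Spec A : set (set K) :=
  [set P | exists2 p, prime_ideal A p & P = localization A p].

Definition affine_ring A : Prop :=
  (exists s : seq K, A = gen_subalg [set` s]) /\ fraction_field A = setT.

(* The non-units of P, which form its maximal ideal when P is local. *)
Definition maxideal P : set K := [set x | P x /\ (x = 0 \/ ~ P x^-1)].

Definition dominates Q P : Prop := P `<=` Q /\ maxideal P `<=` maxideal Q.

Definition valuation_ring V : Prop :=
  [/\ is_subring V, range iota `<=` V & forall x, V x \/ V x^-1].

(* The second condition is separatedness. *)
Definition variety X : Prop :=
  (exists (m : nat) (A : 'I_m.+1 -> set K),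
      (forall i, affine_ring (A i)) /\ X = \bigcup_i Spec (A i)) /\
  (forall V P Q, valuation_ring V -> X P -> X Q ->
      dominates V P -> dominates V Q -> P = Q).

(* The Zariski topology: the sets of points at which finitely many given rational
   functions are all regular form a basis of it. *)
Definition zopen X U : Prop :=
  U `<=` X /\
  forall P, U P -> exists2 s : seq K,
    [set` s] `<=` P & forall Q, X Q -> [set` s] `<=` Q -> U Q.

Definition zclosure X P : set (set K) :=
  [set Q | X Q /\ forall U, zopen X U -> U Q -> U P].

(* The closed subvariety of P^m with generic point (x_0 : ... : x_m). *)
Definition projective_model (m : nat) (x : 'I_m.+1 -> K) : set (set K) :=
  \bigcup_i Spec (gen_subalg (range (fun j => x j / x i))).

Definition quasi_projective X : Prop :=
  exists (m : nat) (x : 'I_m.+1 -> K),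
    (forall i, x i != 0) /\ zopen (projective_model x) X.

Definition integrally_closed P : Prop :=
  forall (x : K) (p : {poly K}),
    p \is monic -> (forall i, P p`_i) -> root p x -> P x.

Definition normal_variety X : Prop := forall P, X P -> integrally_closed P.

(* Birational morphisms Y -> X, and properness by the valuative criterion. *)
Definition proper_birational Y X : Prop :=
  (forall Q, Y Q -> exists2 P, X P & dominates Q P) /\
  (forall V, valuation_ring V -> (exists2 P, X P & dominates V P) ->
     exists2 Q, Y Q & dominates V Q).

(* A prime divisor is represented by its generic point, that is, by a point of X
   whose local ring has Krull dimension 1. *)
Definition prime_divisor X E : Prop :=
  [/\ X E, maxideal E <> [set 0]
    & forall p, prime_ideal E p -> p = [set 0] \/ p = maxideal E].

(* For the morphism Y -> X, the prime divisor F of Y is contracted. *)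
Definition exceptional X F : Prop :=
  ~ exists2 P, prime_divisor X P & dominates F P.

(* The normalized valuation of the discrete valuation ring E at x != 0. *)
Definition ord E (x : K) : int :=
  xget 0 [set n | exists t u : K,
    [/\ t != 0, maxideal E = [set t * a | a in E],
        E u /\ E u^-1, u != 0 & x = u * t ^ n]].

(* Q-divisors, given by their coefficients.  On X only the values at the prime
   divisors of X are relevant, so that principal phi stands for the divisor of phi on
   every normal model at once. *)
Definition divisor := set K -> rat.

Definition principal (phi : K) : divisor := fun E => (ord E phi)%:~R.

(* The sections over U of O_X(D). *)
Definition sheaf_O X (D : divisor) U : set K :=
  [set phi | phi = 0 \/
    forall E, prime_divisor X E -> U E -> 0 <= principal phi E + D E].

Definition regular_functions U : set K := \bigcap_(P in U) P.

Definition center_on X V : set (set K) :=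
  \bigcup_(P in [set P | X P /\ dominates V P]) zclosure X P.

Definition val_sheaf X F (I : set (set K) -> set K) : int :=
  xget 0 [set n |
    let values := [set l | exists U phi,
      [/\ zopen X U, U `&` center_on X F !=set0, I U phi, phi != 0
        & ord F phi = l]] in
    values n /\ forall l, values l -> n <= l].

Definition val_natural X F (D : divisor) : int :=
  val_sheaf X F (sheaf_O X (fun E => - D E)).

(* val_F(D).  For the finitely many j for which j! D might not be integral,
   O_X(-j! D) is read as that of the round-down; the limit is not affected. *)
Definition divisorial_val (R : realType) X F (D : divisor) : R :=
  limn (fun j => (val_natural X F (fun E => j`!%:R * D E))%:~R / j`!%:R : R).

Definition is_derivation (d : K -> K) : Prop :=
  [/\ forall x y, d (x + y) = d x + d y,
      forall x y, d (x * y) = x * d y + y * d x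
    & forall c, d (iota c) = 0].

Definition derivation := {d : K -> K | is_derivation d}.

(* Omega_{K/k} is finite-dimensional with dual the space of derivations, so
   differential n-forms on K are alternating n-forms on derivations. *)
Definition diff_form (n : nat) := ('I_n -> derivation) -> K.

(* d y_1 /\ ... /\ d y_n *)
Definition dwedge n (y : 'I_n -> K) : diff_form n :=
  fun d => \det (\matrix_(i, j) sval (d i) (y j)).

(* The image of the n-th exterior power of Omega_{A/k} in that of Omega_{K/k}. *)
Definition Omega n A : set (diff_form n) :=
  [set w | exists (m : nat) (a : 'I_m -> K) (y : 'I_m -> 'I_n -> K),
    [/\ forall j, A (a j), forall j i, A (y j i)
      & w = fun d => \sum_j a j * dwedge (y j) d]].

Definition rational_form n (w : diff_form n) : Prop :=
  @Omega n setT w /\ w <> (fun=> 0).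

(* The order of w along E: w = f * eta with eta a generator of Omega^n_E. *)
Definition ord_form n E (w : diff_form n) : int :=
  xget 0 [set l | exists (eta : diff_form n) (f : K),
    [/\ @Omega n E = [set (fun d => a * eta d) | a in E],
        w = (fun d => f * eta d) & ord E f = l]].

(* The canonical divisor div w, simultaneously on all normal models; for a
   birational morphism f : Y -> X one has f_* K_Y = K_X with this choice. *)
Definition canonical_divisor n (w : diff_form n) : divisor :=
  fun E => (ord_form E w)%:~R.

Definition pullback_divisor (R : realType) X (D : divisor) : set K -> R :=
  fun E => divisorial_val R X E D.

(* K_{Y/X} = K_Y + f^*(-K_X) *)
Definition relative_canonical_divisor (R : realType) n (w : diff_form n) X :
    set K -> R :=
  fun E => ratr (canonical_divisor w E) +
           pullback_divisor R X (fun E' => - canonical_divisor w E') E.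

Definition algebraically_independent n (x : 'I_n -> K) : Prop :=
  injective (fun p : mpoly.mpoly n k => mpoly.mmap iota x p).

Definition algebraic_over (L : set K) : Prop :=
  forall z : K, exists p : {poly K}, [/\ p != 0, forall i, L p`_i & root p z].

(* n is the transcendence degree of K over k, the dimension of all models. *)
Definition has_dimension n : Prop :=
  exists x : 'I_n -> K,
    algebraically_independent x /\
    algebraic_over (fraction_field (gen_subalg (range x))).

(* For X a normal variety of dimension n. *)
Definition canonical_singularities (R : realType) n X : Prop :=
  forall w : diff_form n, rational_form w ->
  forall Y F, variety Y -> normal_variety Y -> proper_birational Y X ->
    prime_divisor Y F -> exceptional X F ->
    1 <= relative_canonical_divisor R w X F + 1.

Definition affine_open X A U : Prop :=
  [/\ affine_ring A, U = Spec A & zopen X U].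

(* The sections over U of the algebra R_X(D) = (+)_(m >= 0) O_X(mD), where the
   homogeneous element phi of degree m is written phi *: 'X^m. *)
Definition divisorial_algebra X (D : divisor) U : set {poly K} :=
  [set p | forall m, sheaf_O X (fun E => m%:R * D E) U p`_m].

Definition finitely_generated_algebra U (S : set {poly K}) : Prop :=
  exists s : seq {poly K},
    S = gen_subring (polyC @` regular_functions U `|` [set` s]).

Definition fg_divisorial_algebra X (D : divisor) : Prop :=
  forall A U, affine_open X A U ->
    finitely_generated_algebra U (divisorial_algebra X D U).

(* Homogeneous primes of the graded subring S of K['X] not containing S_+. *)
Definition relevant_prime (S q : set {poly K}) : Prop :=
  [/\ prime_ideal S q,
      forall p, q p -> forall m, q (p`_m *: 'X^m)
    & exists p, [/\ S p, p`_0 = 0 & ~ q p]].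

(* The degree 0 part of the homogeneous localization of S at q. *)
Definition homogeneous_localization (S q : set {poly K}) : set K :=
  [set x | exists m a b,
    [/\ S (a *: 'X^m), S (b *: 'X^m), ~ q (b *: 'X^m) & x = a / b]].

Definition Proj (S : set {poly K}) : set (set K) :=
  [set P | exists2 q, relevant_prime S q & P = homogeneous_localization S q].

(* Proj_X R_X(D), glued from the Proj of the sections over affine opens. *)
Definition relative_Proj X (D : divisor) : set (set K) :=
  [set P | exists A U, affine_open X A U /\ Proj (divisorial_algebra X D U) P].

End Models.

(* Main.v *)
(* Let S be the algebra of sections of the O_X(mD), D = K_X, over an affine open
   Spec A, and write points of X_can as degree 0 localizations P' = S_(q).  The
   divisor D is locally the divisor of a finite set of rational functions: Omega^n is
   finitely generated inside a line, so near a prime divisor it is generated by a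
   coordinate of least order.  Hence only finitely many prime divisors are
   relevant to any given rational function, and a denominator of P' can be chosen to
   have large order at those E that do not contain P'.  Thus P' is the intersection
   of the local rings E of the prime divisors of X with P' in E.  This makes X_can
   normal and small over X: if P' is itself a prime divisor, then it is one of these
   E.  For F over X_can with center P', choose b in S of degree d > 0 not vanishing
   at P'.  For d | M the function b^(M/d) generates O(MD) at P', and has the least
   order along F among the sections of O(MD) at the center of F, both on X and on
   X_can.  So val_F(-K) and the discrepancy of F are the same for X and X_can. *)
Require Import Defs.
From mathcomp Require Import all_boot all_order all_algebra.
From mathcomp Require Import all_classical all_reals all_analysis complex.
From mathcomp Require Import ring zify.
Import Order.TTheory GRing.Theory Num.Theory.
Set Implicit Arguments.
Unset Strict Implicit.
Unset Printing Implicit Defensive.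
Local Open Scope classical_set_scope.
Local Open Scope ring_scope.

(** * Subrings and noetherian rings *)

(** Codimension one is never measured by dimension theory: for a point of a normal variety it means
    being a discrete valuation ring, and Krull's intersection theorem comes from associated primes.
    The main obstacle is that a point of [relative_Proj] may arise over any affine open of X, while
    finite type needs finitely many charts and separatedness compares two points.
    [Proj_point_transport] therefore moves a point to every affine open that contains its center on
    X. Finite generation of the algebra yields finitely many charts of finite type; it also yields
    properness, since a valuation ring contains the chart of the generator of least slope.
    Separatedness is phrased with valuation rings, so it reaches arbitrary local rings only through
    Chevalley's theorem that they are dominated by valuation rings. Characteristic 0 makes the
    differentials of a transcendence basis span all differentials, so that rational n-forms lie on a
    line. The algebra is built from one form [w], but discrepancies are asked for every form; the
    quotient [h] of two forms absorbs the difference, and the j! in the limit supplies divisibility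
    by d. *)

Section Subrings.
Variable T : comNzRingType.
Implicit Types (A B I J : set T).

Lemma subring1 A : is_subring A -> A 1. Proof. by case. Qed.

Lemma subringB A x y : is_subring A -> A x -> A y -> A (x - y).
Proof. by case=> _ + _; apply. Qed.

Lemma subringM A x y : is_subring A -> A x -> A y -> A (x * y).
Proof. by case=> _ _; apply. Qed.

Lemma subring0 A : is_subring A -> A 0.
Proof. by move=> sA; rewrite -(subrr 1); apply: subringB => //; apply: subring1. Qed.

Lemma subringN A x : is_subring A -> A x -> A (- x).
Proof. by move=> sA Ax; rewrite -sub0r; apply: subringB => //; apply: subring0. Qed.

Lemma subringD A x y : is_subring A -> A x -> A y -> A (x + y).
Proof. by move=> sA Ax Ay; rewrite -[y]opprK; apply: subringB => //; apply: subringN. Qed.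

Lemma subringX A x n : is_subring A -> A x -> A (x ^+ n).
Proof.
move=> sA Ax; elim: n => [|n IH]; first by rewrite expr0; apply: subring1.
by rewrite exprS; apply: subringM.
Qed.

Lemma subring_sum A (J : Type) (r : seq J) (Q : pred J) (F : J -> T) :
  is_subring A -> (forall j, Q j -> A (F j)) -> A (\sum_(j <- r | Q j) F j).
Proof.
move=> sA AF; apply: big_ind => //; first exact: subring0.
by move=> *; apply: subringD.
Qed.

Lemma subring_prod A (J : Type) (r : seq J) (Q : pred J) (F : J -> T) :
  is_subring A -> (forall j, Q j -> A (F j)) -> A (\prod_(j <- r | Q j) F j).
Proof.
move=> sA AF; apply: big_ind => //; first exact: subring1.
by move=> *; apply: subringM.
Qed.

Lemma gen_subringP S : is_subring (gen_subring S : set T).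
Proof.
split=> [A [[]]|x y Sx Sy A AS|x y Sx Sy A AS] //.
  by apply: (subringB (proj1 AS)); [apply: Sx|apply: Sy].
by apply: (subringM (proj1 AS)); [apply: Sx|apply: Sy].
Qed.

Lemma sub_gen_subring S : S `<=` (gen_subring S : set T).
Proof. by move=> x Sx A [_]; apply. Qed.

Lemma gen_subring_min S A : is_subring A -> S `<=` A -> gen_subring S `<=` A.
Proof. by move=> sA SA x; apply. Qed.

Definition is_ideal A I : Prop :=
  [/\ I `<=` A, I 0, forall x y, I x -> I y -> I (x + y)
    & forall a x, A a -> I x -> I (a * x)].

(** Generation is encoded as minimality among ideals, so that it is used by exhibiting one suitable
    ideal; [generates_span] recovers linear combinations. *)
Definition generates A (s : seq T) I : Prop :=
  [set` s] `<=` I /\ forall J, is_ideal A J -> [set` s] `<=` J -> I `<=` J.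

Definition noetherian A : Prop :=
  forall I, is_ideal A I -> exists s, generates A s I.

Definition gen_ideal A (S : set T) : set T :=
  \bigcap_(I in [set I | is_ideal A I /\ S `<=` I]) I.

Lemma is_ideal_refl A : is_subring A -> is_ideal A A.
Proof.
move=> sA; split=> // [|x y|a x]; [exact: subring0|exact: subringD|exact: subringM].
Qed.

Lemma gen_idealP A S : is_subring A -> S `<=` A -> is_ideal A (gen_ideal A S).
Proof.
move=> sA SA; split=> [x|I [[]]//|x y Sx Sy I IS|a x Aa Sx I IS].
- by apply; split => //; apply: is_ideal_refl.
- by case: (IS) => -[_ _ ID _] _; apply: ID; [apply: Sx|apply: Sy].
- by case: (IS) => -[_ _ _ IM] _; apply: IM => //; apply: Sx.
Qed.

Lemma sub_gen_ideal A S : S `<=` gen_ideal A S.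
Proof. by move=> x Sx I [_]; apply. Qed.

Lemma gen_ideal_min A S I : is_ideal A I -> S `<=` I -> gen_ideal A S `<=` I.
Proof. by move=> iI SI x; apply. Qed.

Lemma idealN A I x : is_subring A -> is_ideal A I -> I x -> I (- x).
Proof.
move=> sA [_ _ _ IM] Ix; rewrite -mulN1r; apply: IM => //.
by apply: subringN => //; apply: subring1.
Qed.

Lemma idealB A I x y : is_subring A -> is_ideal A I -> I x -> I y -> I (x - y).
Proof.
move=> sA iI Ix Iy; have := iI => -[_ _ ID _]; apply: ID => //.
exact: idealN iI Iy.
Qed.

Lemma ideal_bigcup A (I : nat -> set T) :
  (forall n, is_ideal A (I n)) -> (forall m n, (m <= n)%N -> I m `<=` I n) ->
  is_ideal A (\bigcup_n I n).
Proof.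
move=> iI mI; split.
- by move=> x [n _ Ix]; case: (iI n) => IA _ _ _; apply: IA.
- by exists 0%N => //; case: (iI 0%N).
- move=> x y [m _ Ix] [n _ Iy]; exists (maxn m n) => //.
  case: (iI (maxn m n)) => _ _ ID _.
  by apply: ID; [apply: mI Ix; rewrite leq_maxl|apply: mI Iy; rewrite leq_maxr].
- by move=> a x Aa [n _ Ix]; exists n => //; case: (iI n) => _ _ _; apply.
Qed.

Lemma noetherian_max A (F : set (set T)) :
  noetherian A -> (forall I, F I -> is_ideal A I) -> F !=set0 ->
  exists2 I, F I & forall J, F J -> I `<=` J -> J = I.
Proof.
move=> nA iF [I0 FI0].
(* The empty set joins [F] because the union of the empty chain must belong to the family; ideals
   contain 0, so it is not maximal. *)
have [C CF Ctot|I [FI0' mI]] := @Zorn_bigcup T (F `|` [set set0]).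
  have [allC0|] := pselect (forall I, C I -> I = set0).
    by right; rewrite /= -subset0 => x [I CI]; rewrite (allC0 I CI).
  move=> /existsNP [I1 /not_implyP [CI1 I1n0]]; left.
  have FC I : C I -> I !=set0 -> F I.
    by move=> /CF [//|->] [].
  have I1ex : I1 !=set0 by apply/set0P/eqP.
  have FI1 := FC _ CI1 I1ex.
  have iU : is_ideal A (\bigcup_(I in C) I).
    split.
    - move=> x [I CI Ix]; have /(FC _ CI)/iF[IA _ _ _] : I !=set0 by exists x.
      exact: IA.
    - by exists I1 => //; case: (iF _ FI1).
    - move=> x y [I CI Ix] [J CJ Jy].
      have iI : is_ideal A I by apply/iF/FC => //; exists x.
      have iJ : is_ideal A J by apply/iF/FC => //; exists y.
      have [IJ|JI] := Ctot _ _ CI CJ.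
        by exists J => //; case: iJ => _ _ + _; apply => //; apply: IJ.
      by exists I => //; case: iI => _ _ + _; apply => //; apply: JI.
    - move=> a x Aa [I CI Ix]; exists I => //.
      have /(FC _ CI)/iF[_ _ _ IM] : I !=set0 by exists x.
      exact: IM.
  have [s [sU Us]] := nA _ iU.
  (* Finitely many generators of the union lie in one member of the chain, which is then the whole
     union. *)
  have [I2 [CI2 I2n0] sI2] : exists2 I, C I /\ I !=set0 & [set` s] `<=` I.
    elim: s sU {Us} => [|x s IH] sU; first by exists I1.
    have [|I [CI In0] sI] := IH; first by move=> y ys; apply: sU; rewrite /= in_cons ys orbT.
    have [J CJ Jx] := sU x (mem_head x s).
    have [IJ|JI] := Ctot _ _ CI CJ.
      exists J; first by split=> //; exists x.
      by move=> y /=; rewrite in_cons => /orP[/eqP->//|/sI/IJ].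
    exists I; first by split.
    by move=> y /=; rewrite in_cons => /orP[/eqP->|/sI//]; apply: JI.
  have -> : \bigcup_(I in C) I = I2.
    apply/seteqP; split; first by apply: Us => //; apply/iF/FC.
    by move=> x ?; exists I2.
  exact: FC.
have FI : F I.
  case: FI0' => // I00; case: (mI I0); last by left.
  rewrite I00; split=> // /(_ 0); apply.
  by case: (iF _ FI0).
exists I => // J FJ IJ; apply/seteqP; split => //.
by apply: contrapT => JI; apply: (mI J); [split|left].
Qed.

End Subrings.

(** * Hilbert's basis theorem *)

Section Hilbert.
Variable T : comNzRingType.
Implicit Types (A : set T).

Definition poly_over A : set {poly T} := [set p | forall i, A p`_i].

Lemma poly_over_subring A : is_subring A -> is_subring (poly_over A).
Proof.
move=> sA; split=> [i|p q Ap Aq i|p q Ap Aq i].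
- by rewrite coef1; case: eqP => _; [apply: subring1|apply: subring0].
- by rewrite coefB; apply: subringB.
- by rewrite coefM; apply: subring_sum => // j _; apply: subringM.
Qed.

Lemma poly_overXn A n : is_subring A -> poly_over A 'X^n.
Proof.
by move=> sA i; rewrite coefXn; case: eqP => _; [apply: subring1|apply: subring0].
Qed.

Lemma poly_overC A c : is_subring A -> A c -> poly_over A c%:P.
Proof. by move=> sA Ac i; rewrite coefC; case: eqP => // _; apply: subring0. Qed.

(** Each [f (L n)] has least size among the elements of [J] outside the ideal of its predecessors.
    The ideals [H n] of leading coefficients stabilize at some [N], so an element of the ideal of
    the predecessors of [f (L N)] cancels its leading term, which leaves a shorter element still
    outside that ideal. *)
Theorem hilbert_basis A : is_subring A -> noetherian A -> noetherian (poly_over A).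
Proof.
move=> sA nA J iJ; apply: contrapT => nfg.
have sAX := poly_over_subring sA.
pose G (s : seq {poly T}) := gen_ideal (poly_over A) [set` s].
have [f fP] : {f : seq {poly T} -> {poly T} & forall s, [set` s] `<=` J ->
    [/\ J (f s), ~ G s (f s)
      & forall p, J p -> ~ G s p -> (size (f s) <= size p)%N]}.
  apply: (@choice _ _ (fun s g => [set` s] `<=` J -> [/\ J g, ~ G s g
      & forall p, J p -> ~ G s p -> (size g <= size p)%N])) => s.
  have [sJ|nsJ] := pselect ([set` s] `<=` J); last by exists 0.
  have [p0 [Jp0 Gp0]] : exists p, J p /\ ~ G s p.
    apply: contrapT => noP; apply: nfg; exists s; split=> // I iI sI p Jp.
    apply: contrapT => Ip; apply: noP; exists p; split=> //.
    by move=> /(_ I); apply: contra_not Ip; apply.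
  pose sz n := `[< exists p, [/\ J p, ~ G s p & size p = n] >].
  have exn : exists n, sz n by exists (size p0); apply/asboolP; exists p0.
  case: (ex_minnP exn) => n /asboolP[p [Jp Gp szp]] nmin.
  exists p => _; split => // q Jq Gq; rewrite szp; apply: nmin.
  by apply/asboolP; exists q.
pose L n := iter n (fun s => rcons s (f s)) [::].
have LS n : L n.+1 = rcons (L n) (f (L n)) by [].
have LJ n : [set` L n] `<=` J.
  elim: n => [|n IH] //; rewrite LS => p /=.
  by rewrite mem_rcons in_cons => /orP[/eqP->|/IH//]; case: (fP _ IH).
have Lmono m n : (m <= n)%N -> {subset L m <= L n}.
  move=> /subnK <-; elim: (n - m)%N => [|k IH] // p /IH; rewrite addSn LS.
  by rewrite mem_rcons in_cons => ->; rewrite orbT.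
have Llt m n : (m < n)%N -> f (L m) \in L n.
  by move=> mn; apply: (Lmono m.+1 n mn); rewrite LS mem_rcons mem_head.
have Gideal n : is_ideal (poly_over A) (G (L n)).
  by apply: gen_idealP => //; apply: subset_trans (LJ n) _; case: iJ.
have szmono m n : (m <= n)%N -> (size (f (L m)) <= size (f (L n)))%N.
  move=> mn; case: (fP _ (LJ m)) => _ _; apply; case: (fP _ (LJ n)) => // _ + _.
  apply: contra_not; apply: gen_ideal_min => // p pm.
  by apply: sub_gen_ideal; exact: (Lmono _ _ mn).
pose a n := lead_coef (f (L n)).
have Aa n : A (a n).
  have [Jf _ _] := fP _ (LJ n); case: iJ => JA _ _ _; exact: (JA _ Jf).
pose H n := gen_ideal A [set a i | i in [set i | (i < n)%N]].
have Hideal n : is_ideal A (H n) by apply: gen_idealP => // _ [i _ <-].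
have Hmono m n : (m <= n)%N -> H m `<=` H n.
  move=> mn; apply: gen_ideal_min => // _ [i /= im <-].
  by apply: sub_gen_ideal; exists i => //=; apply: leq_trans mn.
have [t [tH Ht]] := nA _ (ideal_bigcup Hideal Hmono).
have [N tN] : exists N, [set` t] `<=` H N.
  elim: t tH {Ht} => [|x t IH] tH; first by exists 0%N.
  have [|N tN] := IH; first by move=> y yt; apply: tH; rewrite /= in_cons yt orbT.
  have [M _ HM] := tH x (mem_head x t).
  exists (maxn M N) => y /=; rewrite in_cons => /orP[/eqP->|/tN yN].
    by apply: Hmono HM; rewrite leq_maxl.
  by apply: Hmono yN; rewrite leq_maxr.
have HaN : H N (a N).
  apply: Ht tN _ _ => //; exists N.+1 => //.
  by apply: sub_gen_ideal; exists N => /=.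
have [JfN GfN fNmin] := fP _ (LJ N).
(* These are the coefficients that elements of [G (L N)] of bounded size have in the top position of
   [f (L N)]. Sizes do not decrease, so each earlier [f (L i)] can be shifted by a power of ['X] to
   put [a i] there. *)
pose K := [set x | exists p, [/\ G (L N) p, (size p <= size (f (L N)))%N
  & p`_(size (f (L N))).-1 = x]].
have [GA G0 GD GM] := Gideal N.
have iK : is_ideal A K.
  split.
  - by move=> x [p [/GA Gp _ <-]]; apply: Gp.
  - by exists 0; rewrite size_poly0 coef0.
  - move=> x y [p [Gp sp <-]] [q [Gq sq <-]]; exists (p + q).
    rewrite coefD; split=> //; first exact: GD.
    by rewrite (leq_trans (size_polyD _ _)) // geq_max sp.
  - move=> c x Ac [p [Gp sp <-]]; exists (c%:P * p); rewrite coefCM; split=> //.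
      by apply: GM => //; apply: poly_overC.
    by rewrite mul_polyC (leq_trans (size_scale_leq _ _)).
have [p [Gp sp pE]] : K (a N).
  apply: HaN; split => // _ [i /= iN <-].
  have szi := szmono _ _ (ltnW iN).
  have [Jfi Gfi _] := fP _ (LJ i).
  have fi0 : f (L i) != 0.
    by apply: contra_notN Gfi => /eqP ->; case: (Gideal i).
  have szi0 : (0 < size (f (L i)))%N by rewrite size_poly_gt0.
  exists ('X^(size (f (L N)) - size (f (L i))) * f (L i)); split.
  - by apply: GM; [apply: poly_overXn|apply: sub_gen_ideal; apply: Llt].
  - by rewrite mulrC size_mulXn // subnK.
  - rewrite coefXnM ifN; last by rewrite -leqNgt; lia.
    by rewrite /a lead_coefE; congr (_`__); lia.
have iG := Gideal N.
have fN0 : f (L N) != 0 by apply: contra_notN GfN => /eqP ->.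
have szN0 : (0 < size (f (L N)))%N by rewrite size_poly_gt0.
have : (size (f (L N)) <= size (f (L N) - p)%R)%N.
  apply: fNmin.
    apply: (idealB sAX iJ) => //; apply: Gp; split => //.
  apply: contra_not GfN => Gfp; rewrite -[f (L N)](subrK p); exact: GD.
rewrite leqNgt => /negP; apply.
rewrite -(prednK szN0) ltnS; apply/leq_sizeP => j.
rewrite leq_eqVlt => /orP[/eqP <-|jlt]; rewrite coefB.
  by rewrite pE /a lead_coefE subrr.
have szj : (size (f (L N)) <= j)%N by rewrite -(prednK szN0).
by rewrite !nth_default ?subrr // (leq_trans sp).
Qed.

End Hilbert.

(** * Local rings *)

Lemma noetherian_image (T T' : comNzRingType) (h : {rmorphism T -> T'}) (A : set T) :
  is_subring A -> noetherian A -> noetherian (h @` A).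
Proof.
move=> sA nA I [IA I0 ID IM].
have [|s [sI Is]] := nA [set x | A x /\ I (h x)].
  split=> [x []//||x y [Ax Ix] [Ay Iy]|a x Aa [Ax Ix]] /=.
  - by rewrite rmorph0; split=> //; apply: subring0.
  - by rewrite rmorphD; split; [apply: subringD|apply: ID].
  - by rewrite rmorphM; split; [apply: subringM|apply: IM => //; exists a].
exists (map h s); split=> [_ /mapP[x xs ->]|J [JA J0 JD JM] sJ y Iy].
  by case: (sI x xs).
have [x Ax hx] := IA _ Iy; rewrite -hx.
suff: [set x | A x /\ J (h x)] x by case.
apply: Is; last by split=> //; rewrite /= hx.
- split=> [z []//||u v [Au Ju] [Av Jv]|a u Aa [Au Ju]] /=.
  + by rewrite rmorph0; split=> //; apply: subring0.
  + by rewrite rmorphD; split; [apply: subringD|apply: JD].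
  + by rewrite rmorphM; split; [apply: subringM|apply: JM => //; exists a].
- by move=> z zs; split; [case: (sI z zs)|apply: sJ; apply: map_f].
Qed.

Lemma gen_subring_adjoin (T : comNzRingType) (A : set T) (x : T) :
  is_subring A -> gen_subring (A `|` [set x]) = horner_eval x @` poly_over A.
Proof.
move=> sA; have sAX := poly_over_subring sA; apply/seteqP; split.
  apply: gen_subring_min.
    split=> [|_ _ [p Ap <-] [q Aq <-]|_ _ [p Ap <-] [q Aq <-]].
    - by exists 1; [exact: (subring1 sAX)|rewrite rmorph1].
    - by exists (p - q); [exact: (subringB sAX)|rewrite rmorphB].
    - by exists (p * q); [exact: (subringM sAX)|rewrite rmorphM].
  move=> y [Ay|->]; first by exists y%:P; [apply: poly_overC|rewrite /horner_eval hornerC].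
  by exists 'X; [apply: (poly_overXn 1)|rewrite /horner_eval hornerX].
move=> _ [p Ap <-]; rewrite /horner_eval horner_coef.
have sG := gen_subringP (A `|` [set x]).
apply: (subring_sum _ sG) => i _; apply: (subringM sG).
  by apply: sub_gen_subring; left.
by apply: (subringX _ sG); apply: sub_gen_subring; right.
Qed.

Lemma generates_nil (T : comNzRingType) (A : set T) : generates A [::] [set 0].
Proof. by split=> // J [_ J0 _ _] _ _ ->. Qed.

Section LocalRings.
Variables (k K : fieldType) (iota : {rmorphism k -> K}).
Implicit Types (A P Q E V p I : set K).

Lemma gen_subalgP (S : set K) : is_subring (gen_subalg iota S).
Proof. exact: gen_subringP. Qed.

Lemma iota_gen_subalg (S : set K) : range iota `<=` gen_subalg iota S.
Proof. by move=> x ix; apply: sub_gen_subring; left. Qed.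

Lemma sub_gen_subalg (S : set K) : S `<=` gen_subalg iota S.
Proof. by move=> x ix; apply: sub_gen_subring; right. Qed.

Lemma gen_subalg_min (S A : set K) :
  is_subring A -> range iota `<=` A -> S `<=` A -> gen_subalg iota S `<=` A.
Proof. by move=> sA iA SA; apply: gen_subring_min => // x [/iA|/SA]. Qed.

(** Induction on [s]: the image of [k] is a field, and each adjunction is a homomorphic image of a
    polynomial ring over the previous algebra. *)
Lemma gen_subalg_noetherian (s : seq K) : noetherian (gen_subalg iota [set` s]).
Proof.
elim: s => [|x s IH].
  have -> : gen_subalg iota [set` [::]] = range iota.
    apply/seteqP; split; last exact: iota_gen_subalg.
    apply: gen_subalg_min => //.
    split=> [|_ _ [a _ <-] [b _ <-]|_ _ [a _ <-] [b _ <-]].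
    - by exists 1; rewrite // rmorph1.
    - by exists (a - b); rewrite // rmorphB.
    - by exists (a * b); rewrite // rmorphM.
  move=> I iI; have [I0|] := pselect (I = [set 0]).
    by rewrite I0; exists [::]; apply: generates_nil.
  move=> nI0; have [x Ix x0] : exists2 x, I x & x != 0.
    apply: contrapT => H; apply: nI0; apply/seteqP; split=> [x Ix /=|_ ->].
      by apply/eqP; apply: contrapT => /negP x0; apply: H; exists x.
    by case: iI.
  have [IA _ _ IM] := iI.
  have [a _ ax] := IA _ Ix.
  exists [:: x]; split=> [y|J [_ _ _ JM] xJ y Iy]; first by rewrite /= inE => /eqP ->.
  have [b _ by_] := IA _ Iy.
  rewrite -(divfK x0 y); apply: JM; last by apply: xJ; rewrite /= inE.
  by rewrite -by_ -ax -fmorph_div; exists (b / a).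
have -> : gen_subalg iota [set` x :: s] =
    gen_subring (gen_subalg iota [set` s] `|` [set x]).
  apply/seteqP; split.
    apply: gen_subalg_min; first exact: gen_subringP.
      by move=> y iy; apply: sub_gen_subring; left; apply: iota_gen_subalg.
    move=> y /=; rewrite in_cons => /orP[/eqP ->|ys]; apply: sub_gen_subring.
      by right.
    by left; apply: sub_gen_subalg.
  apply: gen_subring_min; first exact: gen_subalgP.
  move=> y [|->]; last by apply: sub_gen_subalg; rewrite /= mem_head.
  apply: gen_subalg_min; [exact: gen_subalgP|exact: iota_gen_subalg|].
  by move=> z zs; apply: sub_gen_subalg; rewrite /= in_cons zs orbT.
rewrite gen_subring_adjoin; last exact: gen_subalgP.
have sA := gen_subalgP [set` s].
apply: noetherian_image; first exact: poly_over_subring.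
exact: hilbert_basis.
Qed.

(** Additivity is what makes the non-units an ideal: multiples of a non-unit are non-units in any
    subring, by [maxidealM]. *)
Definition local_ring P : Prop :=
  is_subring P /\ forall x y, maxideal P x -> maxideal P y -> maxideal P (x + y).

Lemma sub_maxideal P : maxideal P `<=` P. Proof. by move=> x []. Qed.

Lemma nonmaxP P x : is_subring P -> P x -> (~ maxideal P x) <-> (x != 0 /\ P x^-1).
Proof.
move=> sP Px; split=> [mx|[x0 Pv] [_ [xe0|//]]]; last by rewrite xe0 eqxx in x0.
have x0 : x != 0 by apply: contra_notN mx => /eqP ->; split; [exact: subring0|left].
by split=> //; apply: contrapT => Pv; apply: mx; split; [|right].
Qed.

Lemma maxideal0 P : is_subring P -> maxideal P 0.
Proof. by move=> sP; split; [exact: subring0|left]. Qed.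

Lemma maxideal1 P : is_subring P -> ~ maxideal P 1.
Proof.
by move=> sP; apply/nonmaxP; rewrite ?oner_neq0 ?invr1 //; [exact: subring1|split=> //; exact: subring1].
Qed.

Lemma maxidealM P a x : is_subring P -> P a -> maxideal P x -> maxideal P (a * x).
Proof.
move=> sP Pa mx; have Px := sub_maxideal mx.
apply: contrapT => /(nonmaxP sP (subringM sP Pa Px))[].
rewrite mulf_eq0 negb_or => /andP[a0 x0] Pax; move: mx; apply/nonmaxP => //; split=> //.
by rewrite (_ : x^-1 = a * (a * x)^-1); [apply: subringM|rewrite invfM mulVKf].
Qed.

Lemma local_prime P : local_ring P -> prime_ideal P (maxideal P).
Proof.
move=> [sP mD]; split=> //; first exact: sub_maxideal.
- by split=> //; apply: maxideal0.
- by move=> a x; apply: maxidealM.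
- exact: maxideal1.
- move=> x y Px Py mxy; apply: contrapT => /not_orP[].
  move=> /(nonmaxP sP Px)[x0 Pxv] /(nonmaxP sP Py)[y0 Pyv]; move: mxy.
  apply/nonmaxP => //; first exact: subringM.
  by rewrite mulf_neq0 // invfM; split=> //; apply: subringM.
Qed.

Section Localization.
Variables (A p : set K).
Hypotheses (sA : is_subring A) (pp : prime_ideal A p).

Let p_neq0 b : ~ p b -> b != 0.
Proof. by move=> pb; apply: contra_notN pb => /eqP ->; case: pp => _ []. Qed.

Let p_mul b c : A b -> A c -> ~ p b -> ~ p c -> ~ p (b * c).
Proof. by case: pp => _ _ _ _ pM Ab Ac pb pc /pM[]. Qed.

Lemma sub_localization : A `<=` localization A p.
Proof.
move=> a Aa; exists a, 1; rewrite divr1; split=> //; first exact: subring1.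
by case: pp.
Qed.

Lemma localization_subring : is_subring (localization A p).
Proof.
split; first by apply: sub_localization; apply: subring1.
- move=> _ _ [a [b [Aa Ab pb ->]]] [c [d [Ac Ad pd ->]]].
  exists (a * d - c * b), (b * d); split; first by apply: subringB => //; apply: subringM.
  + exact: subringM.
  + exact: p_mul.
  + by rewrite -mulNr addf_div ?p_neq0 // mulNr.
- move=> _ _ [a [b [Aa Ab pb ->]]] [c [d [Ac Ad pd ->]]].
  exists (a * c), (b * d); split; [exact: subringM|exact: subringM|exact: p_mul|].
  by rewrite mulf_div.
Qed.

Lemma maxideal_localizationP x : maxideal (localization A p) x <->
  exists a b, [/\ p a, A b, ~ p b & x = a / b].
Proof.
have sL := localization_subring; have [pA [p0 _] pM _ pP] := pp.
split=> [[[a [b [Aa Ab pb ->]]] m]|[a [b [pa Ab pb ->]]]].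
  exists a, b; split=> //; apply: contrapT => pa; case: m => [/eqP|].
    by rewrite mulf_eq0 invr_eq0 (negbTE (p_neq0 pa)) (negbTE (p_neq0 pb)).
  by apply; rewrite invf_div; exists b, a.
apply: contrapT; move/(nonmaxP sL _); case.
  by exists a, b; split=> //; apply: pA.
rewrite mulf_eq0 invr_eq0 negb_or invf_div => /andP[a0 b0] [c [d [Ac Ad pd /eqP]]].
rewrite (eqr_div _ _ a0 (p_neq0 pd)) => /eqP bd.
have : p (b * d) by rewrite bd; apply: pM.
exact: p_mul.
Qed.

Lemma localization_local : local_ring (localization A p).
Proof.
have [pA [p0 pD] pM _ pP] := pp.
split; first exact: localization_subring.
move=> x y /maxideal_localizationP[a [b [pa Ab pb ->]]].
move=> /maxideal_localizationP[c [d [pc Ad pd ->]]].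
apply/maxideal_localizationP; exists (a * d + c * b), (b * d); split.
- by apply: pD; rewrite mulrC; apply: pM.
- exact: subringM.
- exact: p_mul.
- by rewrite addf_div ?p_neq0.
Qed.

Lemma maxideal_localization_cap : A `&` maxideal (localization A p) = p.
Proof.
have [pA [p0 pD] pM p1 pP] := pp.
apply/seteqP; split=> [x [Ax /maxideal_localizationP[a [b [pa Ab pb xE]]]]|x px].
  have : p (x * b) by rewrite xE divfK // p_neq0.
  by case/pP.
split; first exact: pA.
by apply/maxideal_localizationP; exists x, 1; rewrite divr1; split=> //; exact: subring1.
Qed.

Lemma localization_noetherian : noetherian A -> noetherian (localization A p).
Proof.
have [pA [p0 pD] pM p1 pP] := pp; have sL := localization_subring.
move=> nA I [IL I0 ID IM].
have cap J : is_ideal (localization A p) J -> is_ideal A (A `&` J).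
  move=> [JL J0 JD JM]; split=> [x []//||x y [Ax Jx] [Ay Jy]|a x Aa [Ax Jx]].
  - by split=> //; apply: subring0.
  - by split; [apply: subringD|apply: JD].
  - by split; [apply: subringM|apply: JM => //; apply: sub_localization].
have [s [sI Is]] := nA _ (cap I (And4 IL I0 ID IM)).
exists s; split=> [x /sI[]//|J iJ sJ x Ix].
have [a [b [Aa Ab pb xE]]] := IL _ Ix.
have [JL J0 JD JM] := iJ.
have /(Is _ (cap J iJ))[] : (A `&` I) a.
- split=> //; rewrite (_ : a = b * x).
    by apply: IM => //; apply: sub_localization.
  by rewrite xE mulrC divfK // p_neq0.
- by move=> y ys; split; [case: (sI y ys)|apply: sJ].
move=> _ Ja; rewrite xE mulrC; apply: JM => //.
by exists 1, b; rewrite div1r; split=> //; exact: subring1.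
Qed.

End Localization.

Lemma Spec_local A P : is_subring A -> Spec A P -> local_ring P.
Proof. by move=> sA [p pp ->]; apply: localization_local. Qed.

Lemma Spec_subring A P : is_subring A -> Spec A P -> is_subring P.
Proof. by move=> sA /Spec_local[]. Qed.

Lemma Spec_sub A P : is_subring A -> Spec A P -> A `<=` P.
Proof. by move=> sA [p pp ->]; apply: sub_localization. Qed.

Lemma Spec_frac A P x : is_subring A -> Spec A P -> P x ->
  exists a b, [/\ A a, A b, ~ maxideal P b & x = a / b].
Proof.
move=> sA [p pp ->] [a [b [Aa Ab pb ->]]]; exists a, b; split=> //.
by rewrite -[X in ~ X _](maxideal_localization_cap sA pp) in pb => mb; apply: pb.
Qed.

Lemma cap_maxideal_prime A Q : is_subring A -> local_ring Q -> A `<=` Q ->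
  prime_ideal A (A `&` maxideal Q).
Proof.
move=> sA lQ AQ; have [sQ mD] := lQ; have [_ [m0 _] mM m1 mP] := local_prime lQ.
split=> [x []//|||[_ /m1]//|].
- split=> [|x y [Ax mx] [Ay my]]; first by split=> //; apply: subring0.
  by split; [apply: subringD|apply: mD].
- by move=> a x Aa [Ax mx]; split; [apply: subringM|apply: mM => //; apply: AQ].
- by move=> x y Ax Ay [_ /mP[]]; [exact: AQ|exact: AQ|left|right].
Qed.

Lemma Spec_capE A P : is_subring A -> Spec A P ->
  P = localization A (A `&` maxideal P).
Proof. by move=> sA [p pp ->]; rewrite maxideal_localization_cap. Qed.

(** Elements of [A] outside the contracted maximal ideal are units of [Q], so the localization
    embeds in [Q]. This produces the centers of valuations and of points of the model. *)
Lemma center_Spec A Q : is_subring A -> local_ring Q -> A `<=` Q ->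
  let P := localization A (A `&` maxideal Q) in Spec A P /\ dominates Q P.
Proof.
move=> sA lQ AQ P; have pp := cap_maxideal_prime sA lQ AQ.
have [sQ mD] := lQ.
have QP : P `<=` Q.
  move=> _ [a [b [Aa Ab mb ->]]]; apply: subringM => //; first exact: AQ.
  by case/(nonmaxP sQ (AQ _ Ab)): (fun m => mb (conj Ab m)).
split; first by exists (A `&` maxideal Q).
split=> // x /(maxideal_localizationP sA pp)[a [b [[Aa ma] Ab mb ->]]].
rewrite mulrC; apply: maxidealM => //.
by case/(nonmaxP sQ (AQ _ Ab)): (fun m => mb (conj Ab m)).
Qed.

Lemma dominates_trans P Q E : dominates E Q -> dominates Q P -> dominates E P.
Proof.
by move=> [QE mQE] [PQ mPQ]; split; [exact: subset_trans QE|exact: subset_trans mQE].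
Qed.

Lemma dominates_maxideal P Q x : local_ring P -> local_ring Q -> dominates Q P -> P x ->
  maxideal Q x <-> maxideal P x.
Proof.
move=> [sP _] [sQ _] [PQ mPQ] Px; split=> [mx|/mPQ//].
apply: contrapT => /(nonmaxP sP Px)[x0 /PQ Qv]; move: mx.
by apply/(nonmaxP sQ (PQ _ Px)).
Qed.

Lemma noetherian_Spec A P : affine_ring iota A -> Spec A P -> noetherian P.
Proof.
move=> [[s ->] _] [p pp ->]; apply: localization_noetherian => //.
  exact: gen_subalgP.
exact: gen_subalg_noetherian.
Qed.

Lemma affine_subring A : affine_ring iota A -> is_subring A.
Proof. by move=> [[s ->] _]; apply: gen_subalgP. Qed.

Lemma affine_iota A : affine_ring iota A -> range iota `<=` A.
Proof. by move=> [[s ->] _]; apply: iota_gen_subalg. Qed.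

End LocalRings.

(** * Discrete valuation rings *)

Lemma generates_span (T : comNzRingType) (A I : set T) (s : seq T) :
  is_subring A -> is_ideal A I -> generates A s I -> forall x, I x ->
  exists2 c : 'I_(size s) -> T, forall i, A (c i) & x = \sum_i c i * s`_i.
Proof.
move=> sA [IA I0 ID IM] [sI Is] x Ix.
pose J := [set x | exists2 c : 'I_(size s) -> T,
  forall i, A (c i) & x = \sum_i c i * s`_i].
apply: (Is J) => //; first split.
- move=> _ [c Ac ->]; apply: (subring_sum _ sA) => i _; apply: subringM => //.
  by apply/IA/sI; rewrite /= mem_nth.
- exists (fun=> 0); first by move=> i; apply: subring0.
  by rewrite big1 // => i _; rewrite mul0r.
- move=> _ _ [c Ac ->] [d Ad ->]; exists (fun i => c i + d i).
    by move=> i; apply: subringD.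
  by rewrite -big_split; apply: eq_bigr => i _; rewrite mulrDl.
- move=> a _ Aa [c Ac ->]; exists (fun i => a * c i).
    by move=> i; apply: subringM.
  by rewrite mulr_sumr; apply: eq_bigr => i _; rewrite mulrA.
- move=> y /(nthP 0)[i si <-]; exists (fun j => (j == Ordinal si)%:R).
    by move=> j; case: (_ == _); [apply: subring1|apply: subring0].
  by rewrite (bigD1 (Ordinal si)) //= eqxx mul1r big1 ?addr0 // => j /negbTE->; rewrite mul0r.
Qed.

Section DVR.
Variables (k K : fieldType) (iota : {rmorphism k -> K}).
Implicit Types (A P Q E V p I : set K).

Lemma char_poly_over A n (M : 'M[K]_n) : is_subring A -> (forall i j, A (M i j)) ->
  poly_over A (char_poly M).
Proof.
move=> sA AM; have sAX := poly_over_subring sA.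
rewrite /char_poly /determinant; apply: (subring_sum _ sAX) => s _.
apply: (subringM sAX).
  by apply: (subringX _ sAX); apply: (subringN sAX); apply: (subring1 sAX).
apply: (subring_prod _ sAX) => i _; rewrite !mxE; apply: (subringB sAX).
  case: (_ == _); first by rewrite mulr1n; apply: (poly_overXn 1).
  by rewrite mulr0n; apply: (subring0 sAX).
exact: poly_overC.
Qed.

(* The determinant trick. *)
Lemma integral_of_ideal A I y : is_subring A -> noetherian A -> integrally_closed A ->
  is_ideal A I -> I <> [set 0] -> (forall x, I x -> I (y * x)) -> A y.
Proof.
move=> sA nA icA iI In0 yI; have [s gs] := nA _ iI.
have [sI Is] := gs; have [IA I0 ID IM] := iI.
have [c cA cE] : exists2 c : 'I_(size s) -> 'I_(size s) -> K,
    forall i j, A (c i j) & forall i : 'I_(size s), y * s`_i = \sum_j c i j * s`_j.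
  have H (i : 'I_(size s)) : exists c : 'I_(size s) -> K,
      (forall j, A (c j)) /\ y * s`_i = \sum_j c j * s`_j.
    have [|c cA cE] := generates_span sA iI gs (x := y * s`_i); last by exists c.
    by apply/yI/sI; rewrite /= mem_nth.
  have [c cP] := choice H.
  by exists c => i; case: (cP i).
pose M := \matrix_(i, j < size s) c j i.
pose v := \row_(i < size s) s`_i.
apply: (icA y (char_poly M)); first exact: char_poly_monic.
  by apply: char_poly_over => // i j; rewrite mxE.
rewrite -eigenvalue_root_char; apply/eigenvalueP; exists v.
  apply/rowP => i; rewrite !mxE cE; apply: eq_bigr => j _.
  by rewrite !mxE mulrC.
apply: contra_notN In0 => /eqP v0; apply/seteqP; split=> [x Ix|_ ->//].
apply: Is Ix; first by split=> [_ ->||_ _ -> ->|a _ _ ->] //=; rewrite ?addr0 ?mulr0 //; apply: subring0.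
move=> z /(nthP 0)[i si <-] /=; have /rowP/(_ (Ordinal si)) := v0.
by rewrite !mxE.
Qed.

(** A maximal one among the annihilators of the nonzero multiples [c * x] in the module K/A is
    prime. *)
Lemma exists_associated_prime A x : is_subring A -> noetherian A -> ~ A x ->
  exists c, [/\ A c, ~ A (c * x) & prime_ideal A [set e | A e /\ A (e * (c * x))]].
Proof.
move=> sA nA Ax.
pose ann c := [set e | A e /\ A (e * (c * x))].
pose F := [set I | exists c, [/\ A c, ~ A (c * x) & I = ann c]].
have iann c : A c -> is_ideal A (ann c).
  move=> Ac; split=> [e []//||e f [Ae ex] [Af fx]|a e Aa [Ae ex]].
  - by split; rewrite ?mul0r; apply: subring0.
  - by split; rewrite ?mulrDl; apply: subringD.
  - by split; rewrite -?mulrA; apply: subringM.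
have [|| _ [c [Ac cx ->]] cmax] := noetherian_max nA (F := F).
- by move=> _ [c [Ac _ ->]]; apply: iann.
- by exists (ann 1), 1; split=> //; [apply: subring1|rewrite mul1r].
exists c; split=> //; have [annA ann0 annD annM] := iann c Ac.
split=> //; first by case; rewrite mul1r.
move=> u v Au Av [_ uvx]; apply: contrapT => /not_orP[nu nv].
have Auc : A (u * c) by apply: subringM.
have ucx : ~ A (u * c * x) by rewrite -mulrA => H; apply: nu.
have annE : ann (u * c) = ann c.
  apply: cmax; first by exists (u * c).
  by move=> e [Ae ex]; split=> //; rewrite -mulrA mulrCA; apply: subringM.
suff /[!annE] : ann (u * c) v by [].
by split=> //; rewrite -mulrA mulrCA mulrA.
Qed.

(** Phrased by factorization through one uniformizer, which is the shape that [ord] inspects. *)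
Definition dvr E : Prop :=
  [/\ is_subring E
    & exists t, [/\ t != 0, maxideal E = [set t * a | a in E]
    & forall x, x != 0 -> exists u (n : int), [/\ E u, E u^-1, u != 0 & x = u * t ^ n]]].

(** If [y] carried the maximal ideal into itself, the determinant trick would make it integral and
    hence an element of [E]. So some [y * z] is a unit, and [y^-1] generates the maximal ideal. *)
Lemma dvr_criterion E y : local_ring E -> noetherian E -> integrally_closed E ->
  fraction_field E = setT -> maxideal E <> [set 0] -> ~ E y ->
  (forall m, maxideal E m -> E (y * m)) -> dvr E.
Proof.
move=> lE nE icE frE mn0 Ey ym; have [sE mD] := lE.
have [_ [m0 _] mM m1 mP] := local_prime lE.
have iM : is_ideal E (maxideal E) by split=> //; apply: sub_maxideal.
have [z [mz ymz]] : exists z, maxideal E z /\ ~ maxideal E (y * z).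
  apply: contrapT => H; apply: Ey; apply: (integral_of_ideal sE nE icE iM mn0) => x mx.
  by apply: contrapT => myx; apply: H; exists x.
have [yz0 Eyzv] := (nonmaxP sE (ym _ mz)).1 ymz.
have y0 : y != 0 by apply: contra_neq yz0 => ->; rewrite mul0r.
have mt : maxideal E y^-1.
  rewrite (_ : y^-1 = (y * z)^-1 * z); first by apply: mM.
  by rewrite invfM -mulrA mulVf ?mulr1 //; apply: contra_neq yz0 => ->; rewrite mulr0.
have mE : maxideal E = [set y^-1 * a | a in E].
  apply/seteqP; split=> [x mx|_ [a Ea <-]]; last by rewrite mulrC; apply: mM.
  by exists (y * x); [apply: ym|rewrite mulKf].
split=> //; exists y^-1; split; rewrite ?invr_eq0 //.
have Efac a : E a -> a != 0 -> exists u (n : nat),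
    [/\ E u, E u^-1, u != 0 & a = u * y^-1 ^+ n].
  move=> Ea a0.
  pose I b := [set b * e | e in E].
  have iI b : E b -> is_ideal E (I b).
    move=> Eb; split=> [_ [e Ee <-]||_ _ [e Ee <-] [f Ef <-]|c _ Ec [e Ee <-]].
    - exact: subringM.
    - by exists 0; rewrite ?mulr0 //; apply: subring0.
    - by exists (e + f); rewrite ?mulrDr //; apply: subringD.
    - by exists (c * e); [apply: subringM|rewrite mulrCA].
  (* The ideals generated by [a * y ^+ n] increase while they stay inside [E]. At a maximal one the
     generator is a unit, since otherwise one more factor [y] would give the same ideal and put [y]
     in [E]. *)
  pose F := [set J | exists n, E (a * y ^+ n) /\ J = I (a * y ^+ n)].
  have [|| _ [n [En ->]] nmax] := noetherian_max nE (F := F).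
  - by move=> _ [n [En ->]]; apply: iI.
  - by exists (I a), 0%N; rewrite expr0 mulr1.
  have u0 : a * y ^+ n != 0 by rewrite mulf_neq0 // expf_neq0.
  have aE : a = a * y ^+ n * y^-1 ^+ n by rewrite exprVn mulfK // expf_neq0.
  have [mu|/(nonmaxP sE En)[_ Euv]] := pselect (maxideal E (a * y ^+ n)); last first.
    by exists (a * y ^+ n), n.
  have En1 : E (a * y ^+ n.+1) by rewrite exprSr mulrA mulrC; apply: ym.
  have IE : I (a * y ^+ n.+1) = I (a * y ^+ n).
    apply: nmax; first by exists n.+1.
    move=> _ [e Ee <-]; exists (y^-1 * e); first by apply: subringM => //; apply: sub_maxideal.
    by rewrite exprSr; field.
  have : I (a * y ^+ n.+1) (a * y ^+ n.+1) by exists 1; rewrite ?mulr1 //; apply: subring1.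
  rewrite IE => -[e Ee]; rewrite exprSr mulrA => /(mulfI u0) ye.
  by case: Ey; rewrite -ye.
move=> x x0; have [a [b [Ea Eb b0 xE]]] : fraction_field E x by rewrite frE.
have a0 : a != 0 by apply: contra_neq x0 => a0; rewrite xE a0 mul0r.
have [u [n [Eu Euv u0 aE]]] := Efac a Ea a0.
have [v [m [Ev Evv v0 bE]]] := Efac b Eb b0.
exists (u / v), (n%:Z - m%:Z); split.
- exact: subringM.
- by rewrite invf_div; apply: subringM.
- by rewrite mulf_neq0 // invr_eq0.
- by rewrite xE aE bE expfzDr ?invr_eq0 // -exprnN -exprnP invfM mulrACA.
Qed.

Lemma unit_exprz E u (n : int) : is_subring E -> E u -> E u^-1 -> E (u ^ n).
Proof.
by move=> sE Eu Euv; case: n => n; rewrite ?NegzE -?exprnN -?exprVn; apply: subringX.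
Qed.

Section Order.
Variable E : set K.
Hypothesis dE : dvr E.
Let sE : is_subring E. Proof. by case: dE. Qed.

Let ord_ge0_aux (t u : K) (n : int) :
  t != 0 -> maxideal E = [set t * a | a in E] -> u != 0 -> E u -> E u^-1 ->
  E (u * t ^ n) <-> 0 <= n.
Proof.
move=> t0 mE u0 Eu Euv.
have mt : maxideal E t by rewrite mE; exists 1; rewrite ?mulr1 //; apply: subring1.
have Et := sub_maxideal mt.
split=> [Ex|]; last by case: n => // n _; apply: subringM => //; apply: subringX.
case: n Ex => // n; rewrite NegzE -exprnN => Ex; exfalso; move: mt.
apply/(nonmaxP sE Et); split=> //.
have : E (u^-1 * (u / t ^+ n.+1) * t ^+ n) by apply: subringM; [|apply: subringM|apply: subringX].
by congr E; rewrite exprSr; field; rewrite u0 t0 expf_neq0.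
Qed.

(** Two uniformizers differ by a unit, so the exponent is independent of the choice and the [xget]
    in [ord] returns it. *)
Lemma ord_uniq (t u : K) (n : int) :
  t != 0 -> maxideal E = [set t * a | a in E] -> E u -> E u^-1 -> u != 0 ->
  ord E (u * t ^ n) = n.
Proof.
move=> t0 mE Eu Euv u0; apply: xget_subset1; first by exists t, u.
have aux : forall (m l : int) (t u t' u' : K), t != 0 -> maxideal E = [set t * a | a in E] ->
    E u -> E u^-1 -> u != 0 -> t' != 0 -> maxideal E = [set t' * a | a in E] ->
    E u' -> E u'^-1 -> u' != 0 -> u * t ^ m = u' * t' ^ l -> l <= m.
  move=> m l {}t {}u t' u' {}t0 {}mE {}Eu {}Euv {}u0 t'0 mE' Eu' Eu'v u'0 eq.
  have [e Ee tE] : exists2 e, E e & t * e = t'.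
    suff : maxideal E t' by rewrite mE.
    by rewrite mE'; exists 1; rewrite ?mulr1 //; apply: subring1.
  have [f Ef t'E] : exists2 e, E e & t' * e = t.
    suff : maxideal E t by rewrite mE'.
    by rewrite mE; exists 1; rewrite ?mulr1 //; apply: subring1.
  have e0 : e != 0 by apply: contra_neq t'0 => e0; rewrite -tE e0 mulr0.
  have Eev : E e^-1.
    suff -> : e^-1 = f by [].
    apply: (mulfI t'0); rewrite t'E -{1}tE; exact: mulfK.
  rewrite -subr_ge0 -(ord_ge0_aux (m - l) t0 mE u0 Eu Euv).
  rewrite expfzDr // mulrA eq -tE exprzMl ?unitfE //.
  rewrite [t ^ l * _]mulrC mulrA -mulrA -expfzDr // subrr expr0z mulr1.
  by apply: subringM => //; apply: unit_exprz.
move=> m l [t1 [u1 [t10 mE1 [Eu1 Euv1] u10 ->]]] [t2 [u2 [t20 mE2 [Eu2 Euv2] u20 e]]].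
apply/eqP; rewrite eq_le; apply/andP; split; first exact: (aux _ _ t2 u2 t1 u1).
exact: (aux _ _ t1 u1 t2 u2).
Qed.

Lemma dvr_uniformizer : exists2 t, t != 0 /\ maxideal E = [set t * a | a in E] &
  forall x, x != 0 -> exists u, [/\ E u, E u^-1, u != 0 & x = u * t ^ (ord E x)].
Proof.
have [_ [t [t0 mE tP]]] := dE; exists t => // x x0.
have [u [n [Eu Euv u0 xE]]] := tP x x0.
by exists u; split=> //; rewrite {2}xE ord_uniq.
Qed.

Lemma ordM x y : x != 0 -> y != 0 -> ord E (x * y) = ord E x + ord E y.
Proof.
have [t [t0 mE] tP] := dvr_uniformizer => x0 y0.
have [u [Eu Euv u0 xE]] := tP x x0; have [v [Ev Evv v0 yE]] := tP y y0.
rewrite {1}xE {1}yE mulrACA -expfzDr // ord_uniq //.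
- exact: subringM.
- by rewrite invfM; apply: subringM.
- exact: mulf_neq0.
Qed.

Lemma ord1 : ord E 1 = 0.
Proof.
by apply: (@addrI _ (ord E 1)); rewrite addr0 -ordM ?oner_neq0 // mulr1.
Qed.

Lemma ordV x : x != 0 -> ord E x^-1 = - ord E x.
Proof.
move=> x0; apply: (@addrI _ (ord E x)).
by rewrite subrr -ordM ?invr_eq0 // mulfV // ord1.
Qed.

Lemma ordX x n : x != 0 -> ord E (x ^+ n) = ord E x *+ n.
Proof.
move=> x0; elim: n => [|n IH]; first by rewrite expr0 ord1 mulr0n.
by rewrite exprS ordM ?expf_neq0 // IH mulrS.
Qed.

Lemma ord_ge0 x : x != 0 -> (0 <= ord E x) <-> E x.
Proof.
have [t [t0 mE] tP] := dvr_uniformizer => x0.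
have [u [Eu Euv u0 xE]] := tP x x0.
by rewrite -(ord_ge0_aux (ord E x) t0 mE u0 Eu Euv) -xE.
Qed.

Lemma ord_gt0 x : x != 0 -> (0 < ord E x) <-> maxideal E x.
Proof.
move=> x0; split=> [ox|mx].
  have Ex : E x by apply/ord_ge0 => //; apply: ltW.
  apply: contrapT => /(nonmaxP sE Ex)[_ Exv].
  have : 0 <= ord E x^-1 by apply/ord_ge0; rewrite ?invr_eq0.
  by rewrite ordV // oppr_ge0 leNgt ox.
have Ex := sub_maxideal mx.
have : 0 <= ord E x by apply/ord_ge0.
rewrite le_eqVlt => /orP[/eqP ox|//].
have Exv : E x^-1 by apply/ord_ge0; rewrite ?invr_eq0 // ordV // -ox oppr0.
by exfalso; move: mx; apply/(nonmaxP sE Ex).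
Qed.

Lemma dvr_total x : E x \/ E x^-1.
Proof.
have [->|x0] := eqVneq x 0; first by left; apply: subring0.
have [ox|ox] := leP 0 (ord E x); first by left; apply/ord_ge0.
by right; apply/ord_ge0; rewrite ?invr_eq0 // ordV // oppr_ge0 ltW.
Qed.

Lemma dvr_local : local_ring E.
Proof.
split=> // x y; have [_ [t [_ mE _]]] := dE; rewrite mE => -[a Ea <-] [b Eb <-].
by exists (a + b); [apply: subringD|rewrite mulrDr].
Qed.

Lemma dvr_maxideal_neq0 : maxideal E <> [set 0].
Proof.
have [t [t0 mE] _] := dvr_uniformizer => m0.
have : maxideal E t by rewrite mE; exists 1; rewrite ?mulr1 //; apply: subring1.
by rewrite m0 => /= /eqP; rewrite (negbTE t0).
Qed.

End Order.

End DVR.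

(** * Finiteness of divisors, and normal rings as intersections *)

Section Models.
Variables (k K : fieldType) (iota : {rmorphism k -> K}).
Implicit Types (A P Q E V p I : set K) (X Y U : set (set K)).

Lemma prime_not_prime A I : is_ideal A I -> ~ I 1 -> ~ prime_ideal A I ->
  exists x y, [/\ A x, A y, I (x * y), ~ I x & ~ I y].
Proof.
move=> [IA I0 ID IM] I1 npI; apply: contrapT => H; apply: npI; split=> //.
move=> x y Ax Ay Ixy; apply: contrapT => /not_orP[nx ny].
by apply: H; exists x, y.
Qed.

Lemma ideal_add A I x : is_subring A -> is_ideal A I -> A x ->
  is_ideal A [set z | exists i a, [/\ I i, A a & z = i + a * x]].
Proof.
move=> sA [IA I0 ID IM] Ax; split.
- move=> _ [i [a [Ii Aa ->]]]; apply: subringD => //; first exact: IA.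
  exact: subringM.
- by exists 0, 0; rewrite mul0r addr0; split=> //; apply: subring0.
- move=> _ _ [i [a [Ii Aa ->]]] [j [b [Ij Ab ->]]]; exists (i + j), (a + b).
  by rewrite mulrDl addrACA; split=> //; [apply: ID|apply: subringD].
- move=> c _ Ac [i [a [Ii Aa ->]]]; exists (c * i), (c * a).
  by rewrite mulrDr mulrA; split=> //; [apply: IM|apply: subringM].
Qed.

(* Noetherian induction: if [x * y] lies in [I], every prime over [I] contains [x] or [y]. *)
Lemma finite_primes_over A I : is_subring A -> noetherian A -> is_ideal A I ->
  exists ps : set (set K), [/\ finite_set ps,
    forall p, ps p -> prime_ideal A p /\ I `<=` p &
    forall p, prime_ideal A p -> I `<=` p -> exists2 q, ps q & q `<=` p].
Proof.
move=> sA nA iI; apply: contrapT => nI.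
pose F := [set I | is_ideal A I /\ ~ exists ps : set (set K), [/\ finite_set ps,
    forall p, ps p -> prime_ideal A p /\ I `<=` p &
    forall p, prime_ideal A p -> I `<=` p -> exists2 q, ps q & q `<=` p]].
have [||J [iJ nJ] Jmax] := noetherian_max nA (F := F); first by move=> J [].
  by exists I.
have step x : A x -> ~ J x -> exists ps : set (set K), [/\ finite_set ps,
    forall p, ps p -> prime_ideal A p /\ J `<=` p &
    forall p, prime_ideal A p -> J `<=` p -> p x -> exists2 q, ps q & q `<=` p].
  move=> Ax nJx; have iJx := ideal_add sA iJ Ax.
  set Jx := (X in is_ideal A X) in iJx.
  have JJx : J `<=` Jx.
    by move=> j Jj; exists j, 0; rewrite mul0r addr0; split=> //; apply: subring0.
  have [FJx|] := pselect (F Jx).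
    exfalso; apply: nJx; rewrite -(Jmax _ FJx JJx).
    by exists 0, 1; rewrite mul1r add0r; split; [case: iJ|apply: subring1|].
  move=> /not_andP[//|/contrapT[ps [fps psP psmin]]]; exists ps; split=> //.
    by move=> p /psP[pp Jxp]; split=> //; apply: subset_trans Jxp.
  move=> p pp Jp px; apply: psmin => // _ [i [a [Ji Aa ->]]].
  by case: pp => _ [_ pD] pM _ _; apply: pD; [apply: Jp|apply: pM].
have [J1|nJ1] := pselect (J 1).
  apply: nJ; exists set0; split=> // p [_ _ _ p1 _] Jp.
  by case: p1; apply: Jp.
have [pJ|npJ] := pselect (prime_ideal A J).
  apply: nJ; exists [set J]; split=> [|_ ->//|p pp Jp]; first exact: finite_set1.
    by split.
  by exists J.
have [x [y [Ax Ay Jxy nJx nJy]]] := prime_not_prime iJ nJ1 npJ.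
have [ps [fps psP psmin]] := step x Ax nJx.
have [qs [fqs qsP qsmin]] := step y Ay nJy.
apply: nJ; exists (ps `|` qs); split.
- by rewrite finite_setU.
- by move=> p [/psP|/qsP].
- move=> p pp Jp; have [_ _ _ _ /(_ x y Ax Ay (Jp _ Jxy))[px|py]] := pp.
    by have [q psq qp] := psmin p pp Jp px; exists q; [left|].
  by have [q psq qp] := qsmin p pp Jp py; exists q; [right|].
Qed.

(** The contraction of the maximal ideal of [E] is minimal over [a], hence among the finitely many
    primes of [finite_primes_over]: for [x] in the contraction, some power of [x] times an element
    outside the contraction is a multiple of [a]. *)
Lemma finite_dvr_maxideal A a : affine_ring iota A -> A a -> a != 0 ->
  finite_set [set E | [/\ Spec A E, dvr E & maxideal E a]].
Proof.
move=> aA Aa a0; have sA := affine_subring aA.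
have nA : noetherian A by case: aA => [[s ->] _]; apply: gen_subalg_noetherian.
have iI : is_ideal A [set a * e | e in A].
  split=> [_ [e Ae <-]||_ _ [e Ae <-] [f Af <-]|c _ Ac [e Ae <-]].
  - exact: subringM.
  - by exists 0; rewrite ?mulr0 //; apply: subring0.
  - by exists (e + f); rewrite ?mulrDr //; apply: subringD.
  - by exists (c * e); [apply: subringM|rewrite mulrCA].
have [ps [fps psP psmin]] := finite_primes_over sA nA iI.
apply: (@sub_finite_set _ _ [set localization A p | p in ps]); last exact: finite_image.
move=> E [AE dE mEa]; have sE := Spec_subring sA AE.
have lE := Spec_local sA AE; have AsE := Spec_sub sA AE.
have pp := cap_maxideal_prime sA lE AsE.
have [|q psq qp] := psmin _ pp.
  move=> _ [e Ae <-]; split; first exact: subringM.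
  by rewrite mulrC; apply: maxidealM => //; apply: AsE.
exists q => //; rewrite [RHS](Spec_capE sA AE); congr localization.
have [[qA [q0 qD] qM q1 qP] Iq] := psP _ psq.
have qa : q a by apply: Iq; exists 1; rewrite ?mulr1 //; apply: subring1.
apply/seteqP; split=> // x [Ax mx].
have [->//|x0] := eqVneq x 0.
have ox : 1 <= ord E x by rewrite -gtz0_ge1; apply/(ord_gt0 dE x0).
have oa : 0 <= ord E a by apply/(ord_ge0 dE a0)/AsE.
(* Since [x] has order at least 1, its [N]-th power has order at least that of [a]. *)
pose N := `|ord E a|%N.
have Ex : E (x ^+ N / a).
  apply/(ord_ge0 dE); first by rewrite mulf_neq0 ?invr_eq0 ?expf_neq0.
  rewrite (ordM dE) ?invr_eq0 ?expf_neq0 // (ordX dE) // (ordV dE) //.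
  rewrite subr_ge0 -mulr_natl /N natz gez0_abs //.
  by rewrite -[leLHS]mulr1 ler_wpM2l.
have [c [d [Ac Ad md cd]]] := Spec_frac sA AE Ex.
have d0 : d != 0 by case/(nonmaxP sE (AsE _ Ad)): md.
have : q (x ^+ N * d).
  rewrite (_ : x ^+ N * d = c * a); first exact: qM.
  by apply/eqP; rewrite -eqr_div // cd.
case/qP => //; first exact: subringX.
  elim: N {Ex cd} => [/q1//|N IH]; rewrite exprS => /qP[] //.
  exact: subringX.
by move=> /qp[].
Qed.

Lemma finite_dvr_ord A x : affine_ring iota A -> x != 0 ->
  finite_set [set E | [/\ Spec A E, dvr E & ord E x != 0]].
Proof.
move=> aA x0; have sA := affine_subring aA.
have [a [b [Aa Ab b0 xE]]] : fraction_field A x by case: aA => _ ->.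
have a0 : a != 0 by apply: contra_neq x0 => a0; rewrite xE a0 mul0r.
apply: (@sub_finite_set _ _ ([set E | [/\ Spec A E, dvr E & maxideal E a]] `|`
                             [set E | [/\ Spec A E, dvr E & maxideal E b]])).
  move=> E [AE dE ox]; have AsE := Spec_sub sA AE.
  apply: contrapT => /not_orP[na nb]; move/negP: ox; apply; rewrite xE.
  rewrite (ordM dE) ?invr_eq0 // (ordV dE) // subr_eq0.
  have ord0 c : A c -> c != 0 -> ~ [/\ Spec A E, dvr E & maxideal E c] -> ord E c = 0.
    move=> Ac c0 nc; apply/eqP; rewrite eq_le; apply/andP; split.
      by rewrite leNgt; apply/negP => /(ord_gt0 dE c0) mc; apply: nc.
    by apply/(ord_ge0 dE c0)/AsE.
  by rewrite !ord0.
by rewrite finite_setU; split; apply: finite_dvr_maxideal.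
Qed.

(* Krull: a normal noetherian domain is the intersection of the discrete valuation
   rings at its height one primes, found here among the primes associated with [x]. *)
Lemma krull_intersection A P x : affine_ring iota A ->
  (forall E, Spec A E -> integrally_closed E) -> Spec A P ->
  (forall E, Spec A E -> dvr E -> P `<=` E -> E x) -> P x.
Proof.
move=> aA icA AP Ex; apply: contrapT => Px; have sA := affine_subring aA.
have sP := Spec_subring sA AP; have AsP := Spec_sub sA AP.
have [c [Pc Pcx]] := exists_associated_prime sP (noetherian_Spec aA AP) Px.
set q := [set e | _] => pq; set y := c * x in Pcx q pq.
have [qP [q0 qD] qM q1 qpr] := pq.
have pp : prime_ideal A (A `&` q).
  split=> [z []//|||[_ /q1]//|].
  - by split=> [|u v [Au qu] [Av qv]]; split; [apply: subring0| |apply: subringD|apply: qD].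
  - by move=> a z Aa [Az qz]; split; [apply: subringM|apply: qM => //; apply: AsP].
  - by move=> u v Au Av [_ /qpr[]]; [exact: AsP|exact: AsP|left|right].
pose E := localization A (A `&` q).
have AE : Spec A E by exists (A `&` q).
have lE := Spec_local sA AE; have sE := Spec_subring sA AE.
have mEP := maxideal_localizationP sA pp.
have PE : P `<=` E.
  move=> z /(Spec_frac sA AP)[a [b [Aa Ab mb ->]]]; exists a, b; split=> // -[_ qb].
  have [b0 Pb] := (nonmaxP sP (AsP _ Ab)).1 mb.
  by apply: q1; rewrite -(mulVf b0); apply: qM.
have nEy : ~ E y.
  move=> [a [s [Aa As qs yE]]]; apply: qs; split=> //; split; first exact: AsP.
  have [s0|s0] := eqVneq s 0; first by rewrite s0 mul0r; apply: subring0.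
  by rewrite yE mulrC divfK //; apply: AsP.
have frE : fraction_field E = setT.
  apply/seteqP; split=> // z _; have [_ frA] := aA.
  have [a [b [Aa Ab b0 zE]]] : fraction_field A z by rewrite frA.
  by exists a, b; split=> //; apply: Spec_sub AE _ _.
(* The prime [q] multiplies [y] into [P], so [y] carries the maximal ideal of [E] into [E] without
   lying in [E], as [dvr_criterion] asks. *)
have dE : dvr E.
  apply: (dvr_criterion lE (noetherian_Spec aA AE) (icA _ AE) frE _ nEy).
    move=> m0; apply: nEy; have [_ frA] := aA.
    have [a [b [Aa Ab b0 yE]]] : fraction_field A y by rewrite frA.
    exists a, b; split=> // qb; move/eqP: b0; apply.
    suff : maxideal E b by rewrite m0.
    by apply/mEP; exists b, 1; rewrite divr1; split=> //;
      [exact: subring1|case=> _ /q1].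
  move=> z /mEP[a [s [[Aa [_ qa]] As qs ->]]].
  rewrite mulrCA mulrA mulrC; apply: subringM => //.
    by exists 1, s; rewrite div1r; split=> //; exact: subring1.
  exact: PE.
apply: nEy; apply: subringM => //; first exact: PE.
exact: Ex.
Qed.

(* The ideal of denominators of [x] lies in no prime. *)
Lemma regular_functions_Spec A : affine_ring iota A -> regular_functions (Spec A) = A.
Proof.
move=> aA; have sA := affine_subring aA; apply/seteqP; split; last first.
  by move=> a Aa P AP; apply: Spec_sub AP _ Aa.
move=> x xP; apply: contrapT => nAx.
have nA : noetherian A by case: aA => [[s ->] _]; apply: gen_subalg_noetherian.
have [c [Ac Acx pp]] := exists_associated_prime sA nA nAx.
have [a [b [Aa Ab pb xE]]] := xP _ (ex_intro2 _ _ _ pp erefl).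
have b0 : b != 0.
  by apply: contra_notN pb => /eqP ->; split; rewrite ?mul0r; exact: subring0.
apply: pb; split=> //; rewrite mulrCA xE [b * _]mulrC divfK //; exact: subringM.
Qed.

Lemma valuation_local V : valuation_ring iota V -> local_ring V.
Proof.
move=> [sV _ Vtot]; split=> // x y mx my.
have [x0|x0] := eqVneq x 0; first by rewrite x0 add0r.
have [y0|y0] := eqVneq y 0; first by rewrite y0 addr0.
have [Vxy|Vyx] := Vtot (x / y).
  rewrite (_ : x + y = (x / y + 1) * y); last by field.
  by apply: maxidealM => //; apply: subringD => //; apply: subring1.
rewrite (_ : x + y = ((x / y)^-1 + 1) * x); last by field; apply/andP.
by apply: maxidealM => //; apply: subringD => //; apply: subring1.
Qed.

End Models.

(** * Dominating valuation rings; varieties *)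

Section Chevalley.
Variables (k K : fieldType) (iota : {rmorphism k -> K}).
Implicit Types (A P Q E V R I : set K) (X Y U : set (set K)).

(* Of the two relations, the one of larger degree can be shortened with the other. *)
Lemma no_two_sided_relation R I : is_subring R -> is_ideal R I -> ~ I 1 ->
  (forall b, I b -> R (1 - b)^-1) -> forall (x : K) (p q : {poly K}), x != 0 ->
  poly_over I p -> poly_over I q -> p.[x] = 1 -> q.[x^-1] = 1 -> False.
Proof.
move=> sR iI I1 Runit x p q; have [IR I0 ID IM] := iI.
have [N] := ubnP (size p + size q); elim: N x p q => // N IH x p q.
wlog le_qp : x p q / (size q <= size p)%N.
  move=> wl; case: (leqP (size q) (size p)) => [/wl|/ltnW le]; first exact.
  move=> sN x0 Ip Iq px qx; apply: (wl x^-1 q p) => //; rewrite ?invr_eq0 ?invrK //.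
  by rewrite addnC.
rewrite ltnS => sN x0 Ip Iq px qx.
have sp0 : (0 < size p)%N.
  by rewrite size_poly_gt0; apply: contra_eq_neq px => ->; rewrite horner0 eq_sym oner_neq0.
have sq0 : (0 < size q)%N.
  by rewrite size_poly_gt0; apply: contra_eq_neq qx => ->; rewrite horner0 eq_sym oner_neq0.
pose n := (size p).-1; pose m := (size q).-1.
have mn : (m <= n)%N by rewrite /m /n; lia.
have q01 : 1 - q`_0 != 0.
  by rewrite subr_eq0; apply: contra_notN I1 => /eqP ->; apply: Iq.
pose c := (1 - q`_0)^-1.
(* Multiplying [q.[x^-1] = 1] by [x ^+ m] and dividing by the unit [c^-1] writes [x ^+ m] as a
   combination of lower powers of [x]. *)
pose r := \poly_(j < m) (c * q`_(m - j)).
have Rr : poly_over R r.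
  move=> j; rewrite coef_poly; case: ltnP => _; last exact: subring0.
  by apply: subringM => //; [apply: Runit|apply: IR].
have rx : r.[x] = x ^+ m.
  have : q.[x^-1] = q`_0 + \sum_(j < m) q`_j.+1 * x^-1 ^+ j.+1.
    by rewrite horner_coef -(prednK sq0) big_ord_recl expr0 mulr1.
  rewrite qx => /eqP; rewrite addrC -subr_eq => /eqP q1.
  rewrite horner_poly (reindex_inj rev_ord_inj) /=.
  transitivity (c * x ^+ m * \sum_(j < m) q`_j.+1 * x^-1 ^+ j.+1).
    rewrite mulr_sumr; apply: eq_bigr => j _.
    rewrite subKn ?ltn_ord // exprVn.
    have -> : x ^+ m = x ^+ (m - j.+1) * x ^+ j.+1 by rewrite -exprD subnK ?ltn_ord.
    by field; rewrite expf_neq0.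
  by rewrite -q1 /c mulrAC mulVf // mul1r.
(* The top power in [p] is rewritten through [r]. The degree drops, and the coefficients stay in [I]
   because the new ones are multiples of the top coefficient of [p]. *)
pose p' := \poly_(i < n) p`_i + (p`_n)%:P * 'X^(n - m) * r.
have Ip' : poly_over I p'.
  move=> i; rewrite coefD; apply: ID; first by rewrite coef_poly; case: ltnP.
  rewrite -mulrA coefCM coefXnM mulrC; apply: IM => //.
  by case: ltnP => _; [apply: subring0|apply: Rr].
have px' : p'.[x] = 1.
  rewrite -px [in RHS]horner_coef -(prednK sp0) big_ord_recr /= hornerD horner_poly.
  by rewrite !hornerM hornerC hornerXn rx -mulrA -exprD subnK.
have sp' : (size p' <= n)%N.
  apply/leq_sizeP => j nj; rewrite coefD coef_poly ltnNge nj /= add0r.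
  rewrite -mulrA coefCM coefXnM; case: ltnP => _; first by rewrite mulr0.
  have mj : (m <= j - (n - m))%N by clearbody m n; lia.
  by rewrite coef_poly ltnNge mj mulr0.
apply: (IH x p' q) => //; move: sp' sN sp0; rewrite /n; lia.
Qed.

Lemma gen_ideal_mono A B (S : set K) : is_subring A -> is_subring B -> A `<=` B ->
  S `<=` A -> gen_ideal A S `<=` gen_ideal B S.
Proof.
move=> sA sB AB SA; have SB := subset_trans SA AB.
have [GB G0 GD GM] := gen_idealP sB SB.
apply: subset_trans (_ : A `&` gen_ideal B S `<=` _); last by move=> x [].
apply: gen_ideal_min => [|x Sx]; last by split; [apply: SA|apply: sub_gen_ideal].
split=> [x []//||x y [Ax Gx] [Ay Gy]|a x Aa [Ax Gx]].
- by split=> //; apply: subring0.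
- by split; [apply: subringD|apply: GD].
- by split; [apply: subringM|apply: GM => //; apply: AB].
Qed.

(** Zorn's lemma applies because the extensions of the maximal ideal of [Q] to the members of a
    chain together form an ideal of the union; if 1 is in the extension to the union, it is in the
    extension to one member. *)
Lemma maximal_proper_extension Q : local_ring Q -> exists R,
  [/\ is_subring R, Q `<=` R, ~ gen_ideal R (maxideal Q) 1 &
    forall R', is_subring R' -> R `<=` R' -> ~ gen_ideal R' (maxideal Q) 1 -> R' = R].
Proof.
move=> lQ; have [sQ _] := lQ; have mQ := @sub_maxideal _ Q.
pose F := [set R | [/\ is_subring R, Q `<=` R & ~ gen_ideal R (maxideal Q) 1]].
have FQ : F Q.
  split=> // Q1; apply: (maxideal1 sQ); move: Q1; apply: gen_ideal_min => //.
  by case: (local_prime lQ) => ? [? ?] ? _ _; split.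
have [C CF Ctot|R [FR Rmax]] := @Zorn_bigcup _ (F `|` [set set0]).
  have [allC0|] := pselect (forall R, C R -> R = set0).
    by right; rewrite /= -subset0 => x [R CR]; rewrite (allC0 R CR).
  move=> /existsNP[R1 /not_implyP[CR1 R1n0]]; left.
  have FC R x : C R -> R x -> F R by move=> /CF[//|->].
  have FR1 : F R1 by case: (CF _ CR1).
  have sub2 x y : (\bigcup_(R in C) R) x -> (\bigcup_(R in C) R) y ->
      exists R, [/\ C R, F R, R x & R y].
    move=> [R CR Rx] [S CS Sy]; have [RS|SR] := Ctot _ _ CR CS.
      by exists S; split=> //; [exact: FC Sy|exact: RS].
    by exists R; split=> //; [exact: FC Rx|exact: SR].
  have sU : is_subring (\bigcup_(R in C) R).
    split=> [|x y Ux Uy|x y Ux Uy].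
    - by exists R1 => //; apply: subring1; case: FR1.
    - have [R [CR [sR _ _] Rx Ry]] := sub2 _ _ Ux Uy.
      by exists R => //; apply: subringB.
    - have [R [CR [sR _ _] Rx Ry]] := sub2 _ _ Ux Uy.
      by exists R => //; apply: subringM.
  have QU : Q `<=` \bigcup_(R in C) R.
    by move=> x Qx; exists R1 => //; case: FR1 => _ + _; apply.
  split=> // U1.
  have [_ [R [CR FR G1]]] : ((\bigcup_(R in C) R) `&`
      [set x | exists R, [/\ C R, F R & gen_ideal R (maxideal Q) x]]) 1.
    split; first exact: subring1.
    suff: gen_ideal (\bigcup_(R in C) R) (maxideal Q) `<=`
      [set x | exists R, [/\ C R, F R & gen_ideal R (maxideal Q) x]] by apply.
    have up R S : C R -> F R -> C S -> F S -> R `<=` S ->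
        gen_ideal R (maxideal Q) `<=` gen_ideal S (maxideal Q).
      move=> CR [sR QR _] CS [sS _ _] RS; apply: gen_ideal_mono => //.
      exact: subset_trans QR.
    apply: gen_ideal_min => [|x mx]; last by exists R1; split=> //; apply: sub_gen_ideal.
    have iG R : F R -> is_ideal R (gen_ideal R (maxideal Q)).
      by move=> [sR QR _]; apply: gen_idealP => //; apply: subset_trans QR.
    split.
    - move=> x [R [CR FR Gx]]; exists R => //; case: (iG _ FR) => GR _ _ _; exact: GR.
    - by exists R1; split=> //; case: (iG _ FR1).
    - move=> x y [R [CR FR Gx]] [S [CS FS Gy]]; have [RS|SR] := Ctot _ _ CR CS.
        exists S; split=> //; case: (iG _ FS) => _ _ GD _; apply: GD => //.
        exact: (up R S).
      exists R; split=> //; case: (iG _ FR) => _ _ GD _; apply: GD => //.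
      exact: (up S R).
    - move=> a x [R CR Ra] [S [CS FS Gx]]; have FR := FC _ _ CR Ra.
      have [RS|SR] := Ctot _ _ CR CS.
        by exists S; split=> //; case: (iG _ FS) => _ _ _ GM; apply: GM => //; apply: RS.
      exists R; split=> //; case: (iG _ FR) => _ _ _ GM; apply: GM => //.
      exact: (up S R).
  by case: FR.
have {}FR : F R.
  case: FR => // R0; case: (Rmax Q); last by left.
  by rewrite R0; split=> // /(_ 1); apply; exact: subring1.
have [sR QR R1] := FR; exists R; split=> // R' sR' RR' R'1.
apply/seteqP; split=> //; apply: contrapT => R'R.
by apply: (Rmax R'); [split|left; split=> //; apply: subset_trans RR'].
Qed.

(** The ring [R'] inverts [1 - b]. If [S] generated its unit ideal, a power of [1 - b] would lie in
    the ideal generated by [S] in [R], and so would 1, since [b] does. By maximality [R'] is [R]. *)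
Lemma maximal_extension_unit R (S : set K) : is_subring R -> S `<=` R ->
  ~ gen_ideal R S 1 ->
  (forall R', is_subring R' -> R `<=` R' -> ~ gen_ideal R' S 1 -> R' = R) ->
  forall b, gen_ideal R S b -> R (1 - b)^-1.
Proof.
move=> sR SR R1 Rmax b Ib; have iI := gen_idealP sR SR; have [IR I0 ID IM] := iI.
have u0 : 1 - b != 0 by rewrite subr_eq0; apply: contra_notN R1 => /eqP ->.
have Ru : R (1 - b) by apply: subringB => //; [apply: subring1|apply: IR].
pose R' := [set x | exists n, R (x * (1 - b) ^+ n)].
have lift (J : set K) x m n : is_ideal R J -> J (x * (1 - b) ^+ m) ->
    J (x * (1 - b) ^+ (n + m)).
  move=> [_ _ _ JM] Jx; rewrite exprD mulrCA; apply: JM => //; exact: subringX.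
have iR := is_ideal_refl sR.
have sR' : is_subring R'.
  split=> [|x y [m Rx] [n Ry]|x y [m Rx] [n Ry]].
  - by exists 0%N; rewrite mulr1; apply: subring1.
  - exists (n + m)%N; rewrite mulrBl; apply: subringB => //; first exact: lift.
    by rewrite addnC; apply: lift.
  - by exists (m + n)%N; rewrite exprD mulrACA; apply: subringM.
have RR' : R `<=` R' by move=> x Rx; exists 0%N; rewrite mulr1.
suff R'1 : ~ gen_ideal R' S 1.
  rewrite -(Rmax R' sR' RR' R'1); exists 1%N; rewrite expr1 mulVf //; exact: subring1.
move=> G1.
have [n] : exists n, gen_ideal R S (1 * (1 - b) ^+ n).
  suff: gen_ideal R' S `<=` [set x | exists n, gen_ideal R S (x * (1 - b) ^+ n)] by apply.
  apply: gen_ideal_min => [|x Sx]; last by exists 0%N; rewrite mulr1; apply: sub_gen_ideal.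
  split.
  - by move=> x [n Gx]; exists n; apply: IR.
  - by exists 0%N; rewrite mul0r.
  - move=> x y [m Gx] [n Gy]; exists (n + m)%N; rewrite mulrDl; apply: ID.
      exact: lift iI Gx.
    by rewrite addnC; apply: lift iI Gy.
  - by move=> a x [m Ra] [n Gx]; exists (m + n)%N; rewrite exprD mulrACA; apply: IM.
rewrite mul1r; elim: n => [|n IHn]; first by rewrite expr0.
rewrite exprS => Gn; apply: IHn.
rewrite -[X in _ X](subrK ((1 - b) * (1 - b) ^+ n)); apply: ID => //.
rewrite -[X in X - _]mul1r -mulrBl opprB addrC subrK mulrC; apply: IM => //.
exact: subringX.
Qed.

(** If neither [x] nor [x^-1] lay in the maximal extension, adjoining each would make the ideal
    improper; the two resulting relations contradict [no_two_sided_relation]. *)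
Lemma exists_dominating_valuation Q : local_ring Q -> range iota `<=` Q ->
  exists2 V, valuation_ring iota V & dominates V Q.
Proof.
move=> lQ iQ; have [sQ _] := lQ.
have [R [sR QR R1 Rmax]] := maximal_proper_extension lQ.
have mR : maxideal Q `<=` R by apply: subset_trans QR; apply: sub_maxideal.
have iI := gen_idealP sR mR; have [IR I0 ID IM] := iI.
have Runit := maximal_extension_unit sR mR R1 Rmax.
have mI := @sub_gen_ideal _ R (maxideal Q).
have rel x : ~ R x -> exists2 p, poly_over (gen_ideal R (maxideal Q)) p & p.[x] = 1.
  move=> nRx; have sRX := poly_over_subring sR.
  pose R' := horner_eval x @` poly_over R.
  have R'E : R' = gen_subring (R `|` [set x]) by rewrite gen_subring_adjoin.
  have sR' : is_subring R' by rewrite R'E; apply: gen_subringP.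
  have RR' : R `<=` R' by rewrite R'E => y Ry; apply: sub_gen_subring; left.
  have G1 : gen_ideal R' (maxideal Q) 1.
    apply: contrapT => /(Rmax R' sR' RR') R'R; apply: nRx.
    by rewrite -R'R R'E; apply: sub_gen_subring; right.
  suff : (horner_eval x @` poly_over (gen_ideal R (maxideal Q))) 1.
    by move=> [p Ip px]; exists p.
  suff: gen_ideal R' (maxideal Q) `<=`
     horner_eval x @` poly_over (gen_ideal R (maxideal Q)) by apply.
  apply: gen_ideal_min => [|y my]; last first.
    exists y%:P; last by rewrite /horner_eval hornerC.
    by move=> i; rewrite coefC; case: ifP => _ //; apply: mI.
  split.
  - by move=> _ [p Ip <-]; exists p => // i; apply: IR.
  - by exists 0; rewrite ?rmorph0 // => i; rewrite coef0.
  - move=> _ _ [p Ip <-] [q Iq <-]; exists (p + q); rewrite ?rmorphD //.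
    by move=> i; rewrite coefD; apply: ID.
  - move=> _ _ [p Rp <-] [q Iq <-]; exists (p * q); rewrite ?rmorphM //.
    move=> i; rewrite coefM; apply: (big_ind (gen_ideal R (maxideal Q))) => //.
    by move=> j _; apply: IM.
exists R; first split=> //; first exact: subset_trans QR.
  move=> x; apply: contrapT => /not_orP[nRx nRxv].
  have x0 : x != 0 by apply: contra_notN nRx => /eqP ->; apply: subring0.
  have [p Ip px] := rel _ nRx; have [q Iq qx] := rel _ nRxv.
  exact: (no_two_sided_relation sR iI R1 Runit x0 Ip Iq px qx).
split=> // x mx; split; first exact: mR.
have [->|x0] := eqVneq x 0; [by left|right=> Rxv; apply: R1].
by rewrite -(mulVf x0); apply: IM => //; apply: mI.
Qed.

End Chevalley.

(** * Points and prime divisors of a variety *)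

Section Varieties.
Variables (k K : fieldType) (iota : {rmorphism k -> K}).
Implicit Types (A P Q E V R I : set K) (X Y U : set (set K)).
Variable X : set (set K).
Hypothesis vX : variety iota X.

Lemma variety_affine P : X P -> exists A, [/\ affine_ring iota A, Spec A P & Spec A `<=` X].
Proof.
have [[m [A [aA ->]]] _] := vX; move=> [i _ Pi]; exists (A i); split=> // Q Qi.
by exists i.
Qed.

Lemma variety_local P : X P -> local_ring P.
Proof. by move=> /variety_affine[A [aA AP _]]; exact: Spec_local (affine_subring aA) AP. Qed.

Lemma variety_subring P : X P -> is_subring P.
Proof. by move=> /variety_local[]. Qed.

Lemma variety_iota P : X P -> range iota `<=` P.
Proof.
move=> /variety_affine[A [aA AP _]]; apply: subset_trans (affine_iota aA) _.
exact: Spec_sub (affine_subring aA) AP.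
Qed.

Lemma variety_noetherian P : X P -> noetherian P.
Proof. by move=> /variety_affine[A [aA AP _]]; exact: noetherian_Spec aA AP. Qed.

Lemma variety_fraction P : X P -> fraction_field P = setT.
Proof.
move=> /variety_affine[A [aA AP _]]; apply/seteqP; split=> // x _.
have [a [b [Aa Ab b0 ->]]] : fraction_field A x by case: aA => _ ->.
have AsP := Spec_sub (affine_subring aA) AP.
by exists a, b; split=> //; apply: AsP.
Qed.

Lemma variety_separated V P Q : valuation_ring iota V -> X P -> X Q ->
  dominates V P -> dominates V Q -> P = Q.
Proof. by case: vX => _; apply. Qed.

(** A valuation ring dominating [P] dominates [Q] too, so separatedness applies. *)
Lemma variety_dominates_eq P Q : X P -> X Q -> dominates P Q -> P = Q.
Proof.
move=> XP XQ PQ.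
have [V vV VP] := exists_dominating_valuation (variety_local XP) (variety_iota XP).
by apply: (variety_separated vV) => //; apply: dominates_trans PQ.
Qed.

(** The center of [Q] on [Spec A] is a point of [X] dominated by [Q], hence is [Q] itself. *)
Lemma variety_mem_Spec A Q : affine_ring iota A -> Spec A `<=` X -> X Q -> A `<=` Q ->
  Spec A Q.
Proof.
move=> aA AX XQ AQ.
have [AP QP] := center_Spec (affine_subring aA) (variety_local XQ) AQ.
by rewrite (variety_dominates_eq XQ (AX _ AP) QP).
Qed.

Lemma affine_open_Spec A : affine_ring iota A -> Spec A `<=` X ->
  affine_open iota X A (Spec A).
Proof.
move=> aA AX; split=> //; split=> // P AP; have [[s AE] _] := aA.
have AsP := Spec_sub (affine_subring aA) AP; exists s.
  by apply: subset_trans AsP; rewrite AE; apply: sub_gen_subalg.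
move=> Q XQ sQ; apply: variety_mem_Spec => //; rewrite AE.
by apply: gen_subalg_min => //; [apply: variety_subring|apply: variety_iota].
Qed.

Lemma zopen_generization U P Q : zopen X U -> U P -> X Q -> P `<=` Q -> U Q.
Proof.
move=> [_ oU] UP XQ PQ; have [s sP sU] := oU P UP.
by apply: sU => //; apply: subset_trans PQ.
Qed.

Hypothesis nX : normal_variety X.

(** From left to right, an associated prime of [x^-1] contains the nonzero non-unit [x], so it is
    the maximal ideal, and [c / x] meets [dvr_criterion]. Conversely a nonzero prime contains some
    [x] different from 0, and a high power of every non-unit is a multiple of [x]. *)
Lemma prime_divisorP E : prime_divisor X E <-> X E /\ dvr E.
Proof.
split=> [[XE m0 Eprime]|[XE dE]].
  split=> //; have lE := variety_local XE; have [sE _] := lE.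
  have [x mx x0] : exists2 x, maxideal E x & x != 0.
    apply: contrapT => H; apply: m0; apply/seteqP; split=> [x mx|_ ->]; last exact: maxideal0.
    by apply/eqP; apply: contrapT => /negP x0; apply: H; exists x.
  have nExv : ~ E x^-1 by case: mx => _ [/eqP|//]; rewrite (negbTE x0).
  have [c [Ec nEcx pp]] := exists_associated_prime sE (variety_noetherian XE) nExv.
  apply: (dvr_criterion lE (variety_noetherian XE) (nX XE) (variety_fraction XE) m0 nEcx).
  case: (Eprime _ pp) => [p0|<- m [_]]; last by rewrite mulrC.
  have : [set e | E e /\ E (e * (c / x))] x.
    by split; [apply: sub_maxideal|rewrite mulrC divfK].
  by rewrite p0 => /= /eqP; rewrite (negbTE x0).
split=> //; first exact: dvr_maxideal_neq0.
move=> p [pE [p0 pD] pM p1 pP].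
have [pz|npz] := pselect (p = [set 0]); [by left|right].
have [x px x0] : exists2 x, p x & x != 0.
  apply: contrapT => H; apply: npz; apply/seteqP; split=> [x px|_ ->]//.
  by apply/eqP; apply: contrapT => /negP x0; apply: H; exists x.
have sE := variety_subring XE.
apply/seteqP; split=> [y py|y my].
  split; first exact: pE.
  have [->|y0] := eqVneq y 0; [by left|right=> Eyv; apply: p1].
  by rewrite -(mulVf y0); apply: pM.
have [->//|y0] := eqVneq y 0.
have oy : 1 <= ord E y by rewrite -gtz0_ge1; apply/(ord_gt0 dE y0).
have ox : 0 <= ord E x by apply/(ord_ge0 dE x0)/pE.
pose N := `|ord E x|%N.
have Ex : E (y ^+ N / x).
  apply/(ord_ge0 dE); first by rewrite mulf_neq0 ?invr_eq0 ?expf_neq0.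
  rewrite (ordM dE) ?invr_eq0 ?expf_neq0 // (ordX dE) // (ordV dE) //.
  rewrite subr_ge0 -mulr_natl /N natz gez0_abs //.
  by rewrite -[leLHS]mulr1 ler_wpM2l.
have : p (y ^+ N) by rewrite -(divfK x0 (y ^+ N)); apply: pM.
elim: N {Ex} => [/p1//|N IH]; rewrite exprS => /pP[] //; first exact: sub_maxideal.
by apply: subringX => //; apply: sub_maxideal.
Qed.

Lemma prime_divisor_dvr E : prime_divisor X E -> dvr E.
Proof. by move=> /prime_divisorP[]. Qed.

Lemma prime_divisor_valuation E : prime_divisor X E -> valuation_ring iota E.
Proof.
move=> /prime_divisorP[XE dE]; split; last exact: dvr_total.
  exact: variety_subring.
exact: variety_iota.
Qed.

Lemma variety_krull A P x : affine_ring iota A -> Spec A `<=` X -> Spec A P ->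
  (forall E, prime_divisor X E -> P `<=` E -> E x) -> P x.
Proof.
move=> aA AX AP Ex; apply: krull_intersection aA _ AP _.
  by move=> E /AX/nX.
by move=> E AE dE PE; apply: Ex => //; apply/prime_divisorP; split=> //; apply: AX.
Qed.

End Varieties.

(** * Differential forms *)

Section Derivations.
Variables (k K : fieldType) (iota : {rmorphism k -> K}).
Implicit Types (A E : set K) (d : derivation iota).

Lemma derD d x y : sval d (x + y) = sval d x + sval d y.
Proof. by case: (svalP d). Qed.

Lemma derM d x y : sval d (x * y) = x * sval d y + y * sval d x.
Proof. by case: (svalP d). Qed.

Lemma der_iota d c : sval d (iota c) = 0.
Proof. by case: (svalP d). Qed.

Lemma der0 d : sval d 0 = 0.
Proof. by apply: (@addrI _ (sval d 0)); rewrite -derD !addr0. Qed.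

Lemma der1 d : sval d 1 = 0.
Proof. by rewrite -(rmorph1 iota) der_iota. Qed.

Lemma derN d x : sval d (- x) = - sval d x.
Proof. by apply: (@addrI _ (sval d x)); rewrite -derD !subrr der0. Qed.

Lemma derB d x y : sval d (x - y) = sval d x - sval d y.
Proof. by rewrite derD derN. Qed.

Lemma der_sum d (J : Type) (r : seq J) (F : J -> K) :
  sval d (\sum_(j <- r) F j) = \sum_(j <- r) sval d (F j).
Proof. by apply: (big_morph _ (derD d) (der0 d)). Qed.

Lemma derX d x n : sval d (x ^+ n) = (x ^+ n.-1 *+ n) * sval d x.
Proof.
elim: n => [|n IH]; first by rewrite expr0 der1 mulr0n mul0r.
rewrite exprS derM IH /= mulrSr mulrDl addrC; case: n IH => [|n] IH.
  by rewrite mulr0n mul0r mulr0 addr0 add0r.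
by rewrite mulrA mulrnAr -exprS addrC.
Qed.

Lemma der_div d x y : y != 0 ->
  sval d (x / y) = y^-1 * sval d x - x / y ^+ 2 * sval d y.
Proof.
move=> y0; have := derM d (x / y) y; rewrite divfK // => ->.
by field.
Qed.

Lemma der_horner d (p : {poly K}) y :
  sval d p.[y] = \sum_(i < size p) y ^+ i * sval d p`_i + p^`().[y] * sval d y.
Proof.
rewrite [in LHS]horner_coef der_sum.
under eq_bigr do rewrite derM derX addrC.
rewrite big_split /=; congr (_ + _).
have -> : p^`().[y] = \sum_(i < size p) p`_i * (y ^+ i.-1 *+ i).
  rewrite /deriv horner_poly; case: (size p) => [|m]; first by rewrite !big_ord0.
  rewrite big_ord_recl mulr0n mulr0 add0r; apply: eq_bigr => i _ /=.
  by rewrite mulrnAl mulrnAr.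
by rewrite mulr_suml; apply: eq_bigr => i _; rewrite mulrA.
Qed.

(* The [y] whose differential is a combination of the [d z_l] over [E]; derivations
   stand in for the dual of the differentials. *)
Definition diff_span r (z : 'I_r -> K) E : set K :=
  [set y | exists2 c : 'I_r -> K, forall l, E (c l) &
     forall d, sval d y = \sum_l c l * sval d (z l)].

Section DiffSpan.
Variables (r : nat) (z : 'I_r -> K) (E : set K).
Hypothesis sE : is_subring E.

Lemma diff_span_iota : range iota `<=` diff_span z E.
Proof.
move=> _ [a _ <-]; exists (fun=> 0) => [l|d]; first exact: subring0.
by rewrite der_iota big1 // => l _; rewrite mul0r.
Qed.

Lemma diff_span_base l : diff_span z E (z l).
Proof.
exists (fun j => (j == l)%:R) => [j|d].
  by case: (_ == _); [apply: subring1|apply: subring0].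
rewrite (bigD1 l) //= eqxx mul1r big1 ?addr0 // => j /negbTE ->.
by rewrite mul0r.
Qed.

Lemma diff_span_subring : is_subring (E `&` diff_span z E).
Proof.
split=> [|x y [Ex [c Ec cx]] [Ey [e Ee ey]]|x y [Ex [c Ec cx]] [Ey [e Ee ey]]].
- split; first exact: subring1.
  by apply: diff_span_iota; exists 1; rewrite ?rmorph1.
- split; first exact: subringB.
  exists (fun l => c l - e l) => [l|d]; first exact: subringB.
  by rewrite derB cx ey -sumrB; apply: eq_bigr => l _; rewrite mulrBl.
- split; first exact: subringM.
  exists (fun l => x * e l + y * c l) => [l|d].
    by apply: subringD => //; apply: subringM.
  rewrite derM cx ey !mulr_sumr -big_split; apply: eq_bigr => l _ /=.
  by rewrite mulrDl !mulrA.
Qed.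

Lemma diff_span_div x y : E x -> E y -> E y^-1 -> y != 0 ->
  diff_span z E x -> diff_span z E y -> diff_span z E (x / y).
Proof.
move=> Ex Ey Eyv y0 [c Ec cx] [e Ee ey].
exists (fun l => y^-1 * c l - x / y ^+ 2 * e l) => [l|d].
  apply: subringB => //; apply: subringM => //.
  by rewrite -exprVn; apply: subringM => //; apply: subringX.
rewrite der_div // cx ey !mulr_sumr -sumrB; apply: eq_bigr => l _.
by rewrite mulrBl !mulrA.
Qed.

End DiffSpan.

(** The elements whose differential is a combination of the [x l] differentials form a ring closed
    under division. For a polynomial of least size over it with root [y], the derivative is nonzero
    in characteristic 0 and shorter, hence does not vanish at [y]; differentiating the relation
    solves for the differential of [y]. *)
Lemma diff_span_algebraic n (x : 'I_n -> K) : (forall m, m.+1%:R != 0 :> K) ->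
  algebraic_over (fraction_field (gen_subalg iota (range x))) ->
  diff_span x setT = setT.
Proof.
move=> char0 alg; apply/seteqP; split=> // y _.
have sT : is_subring (setT : set K) by split.
have sL := diff_span_subring x sT; rewrite setTI in sL.
set L := diff_span x setT in sL *.
have AL : gen_subalg iota (range x) `<=` L.
  apply: gen_subalg_min => //; first exact: diff_span_iota.
  by move=> _ [l _ <-]; apply: diff_span_base.
have FL : fraction_field (gen_subalg iota (range x)) `<=` L.
  by move=> _ [a [b [/AL La /AL Lb b0 ->]]]; apply: diff_span_div.
have [p0 [p00 p0L p0y]] := alg y.
pose sz m := `[< exists p : {poly K}, [/\ p != 0, poly_over L p, root p y & size p = m] >].
have exm : exists m, sz m.
  by exists (size p0); apply/asboolP; exists p0; split=> // i; apply: FL.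
case: (ex_minnP exm) => m /asboolP[p [p_neq0 Lp py szp]] minm.
have dp0 : p^`().[y] != 0.
  apply/negP => dpy; have dpE : p^`() != 0.
    apply: contraNneq p_neq0 => dp0.
    have pC : p = (p`_0)%:P.
      apply/polyP => -[|i]; rewrite coefC //=.
      have /eqP := congr1 (fun q : {poly K} => q`_i) dp0.
      by rewrite coef_deriv coef0 -mulr_natr mulf_eq0 (negbTE (char0 _)) orbF => /eqP.
    by move: py; rewrite /root pC hornerC => /eqP ->.
  have : (m <= size p^`())%N.
    apply: minm; apply/asboolP; exists p^`(); split=> // i.
    rewrite coef_deriv -mulr_natr; apply: (subringM sL) => //.
    by apply: diff_span_iota => //; exists i.+1%:R; rewrite ?rmorph_nat.
  by rewrite leqNgt -szp lt_size_deriv.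
have H i : exists c : 'I_n -> K, forall d, sval d p`_i = \sum_l c l * sval d (x l).
  by case: (Lp i) => c _ ?; exists c.
have [c cP] := choice H.
exists (fun l => - (\sum_(i < size p) y ^+ i * c i l) / p^`().[y]) => // d.
apply: (mulfI dp0); have /eqP := der_horner d p y.
rewrite (rootP py) der0 eq_sym addrC addr_eq0 => /eqP ->.
rewrite mulr_sumr -sumrN; under eq_bigr do rewrite cP mulr_sumr -sumrN.
rewrite exchange_big /=; apply: eq_bigr => l _.
rewrite mulrA (mulrC p^`().[y]) divfK //.
by rewrite mulNr mulr_suml sumrN; congr (- _); apply: eq_bigr => i _; rewrite mulrA.
Qed.

(** Multilinearity of the determinant. The sum runs over all maps [f]; the non-injective ones
    contribute zero. *)
Lemma dwedge_expand n r (y : 'I_n -> K) (z : 'I_r -> K) (c : 'I_n -> 'I_r -> K) :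
  (forall j d, sval d (y j) = \sum_l c j l * sval d (z l)) ->
  forall d : 'I_n -> derivation iota, dwedge y d = \sum_(f : {ffun 'I_n -> 'I_r})
    (\prod_j c j (f j)) * dwedge (fun j => z (f j)) d.
Proof.
move=> cP d; rewrite /dwedge -det_tr.
under [RHS]eq_bigr => f _ do rewrite -[\det _]det_tr.
rewrite /determinant.
under [LHS]eq_bigr => s _.
  under eq_bigr => j _ do rewrite !mxE cP.
  rewrite bigA_distr_bigA mulr_sumr.
  over.
rewrite exchange_big; apply: eq_bigr => f _.
rewrite mulr_sumr; apply: eq_bigr => s _.
rewrite big_split [in LHS]mulrCA; congr (_ * (_ * _)).
by apply: eq_bigr => j _; rewrite !mxE.
Qed.

Lemma dwedge_basis n (x : 'I_n -> K) : diff_span x setT = setT ->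
  forall y : 'I_n -> K, exists g, forall d : 'I_n -> derivation iota, dwedge y d = g * dwedge x d.
Proof.
move=> xT y.
have H j : exists c : 'I_n -> K, forall d, sval d (y j) = \sum_l c l * sval d (x l).
  have : diff_span x setT (y j) by rewrite xT.
  by case=> c _ ?; exists c.
have [c cP] := choice H.
exists (\det (\matrix_(l, j) c j l)) => d; rewrite /dwedge mulrC -det_mulmx.
congr (\det _); apply/matrixP => i j; rewrite !mxE cP; apply: eq_bigr => l _.
by rewrite !mxE mulrC.
Qed.

Section Generators.
Variables (n r : nat) (x : 'I_n -> K) (z : 'I_r -> K).
Hypothesis xT : diff_span x setT = setT.

(** Coordinates, in the line spanned by [dwedge x], of the nonvanishing wedges of the differentials
    of the [z l]. *)
Definition form_coordinates : set K :=
  [set g | g != 0 /\ exists f : {ffun 'I_n -> 'I_r},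
     forall d : 'I_n -> derivation iota, dwedge (fun j => z (f j)) d = g * dwedge x d].

(** Finite generation: expanding every differential in those of the [z l] leaves only wedges of
    these, with coefficients still in [E]. *)
Lemma OmegaP (E : set K) : is_subring E -> E `<=` diff_span z E -> (forall l, E (z l)) ->
  forall w : diff_form iota n, Omega E w <->
  exists a : {ffun 'I_n -> 'I_r} -> K, (forall f, E (a f)) /\
    w = fun d : 'I_n -> derivation iota => \sum_f a f * dwedge (fun j => z (f j)) d.
Proof.
move=> sE Ez zE w; split=> [[m [a [y [Ea Ey ->]]]]|[a [Ea ->]]]; last first.
  exists #|{ffun 'I_n -> 'I_r}|, (fun i => a (enum_val i)),
    (fun i j => z ((enum_val i : {ffun 'I_n -> 'I_r}) j)); split=> //.
  apply/funext => d; rewrite (reindex_onto enum_val enum_rank) /=; last first.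
    by move=> f _; rewrite enum_rankK.
  by apply: eq_bigl => i; rewrite enum_valK eqxx.
have H (ij : 'I_m * 'I_n) : exists c : 'I_r -> K, (forall l, E (c l)) /\
    forall d, sval d (y ij.1 ij.2) = \sum_l c l * sval d (z l).
  by case: (Ez _ (Ey ij.1 ij.2)) => c Ec cP; exists c.
have [c cP] := choice H.
exists (fun f => \sum_i a i * \prod_j c (i, j) (f j)); split.
  move=> f; apply: (subring_sum _ sE) => i _; apply: subringM => //.
  by apply: (subring_prod _ sE) => j _; case: (cP (i, j)).
apply/funext => d; rewrite -[RHS]/(\sum_f _); under [RHS]eq_bigr do rewrite mulr_suml.
rewrite exchange_big; apply: eq_bigr => i _ /=.
rewrite (@dwedge_expand n r (y i) z (fun j => c (i, j))); last first.
  by move=> j d'; case: (cP (i, j)).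
by rewrite mulr_sumr; apply: eq_bigr => f _; rewrite mulrA.
Qed.

End Generators.
End Derivations.

(** * Canonical divisors of rational forms *)

Section CanonicalDivisor.
Variables (k K : fieldType) (iota : {rmorphism k -> K}) (n : nat) (x : 'I_n -> K).
Hypothesis xT : diff_span iota x setT = setT.
Implicit Types (A E G : set K) (w : diff_form iota n).

Lemma fractions_diff_span (s : seq K) (E : set K) : is_subring E ->
  gen_subalg iota [set` s] `<=` E ->
  (forall y, E y -> exists a b, [/\ gen_subalg iota [set` s] a,
     gen_subalg iota [set` s] b, b != 0, E b^-1 & y = a / b]) ->
  E `<=` diff_span iota (fun i : 'I_(size s) => s`_i) E.
Proof.
move=> sE AE Efrac; pose z (i : 'I_(size s)) := s`_i; rewrite -/z.
have AD : gen_subalg iota [set` s] `<=` E `&` diff_span iota z E.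
  apply: gen_subalg_min; first exact: diff_span_subring.
    move=> y iy; split; [apply: AE; exact: iota_gen_subalg|].
    exact: diff_span_iota.
  move=> y ys; split; first by apply: AE; apply: sub_gen_subalg.
  have /(nthP 0)[i si <-] := ys; exact: (diff_span_base iota z sE (Ordinal si)).
move=> y /Efrac[a [b [/AD[Ea Da] /AD[Eb Db] b0 Ebv ->]]].
exact: diff_span_div.
Qed.

Lemma rational_form_coordinate w : rational_form w ->
  exists2 g, g != 0 & w = fun d : 'I_n -> derivation iota => g * dwedge x d.
Proof.
move=> [[m [a [y [_ _ wE]]]] wn0].
have [g gP] := choice (fun i => dwedge_basis xT (y i)).
have wg : w = fun d => (\sum_i a i * g i) * dwedge x d.
  rewrite wE; apply/funext => d; rewrite mulr_suml; apply: eq_bigr => i _.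
  by rewrite gP mulrA.
exists (\sum_i a i * g i) => //; apply/negP => /eqP g0; apply: wn0.
by rewrite wg g0; apply/funext => d; rewrite mul0r.
Qed.

(** Local data replacing finite support of [delta]: a section of the m-th multiple is compared with
    [g ^+ m] for one [g] in [G], and their quotient has nonzero order at only finitely many [E]. *)
Definition generates_divisor A (delta : set K -> int) G : Prop :=
  [/\ G !=set0, forall g, G g -> g != 0 &
   forall E, Spec A E -> dvr E ->
     (forall g, G g -> 0 <= ord E g + delta E) /\
     exists2 g, G g & ord E g + delta E = 0].

Lemma form_coordinates_neq0 (s : seq K) w : affine_ring iota (gen_subalg iota [set` s]) ->
  rational_form w -> form_coordinates iota x (fun i : 'I_(size s) => s`_i) !=set0.
Proof.
move=> [_ frA] rw; have [mw wn0] := rw; pose z (i : 'I_(size s)) := s`_i; rewrite -/z.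
have sT : is_subring (setT : set K) by split.
have [|//|] := (OmegaP sT (z := z) _ _ w).1 mw; last move=> a [_ wE].
  apply: fractions_diff_span => // y _.
  have [a [b [Aa Ab b0 ->]]] : fraction_field (gen_subalg iota [set` s]) y by rewrite frA.
  by exists a, b.
apply: contrapT => G0; apply: wn0; rewrite wE; apply/funext => d.
rewrite big1 // => f _; have [g gP] := dwedge_basis xT (fun j => z (f j)).
rewrite gP; have [->|g0] := eqVneq g 0; first by rewrite mul0r mulr0.
by case: G0; exists g; split=> //; exists f.
Qed.

(* [Omega E] is finitely generated inside a line, hence generated by a coordinate of
   least order. *)
Lemma dvr_form_generator (s : seq K) E w : affine_ring iota (gen_subalg iota [set` s]) ->
  rational_form w -> Spec (gen_subalg iota [set` s]) E -> dvr E ->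
  exists2 g0, form_coordinates iota x (fun i : 'I_(size s) => s`_i) g0 &
   (forall g, form_coordinates iota x (fun i : 'I_(size s) => s`_i) g -> ord E g0 <= ord E g) /\
   Omega E = [set (fun d : 'I_n -> derivation iota => a * (g0 * dwedge x d)) | a in E].
Proof.
move=> aA rw AE dE; have [g [g0 [f gf]]] := form_coordinates_neq0 aA rw.
pose z (i : 'I_(size s)) := s`_i; rewrite -/z in gf *.
have sA := affine_subring aA; have sE := Spec_subring sA AE.
have AsE := Spec_sub sA AE.
have [c cP] := choice (fun f : {ffun 'I_n -> 'I_(size s)} =>
  dwedge_basis xT (fun j => z (f j))).
(* Evaluating at a tuple where [dwedge x] does not vanish makes coordinates unique. *)
have [dd dd0] : exists d : 'I_n -> derivation iota, dwedge x d != 0.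
  apply: contrapT => dx; have [h h0 wE] := rational_form_coordinate rw.
  case: rw => _; apply; rewrite wE; apply/funext => d.
  have [->|dn0] := eqVneq (dwedge x d) 0; first by rewrite mulr0.
  by case: dx; exists d.
have cE h (f' : {ffun 'I_n -> 'I_(size s)}) :
    (forall d : 'I_n -> derivation iota, dwedge (fun j => z (f' j)) d = h * dwedge x d) ->
    c f' = h.
  by move=> hP; apply: (mulIf dd0); rewrite -cP hP.
have cf0 : c f != 0 by rewrite (cE _ _ gf).
have [f0 f0n0 f0min] := @Order.TotalTheory.arg_minP _ _ _ f (fun f => c f != 0) (fun f => ord E (c f)) cf0.
have Gc f' : c f' != 0 -> form_coordinates iota x z (c f') by split=> //; exists f'.
exists (c f0); first exact: Gc.
split.
  move=> h [h0 [f' hf']]; rewrite -(cE _ _ hf'); apply: f0min.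
  by rewrite (cE _ _ hf').
have Ez : E `<=` diff_span iota z E.
  apply: fractions_diff_span => // y /(Spec_frac sA AE)[a [b [Aa Ab mb yE]]].
  by have [b0 Ebv] := (nonmaxP sE (AsE _ Ab)).1 mb; exists a, b.
have zE l : E (z l) by apply: AsE; apply: sub_gen_subalg; rewrite /= mem_nth.
apply/seteqP; split=> [w' /(OmegaP sE Ez zE)[a [Ea ->]]|_ [a Ea <-]].
  exists (\sum_f a f * (c f / c f0)).
    apply: (subring_sum _ sE) => f' _; apply: subringM => //.
    have [->|cf'0] := eqVneq (c f') 0; first by rewrite mul0r; apply: subring0.
    apply/(ord_ge0 dE); first by rewrite mulf_neq0 ?invr_eq0.
    by rewrite (ordM dE) ?invr_eq0 // (ordV dE) // subr_ge0 f0min.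
  apply/funext => d; rewrite mulr_suml; apply: eq_bigr => f' _.
  by rewrite cP -mulrA [c f' / _ * _]mulrA divfK.
apply/(OmegaP sE Ez zE); exists (fun f => (f == f0)%:R * a); split.
  by move=> f'; case: (_ == _); rewrite ?mul1r ?mul0r //; apply: subring0.
apply/funext => d; rewrite (bigD1 f0) //= eqxx mul1r cP big1 ?addr0 //.
by move=> f' /negbTE ->; rewrite !mul0r.
Qed.

(** The generator [eta] in [ord_form] is arbitrary, but two generators of [Omega E] differ by a unit
    of [E], so the order can be computed with [g0]. *)
Lemma ord_form_generator E (g0 h : K) (w : diff_form iota n) : dvr E -> g0 != 0 -> h != 0 ->
  rational_form w -> w = (fun d : 'I_n -> derivation iota => h * dwedge x d) ->
  Omega E = [set (fun d : 'I_n -> derivation iota => a * (g0 * dwedge x d)) | a in E] ->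
  ord_form E w = ord E h - ord E g0.
Proof.
move=> dE g00 h0 rw wE OE; have [sE _] := dE.
have [dd dd0] : exists d : 'I_n -> derivation iota, dwedge x d != 0.
  apply: contrapT => dx; case: rw => _; apply; rewrite wE; apply/funext => d.
  have [->|dn0] := eqVneq (dwedge x d) 0; first by rewrite mulr0.
  by case: dx; exists d.
have wgen : [/\ Omega E = [set (fun d : 'I_n -> derivation iota => a * (g0 * dwedge x d)) | a in E],
   w = (fun d => h / g0 * (g0 * dwedge x d)) & ord E (h / g0) = ord E h - ord E g0].
  split=> //; last by rewrite (ordM dE) ?invr_eq0 // (ordV dE).
  by rewrite wE; apply/funext => d; rewrite mulrA divfK.
apply: xget_subset1; first by exists (fun d => g0 * dwedge x d), (h / g0).
suff aux l : (exists (eta : diff_form iota n) (f : K),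
   [/\ Omega E = [set (fun d => a * eta d) | a in E], w = (fun d => f * eta d) &
       ord E f = l]) -> l = ord E h - ord E g0.
  by move=> l m /aux -> /aux ->.
move=> [eta [f [OE' wE' fl]]].
have [a Ea aE] : [set (fun d => a * eta d) | a in E] (fun d => g0 * dwedge x d).
  rewrite -OE' OE; exists 1; first exact: subring1.
  by apply/funext => d; rewrite mul1r.
have [b Eb bE] : [set (fun d : 'I_n -> derivation iota => a * (g0 * dwedge x d)) | a in E] eta.
  rewrite -OE OE'; exists 1; first exact: subring1.
  by apply/funext => d; rewrite mul1r.
have g0d : g0 * dwedge x dd != 0 by rewrite mulf_neq0.
have ab : a * b = 1.
  apply: (mulIf g0d); rewrite mul1r -mulrA.
  have := congr1 (fun w : diff_form iota n => w dd) bE => /= ->.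
  exact: (congr1 (fun w : diff_form iota n => w dd) aE).
have [a0 b0] : a != 0 /\ b != 0.
  by apply/andP; rewrite -negb_or -mulf_eq0 ab oner_neq0.
have ob : ord E b = 0.
  apply/eqP; rewrite eq_le; apply/andP; split; last by apply/(ord_ge0 dE).
  rewrite -oppr_ge0 -(ordV dE) //; apply/(ord_ge0 dE); first by rewrite invr_eq0.
  by rewrite (_ : b^-1 = a) //; apply: (mulIf b0); rewrite mulVf.
have fb : f * b = h / g0.
  apply: (mulIf g0d); rewrite -mulrA.
  have := congr1 (fun w : diff_form iota n => w dd) bE => /= ->.
  have := congr1 (fun w : diff_form iota n => w dd) wE' => /= <-.
  by rewrite [in LHS]wE mulrA divfK.
have f0 : f != 0.
  by apply: contra_neq h0 => f0; rewrite -[h](divfK g00) -fb f0 !mul0r.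
have := congr1 (ord E) fb.
by rewrite (ordM dE) // ob addr0 fl (ordM dE) ?invr_eq0 // (ordV dE).
Qed.

Lemma canonical_divisor_generated A w : affine_ring iota A -> rational_form w ->
  exists G, generates_divisor A (fun E => ord_form E w) G.
Proof.
move=> aA rw; have [[s AE] _] := aA; rewrite AE in aA *.
have [h h0 wE] := rational_form_coordinate rw.
(* Division by [h] turns coordinates with respect to [dwedge x] into coordinates with respect to
   [w]. *)
exists [set g / h | g in form_coordinates iota x (fun i : 'I_(size s) => s`_i)]; split.
- by have [g Gg] := form_coordinates_neq0 aA rw; exists (g / h), g.
- by move=> _ [g [g0 _] <-]; rewrite mulf_neq0 ?invr_eq0.
- move=> E AsE dE; have [g0 Gg0 [g0min OE]] := dvr_form_generator aA rw AsE dE.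
  have g00 : g0 != 0 by case: Gg0.
  rewrite (ord_form_generator dE g00 h0 rw wE OE).
  have oE g : g != 0 -> ord E (g / h) + (ord E h - ord E g0) = ord E g - ord E g0.
    by move=> gn0; rewrite (ordM dE) ?invr_eq0 // (ordV dE) // addrA subrK.
  split; last by exists (g0 / h); [exists g0|rewrite oE ?subrr].
  by move=> _ [g Gg <-]; rewrite oE ?subr_ge0; [apply: g0min|case: Gg].
Qed.

(** Both forms are multiples of [dwedge x]; [h] is the quotient of their coordinates, and the order
    of the common generator of [Omega E] cancels. *)
Lemma canonical_divisor_ratio w w' : rational_form w -> rational_form w' ->
  exists2 h, h != 0 & forall A E, affine_ring iota A -> Spec A E -> dvr E ->
    ord_form E w' = ord E h + ord_form E w.
Proof.
move=> rw rw'.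
have [h h0 wE] := rational_form_coordinate rw.
have [h' h'0 wE'] := rational_form_coordinate rw'.
exists (h' / h); first by rewrite mulf_neq0 ?invr_eq0.
move=> A E aA AsE dE; have [[s AE] _] := aA; rewrite AE in aA AsE.
have [g0 [g00 _] [_ OE]] := dvr_form_generator aA rw AsE dE.
rewrite (ord_form_generator dE g00 h0 rw wE OE).
rewrite (ord_form_generator dE g00 h'0 rw' wE' OE).
by rewrite (ordM dE) ?invr_eq0 // (ordV dE) // addrA subrK.
Qed.

End CanonicalDivisor.

(** * Graded primes and Proj *)

Section GradedPrimes.
Variable K : fieldType.
Implicit Types (S Q : nat -> set K) (m l : nat) (a b x : K).

(** Homogeneous pieces are kept as subsets [S m] of [K], with [x] in [S m] standing for [x *: 'X^m];
    [Proj_total_ring] translates back to polynomials. *)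
Definition graded_ring S : Prop :=
  [/\ forall m, S m 0, forall m x y, S m x -> S m y -> S m (x - y), S 0%N 1
    & forall m l x y, S m x -> S l y -> S (m + l)%N (x * y)].

Definition graded_prime S Q : Prop :=
  [/\ forall m, Q m `<=` S m,
      forall m, Q m 0 /\ (forall x y, Q m x -> Q m y -> Q m (x + y)),
      forall m l a x, S m a -> Q l x -> Q (m + l)%N (a * x),
      ~ Q 0%N 1
    & forall m l a b, S m a -> S l b -> Q (m + l)%N (a * b) -> Q m a \/ Q l b].

Definition relevant S Q : Prop := exists m b, [/\ (0 < m)%N, S m b & ~ Q m b].

Definition graded_localization S Q : set K :=
  [set x | exists m a b, [/\ S m a, S m b, ~ Q m b & x = a / b]].

Definition total_ring S : set {poly K} := [set p | forall m, S m p`_m].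

Section Basics.
Variables S Q : nat -> set K.
Hypotheses (gS : graded_ring S) (gQ : graded_prime S Q).

Lemma gradedN m x : S m x -> S m (- x).
Proof. by case: gS => S0 SB _ _ Sx; rewrite -sub0r; apply: SB. Qed.

Lemma gradedD m x y : S m x -> S m y -> S m (x + y).
Proof. by case: gS => _ SB _ _ Sx Sy; rewrite -[y]opprK; apply: SB => //; apply: gradedN. Qed.

Lemma gradedX m x n : S m x -> S (m * n)%N (x ^+ n).
Proof.
case: gS => _ _ S1 SM Sx; elim: n => [|n IH]; first by rewrite muln0 expr0.
by rewrite mulnS exprS; apply: SM.
Qed.

Lemma total_ring_hom m a : total_ring S (a *: 'X^m) <-> S m a.
Proof.
case: gS => S0 _ _ _; split=> [/(_ m)|Sa l]; rewrite coefZ coefXn.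
  by rewrite eqxx mulr1.
by case: eqP => [->|_]; rewrite ?mulr1 ?mulr0.
Qed.

Lemma graded_prime_neq0 m b : ~ Q m b -> b != 0.
Proof. by move=> Qb; apply: contra_notN Qb => /eqP ->; case: gQ => _ /(_ m)[]. Qed.

Lemma graded_primeM m l a b : S m a -> S l b -> ~ Q m a -> ~ Q l b ->
  ~ Q (m + l)%N (a * b).
Proof. by case: gQ => _ _ _ _ QP Sa Sb Qa Qb /QP[]. Qed.

Lemma graded_primeX m b n : S m b -> ~ Q m b -> ~ Q (m * n)%N (b ^+ n).
Proof.
move=> Sb Qb; elim: n => [|n IH]; first by rewrite muln0 expr0; case: gQ.
by rewrite mulnS exprS; apply: graded_primeM => //; apply: gradedX.
Qed.

Lemma graded_localization_subring : is_subring (graded_localization S Q).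
Proof.
have [S0 SB S1 SM] := gS; split.
- by exists 0%N, 1, 1; rewrite divr1; split=> //; case: gQ.
- move=> _ _ [m [a [b [Sa Sb Qb ->]]]] [l [c [d [Sc Sd Qd ->]]]].
  exists (m + l)%N, (a * d - c * b), (b * d); split.
  + by apply: SB; [apply: SM|rewrite addnC; apply: SM].
  + exact: SM.
  + exact: graded_primeM.
  + have b0 := graded_prime_neq0 Qb; have d0 := graded_prime_neq0 Qd.
    by field; rewrite b0 d0.
- move=> _ _ [m [a [b [Sa Sb Qb ->]]]] [l [c [d [Sc Sd Qd ->]]]].
  exists (m + l)%N, (a * c), (b * d); split; [exact: SM|exact: SM|exact: graded_primeM|].
  by rewrite mulf_div.
Qed.

Lemma maxideal_graded_localization m a b : S m a -> S m b -> ~ Q m b ->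
  maxideal (graded_localization S Q) (a / b) <-> Q m a.
Proof.
move=> Sa Sb Qb; have sL := graded_localization_subring.
have Lab : graded_localization S Q (a / b) by exists m, a, b.
have b0 := graded_prime_neq0 Qb; have [QS Q0 QM Q1 QP] := gQ.
split=> [mab|Qa]; apply: contrapT.
  move=> nQa; move: mab; apply/(nonmaxP sL Lab); have a0 := graded_prime_neq0 nQa.
  by rewrite mulf_neq0 ?invr_eq0 // invf_div; split=> //; exists m, b, a.
move/(nonmaxP sL Lab); rewrite mulf_eq0 invr_eq0 (negbTE b0) orbF invf_div.
move=> [a0 [l [c [d [Sc Sd Qd /eqP]]]]]; have d0 := graded_prime_neq0 Qd.
rewrite (eqr_div _ _ a0 d0) => /eqP bd; apply: (graded_primeM Sb Sd Qb Qd).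
by rewrite bd addnC; apply: QM.
Qed.

Lemma graded_localization_local : local_ring (graded_localization S Q).
Proof.
have sL := graded_localization_subring; have [S0 SB S1 SM] := gS.
have [QS Q0 QM Q1 QP] := gQ; split=> // x y mx my.
have [m [a [b [Sa Sb Qb xE]]]] := sub_maxideal mx.
have [l [c [d [Sc Sd Qd yE]]]] := sub_maxideal my.
have b0 := graded_prime_neq0 Qb; have d0 := graded_prime_neq0 Qd.
rewrite xE in mx *; rewrite yE in my *.
move: mx my => /(maxideal_graded_localization Sa Sb Qb) Qa.
move=> /(maxideal_graded_localization Sc Sd Qd) Qc.
rewrite addf_div //; apply/(@maxideal_graded_localization (m + l)%N).
- by apply: gradedD; [apply: SM|rewrite addnC; apply: SM].
- exact: SM.
- exact: graded_primeM.
- case: (Q0 (m + l)%N) => _; apply; last by rewrite mulrC; apply: QM.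
  by rewrite mulrC addnC; apply: QM.
Qed.

End Basics.

(* Homogeneous prime ideals of the total ring are the graded primes. *)
Lemma Proj_total_ring S : graded_ring S -> forall P, Proj (total_ring S) P <->
  exists Q, [/\ graded_prime S Q, relevant S Q & P = graded_localization S Q].
Proof.
move=> gS P; have [S0 SB S1 SM] := gS.
have homM a x m l : (a * x) *: 'X^(m + l) = (a *: 'X^m) * (x *: 'X^l) :> {poly K}.
  by rewrite -scalerAl -scalerAr scalerA exprD.
split=> [[q [[qS [q0 qD] qM q1 qP] qhom [p [Sp p0 qp]]] ->]|[Q [gQ [m [b [m0 Sb Qb]]] ->]]].
- pose Q m := [set a | q (a *: 'X^m)].
  have qsum (n : nat) (F : nat -> {poly K}) : (forall i, (i < n)%N -> q (F i)) ->
      q (\sum_(i < n) F i).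
    move=> qF; apply: (big_ind q) => // i _; exact: qF.
  exists Q; split.
  + split=> [m a /qS/(total_ring_hom gS)//|m|m l a x Sa Qx|Q01|m l a b Sa Sb Qab].
    * split=> [|x y Qx Qy]; first by rewrite /Q /= scale0r.
      by rewrite /Q /= scalerDl; apply: qD.
    * by rewrite /Q /= homM; apply: qM => //; apply/total_ring_hom.
    * by apply: q1; rewrite /Q /= expr0 scale1r in Q01.
    * by apply: qP; [apply/total_ring_hom|apply/total_ring_hom|rewrite -homM].
  + apply: contrapT => H; apply: qp.
    rewrite -[p]coefK poly_def; apply: (qsum _ (fun i => p`_i *: 'X^i)) => i _.
    have [->|i0] := posnP i; first by rewrite p0 scale0r.
    by apply: contrapT => nq; apply: H; exists i, p`_i.
  + apply/seteqP; split=> x [m [a [b [Sa Sb Qb ->]]]]; exists m, a, b.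
      by split=> //; apply/(total_ring_hom gS).
    by split=> //; apply/(total_ring_hom gS).
- have [QS Q0 QM Q1 QP] := gQ; pose q : set {poly K} := [set p | forall m, Q m p`_m].
  have qhom m' a : q (a *: 'X^m') <-> Q m' a.
    split=> [/(_ m')|Qa l]; rewrite coefZ coefXn; first by rewrite eqxx mulr1.
    by case: eqP => [->|_]; rewrite ?mulr1 ?mulr0 //; case: (Q0 l).
  have Qsum n (J : Type) (r : seq J) (R : pred J) (F : J -> K) :
      (forall j, R j -> Q n (F j)) -> Q n (\sum_(j <- r | R j) F j).
    by move=> QF; apply: (big_ind (Q n)) => //; case: (Q0 n).
  exists q; last first.
    apply/seteqP; split=> x [l [a [c [Sa Sc Qc ->]]]]; exists l, a, c.
      by split=> //; [apply/total_ring_hom|apply/total_ring_hom|rewrite qhom].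
    by split=> //; [apply/(total_ring_hom gS)|apply/(total_ring_hom gS)|rewrite -qhom].
  split.
  + split=> [p qp l|||/(_ 0%N)|].
    * exact: QS.
    * split=> [l|p p' qp qp' l]; first by rewrite coef0; case: (Q0 l).
      by rewrite coefD; case: (Q0 l) => _; apply.
    * move=> p p' Sp qp' l; rewrite coefM; apply: Qsum => i _.
      have := QM i (l - i)%N _ _ (Sp i) (qp' (l - i)%N).
      by rewrite subnKC // -ltnS ltn_ord.
    * by rewrite coef1.
    * move=> p p' Sp Sp' qpp'; apply: contrapT => /not_orP[qp qp'].
      have ex (s : {poly K}) : ~ q s -> exists i, `[< ~ Q i s`_i >].
        by move=> /existsNP[i Qi]; exists i; apply/asboolP.
      (* With the lowest coefficients outside [Q] in degrees [i] and [j], every other term of the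
         coefficient of degree [i + j] in the product has a factor in [Q]. *)
      case: (ex_minnP (ex _ qp)) => i /asboolP Qi mini.
      case: (ex_minnP (ex _ qp')) => j /asboolP Qj minj.
      apply: (graded_primeM gQ (Sp i) (Sp' j) Qi Qj).
      have := qpp' (i + j)%N; rewrite coefM.
      have ij : (i < (i + j).+1)%N by rewrite ltnS leq_addr.
      rewrite (bigD1 (Ordinal ij)) //= addKn => Qij.
      rewrite -[X in Q _ X](addrK (\sum_(l < (i + j).+1 | l != Ordinal ij) p`_l * p'`_(i + j - l))).
      case: (Q0 (i + j)%N) => _; apply=> //.
      rewrite -sumrN; apply: Qsum => l lij; rewrite -mulNr.
      have lle : (l <= i + j)%N by rewrite -ltnS ltn_ord.
      have li : (l : nat) != i := lij.
      move: (nat_of_ord l) li lle => h hi hle.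
      have [lti|ile] := ltnP h i.
        have Ql : Q h p`_h.
          by apply: contrapT => /asboolP/mini; rewrite leqNgt lti.
        rewrite mulrC -[X in Q X _](subnK hle); apply: (QM) => //.
        rewrite -mulN1r; exact: (QM 0%N h (-1) _ (gradedN gS S1) Ql).
      have lj : (i + j - h < j)%N by lia.
      have Ql : Q (i + j - h)%N p'`_(i + j - h).
        by apply: contrapT => /asboolP/minj; rewrite leqNgt lj.
      rewrite -[X in Q X _](subnKC hle); apply: QM => //; exact: gradedN.
  + by move=> p qp l; apply/qhom; apply: qp.
  + exists (b *: 'X^m); split; first by apply/total_ring_hom.
      by rewrite coefZ coefXn; case: eqP m0 => [<-//|_]; rewrite mulr0.
    by rewrite qhom.
Qed.

End GradedPrimes.

(** * Sections of divisorial sheaves *)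

Section Sections.
Variables (k K : fieldType) (iota : {rmorphism k -> K}) (X : set (set K)).
Hypotheses (vX : variety iota X) (nX : normal_variety X).
Variable delta : set K -> int.
Implicit Types (A P E V : set K) (U : set (set K)) (Q : nat -> set K).

Lemma ord_add E a b (c : int) : dvr E -> a != 0 -> b != 0 -> a + b != 0 ->
  c <= ord E a -> c <= ord E b -> c <= ord E (a + b).
Proof.
move=> dE; have [sE _] := dE.
wlog oab : a b / ord E a <= ord E b.
  move=> wl a0 b0 ab0 oa ob; have [/wl|/ltW/wl] := leP (ord E a) (ord E b); first exact.
  by rewrite addrC; apply=> //; rewrite addrC.
move=> a0 b0 ab0 oa _; apply: le_trans oa _.
have /(ord_ge0 dE) : E ((a + b) / a).
  rewrite mulrDl divff //; apply: subringD => //; first exact: subring1.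
  by apply/(ord_ge0 dE); rewrite ?mulf_neq0 ?invr_eq0 // (ordM dE) ?invr_eq0 // (ordV dE) // subr_ge0.
by rewrite mulf_neq0 ?invr_eq0 // (ordM dE) ?invr_eq0 // (ordV dE) // subr_ge0; apply.
Qed.

Definition sections U (m : nat) : set K :=
  sheaf_O X (fun E => m%:R * (delta E)%:~R) U.

Lemma sectionsP U m a : sections U m a <-> (a != 0 ->
  forall E, prime_divisor X E -> U E -> 0 <= ord E a + m%:Z * delta E).
Proof.
have eqE E : (0 <= principal a E + m%:R * (delta E)%:~R) = (0 <= ord E a + m%:Z * delta E).
  by rewrite /principal -[m%:R]/(m%:Z%:~R) -intrM -intrD ler0z.
split=> [[->|H]|H]; first by rewrite eqxx.
  by move=> _ E pE UE; rewrite -eqE; apply: H.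
have [->|a0] := eqVneq a 0; [by left|right=> E pE UE].
by rewrite eqE; apply: H.
Qed.

Lemma sections_graded U : graded_ring (sections U).
Proof.
have dvrX E : prime_divisor X E -> dvr E by apply: prime_divisor_dvr vX nX _.
split=> [m|m x y /sectionsP Sx /sectionsP Sy||m l x y /sectionsP Sx /sectionsP Sy].
- by left.
- apply/sectionsP => xy0 E pE UE; have dE := dvrX E pE.
  have [x0|x0] := eqVneq x 0.
    have y0 : y != 0 by apply: contra_neq xy0 => y0; rewrite x0 y0 subrr.
    rewrite x0 sub0r -mulN1r (ordM dE) ?oppr_eq0 ?oner_neq0 //.
    have -> : ord E (-1) = 0; last by rewrite add0r; apply: Sy.
    have : ord E (-1) + ord E (-1) = 0.
      by rewrite -(ordM dE) ?oppr_eq0 ?oner_neq0 // mulrNN mulr1 (ord1 dE).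
    by lia.
  have [y0|y0] := eqVneq y 0; first by rewrite y0 subr0; apply: Sx.
  have oN : ord E (- y) = ord E y.
    have oN1 : ord E (-1) + ord E (-1) = 0.
      by rewrite -(ordM dE) ?oppr_eq0 ?oner_neq0 // mulrNN mulr1 (ord1 dE).
    by rewrite -mulN1r (ordM dE) ?oppr_eq0 ?oner_neq0 //; lia.
  rewrite -[m%:Z * _]opprK subr_ge0; apply: ord_add => //; rewrite ?oppr_eq0 ?oN //.
    by rewrite -subr_ge0 opprK; apply: Sx.
  by rewrite -subr_ge0 opprK; apply: Sy.
- by apply/sectionsP => _ E pE UE; rewrite (ord1 (dvrX E pE)) mul0r.
- apply/sectionsP; rewrite mulf_eq0 negb_or => /andP[x0 y0] E pE UE.
  rewrite (ordM (dvrX E pE)) // PoszD mulrDl addrACA addr_ge0 //; [exact: Sx|exact: Sy].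
Qed.

Section Affine.
Variable A : set K.
Hypotheses (aA : affine_ring iota A) (AX : Spec A `<=` X).
Local Notation S := (sections (Spec A)).

Let sA : is_subring A. Proof. exact: affine_subring aA. Qed.

Lemma Spec_prime_divisor E : Spec A E -> dvr E -> prime_divisor X E.
Proof. by move=> AE dE; apply/(prime_divisorP vX nX); split=> //; apply: AX. Qed.

(** The direction from sections to [A] is Hartogs' principle: nonnegative order at the prime
    divisors through a point puts [a] in its local ring, and [A] is the intersection of these
    rings. *)
Lemma sections_base a : S 0%N a <-> A a.
Proof.
split=> [/sectionsP Sa|Aa]; last first.
  apply/sectionsP => a0 E pE AE; rewrite mul0r addr0.
  apply/(ord_ge0 (prime_divisor_dvr vX nX pE)) => //.
  exact: Spec_sub sA AE _ Aa.
rewrite -(regular_functions_Spec aA) => P AP; apply: (variety_krull vX nX aA AX AP).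
move=> E pE PE; have dE := prime_divisor_dvr vX nX pE.
have [->|a0] := eqVneq a 0; first by apply: subring0; case: dE.
apply/(ord_ge0 dE) => //; have := Sa a0 E pE; rewrite mul0r addr0; apply.
apply: (variety_mem_Spec vX aA AX); first by case: pE.
by apply: subset_trans PE; apply: Spec_sub.
Qed.

Lemma mul_sections c m a : A c -> S m a -> S m (c * a).
Proof. by case: (sections_graded (Spec A)) => _ _ _ SM /sections_base Sc; apply: (SM 0%N). Qed.

Lemma Spec_generization P E : Spec A P -> prime_divisor X E -> P `<=` E -> Spec A E.
Proof.
move=> AP pE PE; apply: (variety_mem_Spec vX aA AX); first by case: pE.
by apply: subset_trans PE; apply: Spec_sub.
Qed.

(** The members of [T] are treated one at a time by multiplying with a high power of an element that
    is positive there; sections have nonnegative order along the divisor, so bounds already reached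
    survive. It serves both degree 0 elements outside a point and homogeneous elements outside a
    graded prime. *)
Lemma exists_multiplier (M : nat -> set K) (T : set (set K)) (e : set K -> int) :
  finite_set T -> (forall E, T E -> Spec A E /\ dvr E) ->
  M 0%N 1 -> (forall m l a b, M m a -> M l b -> M (m + l)%N (a * b)) ->
  (forall m a, M m a -> a != 0 /\ S m a) ->
  (forall E, T E -> exists m c, M m c /\ 0 < ord E c + m%:Z * delta E) ->
  exists m c, M m c /\ forall E, T E -> e E <= ord E c + m%:Z * delta E.
Proof.
move=> /finite_seqP[ts ->] {T} Tdvr M1 MM MS Mpos.
elim: ts Tdvr Mpos => [|E ts IH] Tdvr Mpos; first by exists 0%N, 1.
have [||m [c [Mc cP]]] := IH.
- by move=> F Fts; apply: Tdvr; rewrite /= in_cons Fts orbT.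
- by move=> F Fts; apply: Mpos; rewrite /= in_cons Fts orbT.
have Ets : [set` E :: ts] E by rewrite /= mem_head.
have [l [b [Mb bpos]]] := Mpos E Ets.
have MX n : M (l * n)%N (b ^+ n).
  elim: n => [|n IHn]; first by rewrite muln0 expr0.
  by rewrite mulnS exprS; apply: MM.
have [c0 Sc] := MS _ _ Mc; have [b0 Sb] := MS _ _ Mb.
(* Each factor [b] contributes at least 1 at [E], so this many factors make up the deficit. *)
pose n := absz (e E - (ord E c + m%:Z * delta E))%R.
exists (m + l * n)%N, (c * b ^+ n); split; first exact: MM.
have ordE F : dvr F -> ord F (c * b ^+ n) + (m + l * n)%N%:Z * delta F =
    (ord F c + m%:Z * delta F) + n%:Z * (ord F b + l%:Z * delta F).
  move=> dF; rewrite (ordM dF) ?expf_neq0 // (ordX dF) // -mulr_natl natz.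
  by rewrite PoszD PoszM; ring.
move=> F; rewrite /= in_cons => Fts.
have [AF dF] : Spec A F /\ dvr F by apply: Tdvr; rewrite /= in_cons.
have pF := Spec_prime_divisor AF dF.
rewrite ordE //; case/orP: Fts => [/eqP FE|Fts].
  subst F.
  have : n%:Z <= n%:Z * (ord E b + l%:Z * delta E).
    by rewrite -[leLHS]mulr1 ler_wpM2l // -gtz0_ge1.
  by rewrite /n; lia.
have /sectionsP/(_ b0 F pF AF) := Sb.
by move=> /(mulr_ge0 (ler0n _ n)); have := cP F Fts; lia.
Qed.

Variable G : set K.
Hypothesis AG : generates_divisor A delta G.

Lemma generator_section g : G g -> S 1%N g.
Proof.
case: AG => _ Gn0 GE Gg; apply/sectionsP => g0 E pE AE; rewrite mul1r.
by case: (GE E AE (prime_divisor_dvr vX nX pE)) => + _; apply.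
Qed.

(* Clear the denominators of [a] at the finitely many [E] that do not contain [P]. *)
Lemma section_at_point P m a : Spec A P ->
  (a != 0 -> forall E, prime_divisor X E -> P `<=` E -> 0 <= ord E a + m%:Z * delta E) ->
  exists c, [/\ A c, ~ maxideal P c & S m (c * a)].
Proof.
move=> AP aP; have sP := Spec_subring sA AP; have AsP := Spec_sub sA AP.
have lP := Spec_local sA AP.
have [a0|a0] := eqVneq a 0.
  exists 1; split; [exact: subring1|exact: maxideal1|rewrite a0 mulr0; by left].
have [[g Gg] Gn0 GE] := AG; have g0 := Gn0 g Gg.
(* Passing to [x] leaves finitely many divisors to treat: where [x] has order 0, [a] has the order
   of the section [g ^+ m] and satisfies the bound already. *)
pose x := a / g ^+ m.
have x0 : x != 0 by rewrite mulf_neq0 // invr_eq0 expf_neq0.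
have ox E : dvr E -> ord E x = ord E a - m%:Z * ord E g.
  move=> dE; rewrite /x (ordM dE) ?invr_eq0 ?expf_neq0 //.
  by rewrite (ordV dE) ?expf_neq0 // (ordX dE) // -mulr_natl natz.
pose T := [set E | [/\ Spec A E, dvr E & ord E x != 0]] `&` [set E | ~ P `<=` E].
pose M m := [set c | [/\ m = 0%N, A c & ~ maxideal P c]].
have [||||||l [c [[l0 Ac mc] cP]]] := @exists_multiplier M T (fun E => - ord E x).
- by apply: sub_finite_set (finite_dvr_ord aA x0); apply: subIsetl.
- by move=> E [[]].
- by split=> //; [apply: subring1|apply: maxideal1].
- move=> i j b c [-> Ab mb] [-> Ac mc]; split=> //; first exact: subringM.
  by case: (local_prime lP) => _ _ _ _ mP /(mP _ _ (AsP _ Ab) (AsP _ Ac))[].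
- move=> i c [-> Ac mc]; split; last exact/sections_base.
  by case/(nonmaxP sP (AsP _ Ac)): mc.
- move=> E [[AE dE _] PE]; have sE := Spec_subring sA AE; have AsE := Spec_sub sA AE.
  apply: contrapT => nc; apply: PE => y /(Spec_frac sA AP)[b [d [Ab Ad md ->]]].
  have d0 : d != 0 by case/(nonmaxP sP (AsP _ Ad)): md.
  apply: subringM => //; first exact: AsE.
  suff /(nonmaxP sE (AsE _ Ad))[] : ~ maxideal E d by [].
  move=> /(ord_gt0 dE d0) od; apply: nc; exists 0%N, d; split=> //.
  by rewrite mul0r addr0.
exists c; split=> //; apply/sectionsP => ca0 E pE AE.
have dE := prime_divisor_dvr vX nX pE.
have c0 : c != 0 by apply: contra_neq ca0 => ->; rewrite mul0r.
rewrite (ordM dE) //.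
have oc : 0 <= ord E c by apply/(ord_ge0 dE c0); apply: Spec_sub sA AE _ Ac.
have [PE|nPE] := pselect (P `<=` E); first by have := aP a0 E pE PE; lia.
have gE : 0 <= m%:Z * (ord E g + delta E).
  by rewrite mulr_ge0 //; case: (GE E AE dE) => + _; apply.
have := ox E dE; have [oxE|oxE] := eqVneq (ord E x) 0.
  by rewrite oxE; lia.
have := cP E (conj (And3 AE dE oxE) nPE); rewrite l0 mul0r.
by lia.
Qed.

Section Point.
Variable Q : nat -> set K.
Hypotheses (gQ : graded_prime S Q) (rQ : relevant S Q).
Local Notation P' := (graded_localization S Q).

Let gS := sections_graded (Spec A).
Let lP' := graded_localization_local gS gQ.
Let sP' := graded_localization_subring gS gQ.

Lemma sub_point : A `<=` P'.
Proof.
move=> a Aa; exists 0%N, a, 1; rewrite divr1; split=> //; first exact/sections_base.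
  by apply/sections_base; apply: subring1.
by case: gQ.
Qed.

Definition point_center : set K := localization A (A `&` maxideal P').

Lemma point_centerP : Spec A point_center /\ dominates P' point_center.
Proof. exact: center_Spec sA lP' sub_point. Qed.

Lemma maxideal_point_center c : A c -> maxideal point_center c <-> Q 0%N c.
Proof.
move=> Ac; have [AP dP] := point_centerP; have sP := Spec_local sA AP.
rewrite -(dominates_maxideal sP lP' dP); last exact: Spec_sub sA AP _ Ac.
rewrite -[X in maxideal _ X]divr1; apply: (maxideal_graded_localization gS gQ).
- exact/sections_base.
- by apply/sections_base; apply: subring1.
- by case: gQ.
Qed.

(* Only the finitely many [E] with [ord E x < 0] matter; [P'] is not contained in
   such an [E], so a denominator of [P'] has positive order there. *)
Lemma point_intersection x :
  (forall E, prime_divisor X E -> P' `<=` E -> E x) -> P' x.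
Proof.
move=> xE; have [x0|x0] := eqVneq x 0; first by rewrite x0; apply: subring0.
pose T := [set E | [/\ Spec A E, dvr E & ord E x != 0]] `&` [set E | ord E x < 0].
pose M m := [set c | S m c /\ ~ Q m c].
have [||||||m [c [[Sc Qc] cP]]] := @exists_multiplier M T (fun E => - ord E x).
- by apply: sub_finite_set (finite_dvr_ord aA x0); apply: subIsetl.
- by move=> E [[]].
- by split; [by apply/sections_base; apply: subring1|case: gQ].
- move=> m l a b [Sa Qa] [Sb Qb]; split; first by case: gS => _ _ _; apply.
  exact: (graded_primeM gQ).
- by move=> m a [Sa Qa]; split=> //; apply: (graded_prime_neq0 gQ Qa).
- move=> E [[AE dE _] ox]; have pE := Spec_prime_divisor AE dE.
  have : ~ P' `<=` E.
    by move=> /(xE _ pE)/(ord_ge0 dE x0); rewrite leNgt ox.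
  move=> /existsNP[y /not_implyP[[m [a [b [Sa Sb Qb ->]]]] nEy]].
  exists m, b; split=> //; have b0 := graded_prime_neq0 gQ Qb.
  have a0 : a != 0.
    by apply: contra_notN nEy => /eqP ->; rewrite mul0r; apply: subring0; case: dE.
  have /sectionsP/(_ a0 E pE AE) := Sa.
  (* The numerator is a section, so its order is at least [- m%:Z * delta E]; a denominator of
     larger order is positive along the divisor. *)
  suff : ord E a < ord E b by lia.
  rewrite ltNge; apply/negP => oab; apply: nEy; apply/(ord_ge0 dE).
    by rewrite mulf_neq0 ?invr_eq0.
  by rewrite (ordM dE) ?invr_eq0 // (ordV dE) // subr_ge0.
have c0 := graded_prime_neq0 gQ Qc.
exists m, (c * x), c; split=> //; last by rewrite mulrC mulKf.
apply/sectionsP => cx0 E pE AE; have dE := prime_divisor_dvr vX nX pE.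
rewrite (ordM dE) //; have [ox|ox] := ltP (ord E x) 0.
  have := cP E (conj (And3 AE dE (ltr0_neq0 ox)) ox); lia.
have /sectionsP/(_ c0 E pE AE) := Sc; lia.
Qed.

Lemma point_integrally_closed : integrally_closed P'.
Proof.
move=> x p pm pP px; apply: point_intersection => E pE PE.
apply: (nX _ pm) px; first by case: pE.
by move=> i; apply/PE/pP.
Qed.

End Point.

End Affine.

End Sections.

(** * Affine charts of Proj *)

Section Charts.
Variable K : fieldType.
Implicit Types (S Q : nat -> set K) (A V : set K).

(** The degree 0 part of [S] localized at [b], that is, the coordinate ring of the open subset of
    Proj where [b] does not vanish. *)
Definition chart S (d : nat) (b : K) : set K :=
  [set x | exists m a, S (m * d)%N a /\ x = a / b ^+ m].

Section Chart.
Variables (S : nat -> set K) (d : nat) (b : K).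
Hypotheses (gS : graded_ring S) (d0 : (0 < d)%N) (b0 : b != 0) (Sb : S d b).
Local Notation B := (chart S d b).

Lemma chart_subring : is_subring B.
Proof.
have [S0 SB S1 SM] := gS.
have Sbn n : S (n * d)%N (b ^+ n) by rewrite mulnC; apply: gradedX.
have bn0 n : b ^+ n != 0 by rewrite expf_neq0.
split=> [|_ _ [m [a [Sa ->]]] [n [c [Sc ->]]]|_ _ [m [a [Sa ->]]] [n [c [Sc ->]]]].
- by exists 0%N, 1; rewrite expr0 divr1.
- exists (m + n)%N, (a * b ^+ n - c * b ^+ m); split.
    by rewrite mulnDl; apply: SB; [|rewrite addnC]; apply: SM.
  by rewrite exprD; field; rewrite !bn0.
- by exists (m + n)%N, (a * c); rewrite mulnDl exprD mulf_div; split=> //; apply: SM.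
Qed.

Lemma chart_power m a : S m a -> B (a ^+ d / b ^+ m).
Proof. by move=> Sa; exists m, (a ^+ d); split=> //; apply: gradedX. Qed.

Let expr_pred (c : K) : c ^+ d = c * c ^+ d.-1.
Proof. by rewrite -exprS prednK. Qed.

Let chart_numerator m a c : S m a -> S m c -> S (m * d)%N (a * c ^+ d.-1).
Proof.
move=> Sa Sc; have -> : (m * d = m + m * d.-1)%N by rewrite -mulnS prednK.
by case: gS => _ _ _; apply=> //; apply: gradedX.
Qed.

Lemma graded_localization_chart Q : graded_prime S Q -> ~ Q d b ->
  Spec B (graded_localization S Q).
Proof.
move=> gQ Qb; have [S0 SB S1 SM] := gS; have sB := chart_subring.
have sL := graded_localization_subring gS gQ.
have lL := graded_localization_local gS gQ.
have Sbn n : S (n * d)%N (b ^+ n) by rewrite mulnC; apply: gradedX.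
have Qbn n : ~ Q (n * d)%N (b ^+ n).
  by rewrite mulnC; apply: (graded_primeX gS gQ).
have BL : B `<=` graded_localization S Q.
  by move=> _ [m [a [Sa ->]]]; exists (m * d)%N, a, (b ^+ m).
have [BP dP] := center_Spec sB lL BL.
suff -> : graded_localization S Q = localization B (B `&` maxideal (graded_localization S Q)) by [].
apply/seteqP; split; last by case: dP.
move=> _ [m [a [c [Sa Sc Qc ->]]]]; have c0 := graded_prime_neq0 gQ Qc.
(* Multiplying numerator and denominator by [c ^+ d.-1] raises the degree to [m * d], so that
   division by [b ^+ m] lands in the chart. *)
exists (a * c ^+ d.-1 / b ^+ m), (c ^+ d / b ^+ m); split.
- exists m, (a * c ^+ d.-1); split=> //.
  exact: chart_numerator.
- exact: chart_power.
- case=> _; rewrite (maxideal_graded_localization gS gQ (m := (m * d)%N)) //.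
    exact: (graded_primeX gS gQ).
  exact: gradedX.
- by rewrite expr_pred; field; rewrite c0 !expf_neq0.
Qed.

(* For the prime [p] of the chart, [Q] consists of the [a] in [S m] with [a^d / b^m]
   in [p]; this is additive because the binomial expansion of [(x + y)^(2d)] has only
   terms divisible by [x^d] or by [y^d]. *)
Lemma chart_graded_localization P : Spec B P -> exists Q,
  [/\ graded_prime S Q, relevant S Q & P = graded_localization S Q].
Proof.
move=> [p pp PE]; have [S0 SB S1 SM] := gS; have sB := chart_subring.
have [pB [p0 pD] pM p1 pP] := pp.
have Sbn n : S (n * d)%N (b ^+ n) by rewrite mulnC; apply: gradedX.
have bn0 n : b ^+ n != 0 by rewrite expf_neq0.
pose Q m := [set a | S m a /\ p (a ^+ d / b ^+ m)].
have pX x n : B x -> p (x ^+ n) -> p x.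
  move=> Bx; elim: n => [/p1//|n IH]; rewrite exprS => /pP[] //; exact: subringX.
have gQ : graded_prime S Q.
  split=> [m a []//|m|m l a x Sa [Sx px]|[_]|m l a c Sa Sc [_ pac]].
  - split; first by split=> //; rewrite expr0n eqn0Ngt d0 mul0r.
    move=> x y [Sx px] [Sy py]; have Sxy := gradedD gS Sx Sy; split=> //.
    apply: (pX _ 2); first exact: chart_power.
    rewrite expr_div_n -!exprM exprDn mulr_suml.
    apply: (big_ind p) => // i _; rewrite mulrnAl -mulr_natl.
    have Bn : B ('C(d * 2, i)%:R).
      elim: 'C(_, _) => [|j IHj]; first exact: subring0.
      by rewrite -addn1 natrD; apply: subringD => //; exact: subring1.
    apply: (pM) => //; have [id|di] := leqP d i.
      rewrite (_ : _ / _ = (x ^+ (d * 2 - i) * y ^+ (i - d) / b ^+ m) * (y ^+ d / b ^+ m)).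
        apply: (pM) => //; exists m, (x ^+ (d * 2 - i) * y ^+ (i - d)); split=> //.
        have -> : (m * d = m * (d * 2 - i) + m * (i - d))%N.
          by rewrite -mulnDr; congr muln; have := ltn_ord i; lia.
        by apply: SM; apply: gradedX.
      by rewrite mulf_div -exprD -[_ * _ * y ^+ d]mulrA -exprD subnK // (_ : m + m = m * 2)%N // muln2 addnn.
    rewrite (_ : _ / _ = (x ^+ (d - i) * y ^+ i / b ^+ m) * (x ^+ d / b ^+ m)).
      apply: (pM) => //; exists m, (x ^+ (d - i) * y ^+ i); split=> //.
      have -> : (m * d = m * (d - i) + m * i)%N by rewrite -mulnDr subnK // ltnW.
      by apply: SM; apply: gradedX.
    rewrite mulf_div -exprD [_ * _ * x ^+ d]mulrAC -exprD (_ : m + m = m * 2)%N ?muln2 ?addnn //.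
    by congr (x ^+ _ * _ / _); lia.
  - split; first exact: SM.
    by rewrite exprMn exprD -mulf_div; apply: (pM) => //; apply: chart_power.
  - by rewrite expr1n expr0 divr1.
  - rewrite exprMn exprD -mulf_div in pac.
    by case: (pP _ _ (chart_power Sa) (chart_power Sc) pac); [left|right].
have Qb : ~ Q d b by case=> _; rewrite divff.
exists Q; split=> //; first by exists d, b.
rewrite PE; apply/seteqP; split=> [_ [_ [_ [[m [a [Sa ->]]] [n [c [Sc ->]]] pc ->]]]|].
  exists ((m + n) * d)%N, (a * b ^+ n), (c * b ^+ m); split.
  - by rewrite mulnDl; apply: SM.
  - by rewrite mulnDl addnC; apply: SM.
  - case=> _; rewrite (_ : _ / _ = (c / b ^+ n) ^+ d).
      by move=> pcd; apply: pc; apply: pX pcd; exists n, c.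
    rewrite exprMn expr_div_n mulnDl exprD -!exprM.
    by field; rewrite !bn0.
  - have [->|c0] := eqVneq c 0; first by rewrite !mul0r invr0 !mulr0.
    by field; rewrite !bn0 c0.
move=> _ [m [a [c [Sa Sc Qc ->]]]]; have c0 := graded_prime_neq0 gQ Qc.
exists (a * c ^+ d.-1 / b ^+ m), (c ^+ d / b ^+ m); split.
- exists m, (a * c ^+ d.-1); split=> //.
  exact: chart_numerator.
- exact: chart_power.
- by move=> pc; apply: Qc.
- by rewrite expr_pred; field; rewrite c0 !expf_neq0.
Qed.

End Chart.

(** Multiplication by one generator at a time gives an induction principle for all homogeneous
    elements, without polynomials in the generators. *)
Inductive homogeneous_span A (L : seq (nat * K)) : nat -> K -> Prop :=
| homogeneous_base a : A a -> homogeneous_span A L 0 a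
| homogeneous_zero m : homogeneous_span A L m 0
| homogeneous_sub m x y :
    homogeneous_span A L m x -> homogeneous_span A L m y -> homogeneous_span A L m (x - y)
| homogeneous_mul m x e :
    e \in L -> homogeneous_span A L m x -> homogeneous_span A L (e.1 + m) (e.2 * x).

Lemma homogeneous_spanM A L m l x y : is_subring A ->
  homogeneous_span A L m x -> homogeneous_span A L l y ->
  homogeneous_span A L (m + l) (x * y).
Proof.
move=> sA Hx Hy; elim: Hx => {m x} [a Aa|m|m x z _ IHx _ IHz|m x e eL _ IH].
- rewrite add0n; elim: Hy => {l y} [c Ac|l|l x z _ IHx _ IHz|l x e eL _ IH].
  + by apply: homogeneous_base; apply: subringM.
  + by rewrite mulr0; apply: homogeneous_zero.
  + by rewrite mulrBr; apply: homogeneous_sub.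
  + by rewrite mulrCA; apply: homogeneous_mul.
- by rewrite mul0r; apply: homogeneous_zero.
- by rewrite mulrBl; apply: homogeneous_sub.
- by rewrite -addnA -mulrA; apply: homogeneous_mul.
Qed.

Definition homogeneous_generators A S (L : seq (nat * K)) : Prop :=
  (forall e, e \in L -> [/\ (0 < e.1)%N, e.2 != 0 & S e.1 e.2]) /\
  forall m a, S m a -> homogeneous_span A L m a.

(** The components of the finitely many generators generate. Those of degree 0 already lie in [A],
    and zero ones are dropped, so the rest can serve as denominators of charts. *)
Lemma homogeneous_generators_exist A S : graded_ring S -> is_subring A ->
  (forall a, S 0%N a <-> A a) ->
  (exists s : seq {poly K}, total_ring S = gen_subring (polyC @` A `|` [set` s])) ->
  exists L, homogeneous_generators A S L.
Proof.
move=> gS sA SA [s SE]; have [S0 SB S1 SM] := gS.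
have sS p : p \in s -> total_ring S p.
  by move=> ps; rewrite SE; apply: sub_gen_subring; right.
pose L := [seq e <- flatten [seq [seq (i, p`_i) | i <- iota 0 (size p)] | p : {poly K} <- s] |
  (0 < e.1)%N && (e.2 != 0)].
exists L; split.
  move=> e; rewrite mem_filter => /andP[/andP[-> ->] /flattenP[_ /mapP[p ps ->] /mapP[i _ ->]]].
  by split=> //; apply: sS ps i.
pose H : set {poly K} := [set p | forall m, homogeneous_span A L m p`_m].
suff SH : total_ring S `<=` H.
  move=> m a Sa; have /SH/(_ m) : total_ring S (a *: 'X^m) by apply/total_ring_hom.
  by rewrite coefZ coefXn eqxx mulr1.
have H1 : homogeneous_span A L 0 1 by apply: homogeneous_base; apply: subring1.
rewrite SE; apply: gen_subring_min.
  split=> [m|p q Hp Hq m|p q Hp Hq m].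
  - rewrite coef1; case: eqP => [->//|_]; exact: homogeneous_zero.
  - by rewrite coefB; apply: homogeneous_sub.
  - rewrite coefM; apply: (big_ind (homogeneous_span A L m)).
    + exact: homogeneous_zero.
    + move=> x y Hx Hy; rewrite -[y]opprK -[- y]sub0r; apply: homogeneous_sub => //.
      by apply: homogeneous_sub => //; apply: homogeneous_zero.
    + move=> i _; rewrite -[X in homogeneous_span _ _ X](@subnKC i m) -1?ltnS //.
      exact: homogeneous_spanM.
move=> p [[a Aa <-] m|ps m].
  rewrite coefC; case: eqP => [->|_]; first exact: homogeneous_base.
  exact: homogeneous_zero.
have [m0|m0] := posnP m.
  by rewrite m0; apply: homogeneous_base; apply/SA; apply: sS ps 0%N.
have [->|pm0] := eqVneq p`_m 0; first exact: homogeneous_zero.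
rewrite -[p`_m]mulr1 -[m in homogeneous_span _ _ m]addn0.
apply: (@homogeneous_mul _ _ _ _ (m, p`_m)) => //.
rewrite mem_filter m0 pm0 /=; apply/flattenP.
exists [seq (i, p`_i) | i <- iota 0 (size p)]; first by apply/mapP; exists p.
apply/mapP; exists m => //; rewrite mem_iota add0n /= ltnNge.
by apply: contra_neqN pm0; apply: nth_default.
Qed.

End Charts.

(** * Charts are of finite type *)

Section ChartAffine.
Variables (k K : fieldType) (iota : {rmorphism k -> K}) (A : set K).
Variables (S : nat -> set K) (L : seq (nat * K)) (d : nat) (b : K).
Hypotheses (aA : affine_ring iota A) (gS : graded_ring S) (SA : forall a, S 0%N a <-> A a).
Hypotheses (gL : homogeneous_generators A S L) (dbL : (d, b) \in L).
Local Notation B := (chart S d b).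
Local Notation r := (size L).

Let sA : is_subring A. Proof. exact: affine_subring aA. Qed.
Let d0 : (0 < d)%N. Proof. by case: (gL.1 _ dbL). Qed.
Let b0 : b != 0. Proof. by case: (gL.1 _ dbL). Qed.
Let Sb : S d b. Proof. by case: (gL.1 _ dbL). Qed.
Let sB : is_subring B. Proof. exact: chart_subring. Qed.
Let bn0 n : b ^+ n != 0. Proof. by rewrite expf_neq0. Qed.

Let deg (i : 'I_r) := (nth (0%N, 0) L i).1.
Let gen (i : 'I_r) := (nth (0%N, 0) L i).2.
Let S_gen i : S (deg i) (gen i).
Proof. by case: (gL.1 _ (mem_nth (0%N, 0) (ltn_ord i))). Qed.

Let mon (e : {ffun 'I_r -> 'I_d}) := \prod_i gen i ^+ e i.
Let mdeg (e : {ffun 'I_r -> 'I_d}) := (\sum_i deg i * e i)%N.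

Let S_mon e : S (mdeg e) (mon e).
Proof.
have [S0 SB S1 SM] := gS; rewrite /mdeg /mon.
apply: (big_ind2 S) => // [m x l y Sx Sy|i _]; first exact: SM.
exact: gradedX.
Qed.

(** A monomial in the generators splits into factors [gen i ^+ d] and a monomial with exponents
    below [d]. Dividing by powers of [b] of equal degree leaves finitely many generators of the
    chart over [A]. *)
Let base_change i := gen i ^+ d / b ^+ deg i.
(** Degrees not divisible by [d] give no element of the chart; the value 0 keeps the family indexed
    by all exponent vectors. *)
Let fraction (e : {ffun 'I_r -> 'I_d}) :=
  if (d %| mdeg e)%N then mon e / b ^+ (mdeg e %/ d)%N else 0.

Let small_generators (s : seq K) : seq K :=
  s ++ [seq base_change i | i <- enum 'I_r] ++
  [seq fraction e | e <- enum {ffun 'I_r -> 'I_d}].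

Let sub_chart : A `<=` B.
Proof. by move=> a Aa; exists 0%N, a; rewrite expr0 divr1 mul0n; split=> //; apply/SA. Qed.

Let fraction_chart e : B (fraction e).
Proof.
rewrite /fraction; case: ifP => [de|_]; last exact: subring0.
by exists (mdeg e %/ d)%N, (mon e); rewrite divnK.
Qed.

Section Span.
Variable C : set K.
Hypotheses (sC : is_subring C) (AC : A `<=` C).
Hypotheses (C_base : forall i, C (base_change i)) (C_frac : forall e, C (fraction e)).

(* Exponents are kept below [d] by trading [gen i ^+ d] for [base_change i] times a power
   of [b]; the exponent [n] of [b] may be negative. *)
Inductive bounded_span (m : nat) : K -> Prop :=
| bounded_zero : bounded_span m 0
| bounded_sub x y : bounded_span m x -> bounded_span m y -> bounded_span m (x - y)
| bounded_mon c e (n : int) : C c -> (mdeg e)%:Z + n * d%:Z = m%:Z ->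
    bounded_span m (c * mon e * b ^ n).

Let bounded_mul m i x : bounded_span m x -> bounded_span (deg i + m) (gen i * x).
Proof.
elim=> {x} [|x y _ IHx _ IHy|c e n Cc me]; first by rewrite mulr0; apply: bounded_zero.
  by rewrite mulrBr; apply: bounded_sub.
have [lt|ge] := ltnP (e i).+1 d.
  pose e' := [ffun j => if j == i then Ordinal lt else e j].
  have -> : gen i * (c * mon e * b ^ n) = c * mon e' * b ^ n.
    rewrite /mon (bigD1 i) //= [in RHS](bigD1 i) //= ffunE eqxx exprS.
    under [in RHS]eq_bigr => j /negbTE ji do rewrite ffunE ji.
    by ring.
  apply: bounded_mon => //; rewrite PoszD -me addrA; congr (_ + _).
  rewrite -PoszD; congr Posz; rewrite /mdeg (bigD1 i) //= [in RHS](bigD1 i) //= ffunE eqxx.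
  under eq_bigr => j /negbTE ji do rewrite ffunE ji.
  by rewrite mulnS addnA.
have ei : (e i).+1 = d by apply/eqP; rewrite eqn_leq ge ltn_ord.
pose e' := [ffun j => if j == i then Ordinal d0 else e j].
have -> : gen i * (c * mon e * b ^ n) =
    c * base_change i * mon e' * b ^ (n + (deg i)%:Z).
  rewrite /mon (bigD1 i) //= [in RHS](bigD1 i) //= ffunE eqxx expr0 mul1r.
  under [in RHS]eq_bigr => j /negbTE ji do rewrite ffunE ji.
  rewrite /base_change -[in gen i ^+ d]ei exprS expfzDr // -exprnP.
  by field; rewrite bn0.
apply: bounded_mon; first exact: subringM.
have eM : mdeg e = (mdeg e' + deg i * d.-1)%N.
  rewrite /mdeg (bigD1 i) //= [in RHS](bigD1 i) //= ffunE eqxx muln0 add0n.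
  under [in RHS]eq_bigr => j /negbTE ji do rewrite ffunE ji.
  by rewrite addnC -[in d.-1]ei.
have dE : d%:Z = d.-1%:Z + 1 by rewrite -[in LHS](prednK d0) -addn1 PoszD.
by rewrite PoszD -me eM PoszD PoszM dE; ring.
Qed.

Let bounded_homogeneous m x : homogeneous_span A L m x -> bounded_span m x.
Proof.
elim=> {m x} [a Aa|m|m x y _ IHx _ IHy|m x e eL _ IH].
- rewrite -[a]mulr1 -[a * 1]mulr1.
  have -> : a * 1 * 1 = a * mon [ffun=> Ordinal d0] * b ^ 0.
    by rewrite /mon expr0z big1 // => i _; rewrite ffunE.
  apply: bounded_mon; first exact: AC.
  by rewrite mul0r addr0 /mdeg big1 // => i _; rewrite ffunE muln0.
- exact: bounded_zero.
- exact: bounded_sub.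
- have /(nthP (0%N, 0))[i si <-] := eL; exact: (bounded_mul (Ordinal si) IH).
Qed.

Lemma chart_sub_algebra : B `<=` C.
Proof.
move=> _ [m [a [Sa ->]]]; have /bounded_homogeneous := gL.2 _ _ Sa.
elim=> {a Sa} [|x y _ IHx _ IHy|c e n Cc me].
- by rewrite mul0r; apply: subring0.
- by rewrite mulrBl; apply: subringB.
(* Since [mdeg e] is nonnegative, division by [b ^+ m] leaves [b] in the denominator only, with
   exponent exactly [mdeg e] over [d]. *)
have nm : n <= m%:Z.
  rewrite -(ler_pM2r (_ : 0 < d%:Z)); last by rewrite ltz_nat.
  by rewrite -PoszM -me lerDr.
have mE : mdeg e = (`|m%:Z - n|%N * d)%N.
  apply/eqP; rewrite -eqz_nat PoszM gez0_abs ?subr_ge0 //.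
  by rewrite mulrBl -PoszM -me addrK.
have := C_frac e; rewrite /fraction mE dvdn_mull // mulnK // => Cf.
rewrite (_ : _ / _ = c * (mon e / b ^+ `|m%:Z - n|%N)); first exact: subringM.
have bE : b ^+ m = b ^ n * b ^+ `|m%:Z - n|%N.
  by rewrite !exprnP gez0_abs ?subr_ge0 // -expfzDr //; congr (b ^ _); lia.
by rewrite bE; field; rewrite bn0 expfz_neq0.
Qed.

End Span.

Lemma chart_affine : affine_ring iota B.
Proof.
have [[s AE] frA] := aA; split.
  exists (small_generators s).
  have inS x : x \in small_generators s ->
      [\/ x \in s, exists i, x = base_change i | exists e, x = fraction e].
    rewrite !mem_cat => /or3P[xs|/mapP[i _ ->]|/mapP[e _ ->]]; first by constructor 1.
      by constructor 2; exists i.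
    by constructor 3; exists e.
  apply/seteqP; split; last first.
    apply: gen_subalg_min => //.
      by apply: subset_trans sub_chart; apply: affine_iota.
    move=> x /inS[xs|[i ->]|[e ->]]; last exact: fraction_chart.
      by apply: sub_chart; rewrite AE; apply: sub_gen_subalg.
    by exists (deg i), (gen i ^+ d); split=> //; apply: gradedX.
  apply: chart_sub_algebra; first exact: gen_subalgP.
  - rewrite {1}AE; apply: gen_subalg_min; [exact: gen_subalgP|exact: iota_gen_subalg|].
    by move=> x xs; apply: sub_gen_subalg; rewrite /= mem_cat xs.
  - move=> i; apply: sub_gen_subalg; rewrite /= !mem_cat; apply/or3P; constructor 2.
    by apply: map_f; rewrite mem_enum.
  - move=> e; apply: sub_gen_subalg; rewrite /= !mem_cat; apply/or3P; constructor 3.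
    by apply: map_f; rewrite mem_enum.
apply/seteqP; split=> // x _.
have [a [c [Aa Ac c0 ->]]] : fraction_field A x by rewrite frA.
by exists a, c; split=> //; apply: sub_chart.
Qed.

End ChartAffine.

(** * Valuation rings contain charts *)

Section ProperCharts.
Variables (k K : fieldType) (iota : {rmorphism k -> K}) (A : set K).
Variables (S : nat -> set K) (L : seq (nat * K)).
Hypotheses (sA : is_subring A) (gS : graded_ring S) (SA : forall a, S 0%N a <-> A a).
Hypotheses (gL : homogeneous_generators A S L) (L0 : L <> [::]).
Implicit Types (V : set K) (e f : nat * K).

Lemma valuation_root V x n : valuation_ring iota V -> (0 < n)%N -> V (x ^+ n) -> V x.
Proof.
move=> [sV _ Vtot] n0 Vxn; have [//|Vxv] := Vtot x.
have [->|x0] := eqVneq x 0; first exact: subring0.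
rewrite (_ : x = x ^+ n * x^-1 ^+ n.-1); first by apply: subringM => //; apply: subringX.
by rewrite -[in x ^+ n](prednK n0) exprS exprVn mulfK // expf_neq0.
Qed.

(* The generator of least slope [v b / d]. *)
Lemma minimal_generator V : valuation_ring iota V ->
  exists2 e, e \in L & forall f, f \in L -> V (f.2 ^+ e.1 / e.2 ^+ f.1).
Proof.
move=> vV; have [sV _ Vtot] := vV.
have Lgt e : e \in L -> (0 < e.1)%N /\ e.2 != 0 by move=> /gL.1[].
elim: L L0 Lgt => [//|e l IH] _ Lgt.
have [e10 e20] := Lgt e (mem_head e l).
have refl f : f.2 != 0 -> V (f.2 ^+ f.1 / f.2 ^+ f.1).
  by move=> f0; rewrite divff ?expf_neq0 //; apply: subring1.
have [->|/eqP l0] := eqVneq l [::].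
  by exists e; [rewrite mem_head|move=> f; rewrite inE => /eqP ->; apply: refl].
have [|g gl gmin] := IH l0; first by move=> f fl; apply: Lgt; rewrite in_cons fl orbT.
have [g10 g20] : (0 < g.1)%N /\ g.2 != 0 by apply: Lgt; rewrite in_cons gl orbT.
have [Veg|Vge] := Vtot (e.2 ^+ g.1 / g.2 ^+ e.1).
  exists g; first by rewrite in_cons gl orbT.
  by move=> f; rewrite in_cons => /orP[/eqP ->//|/gmin].
rewrite invf_div in Vge; exists e; first exact: mem_head.
move=> f; rewrite in_cons => /orP[/eqP ->|fl]; first exact: refl.
have [f10 f20] : (0 < f.1)%N /\ f.2 != 0 by apply: Lgt; rewrite in_cons fl orbT.
(* Slopes are compared with denominators cleared, so passing through [g] yields the claim only for a
   power, and a root is taken. *)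
apply: (valuation_root vV g10).
rewrite (_ : _ ^+ g.1 = (f.2 ^+ g.1 / g.2 ^+ f.1) ^+ e.1 * (g.2 ^+ e.1 / e.2 ^+ g.1) ^+ f.1).
  by apply: subringM => //; apply: subringX => //; apply: gmin.
rewrite !expr_div_n -!exprM [(g.1 * e.1)%N]mulnC [(e.1 * f.1)%N]mulnC [(f.1 * g.1)%N]mulnC.
by field; rewrite !expf_neq0.
Qed.

(** The slope bound passes from the generators to all homogeneous elements: in a difference, factor
    out the term that divides the other in [V]. A root then gives membership of chart elements. *)
Lemma chart_sub_valuation V e : valuation_ring iota V -> A `<=` V -> e \in L ->
  (forall f, f \in L -> V (f.2 ^+ e.1 / e.2 ^+ f.1)) -> chart S e.1 e.2 `<=` V.
Proof.
move=> vV AV eL emin; have [sV _ Vtot] := vV; have [e10 e20 Se] := gL.1 _ eL.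
have en0 n : e.2 ^+ n != 0 by rewrite expf_neq0.
have SV m a : S m a -> V (a ^+ e.1 / e.2 ^+ m).
  move=> /gL.2; elim=> {m a} [a Aa|m|m x y _ IHx _ IHy|m x f fL _ IH].
  - by rewrite expr0 divr1; apply: subringX => //; apply: AV.
  - by rewrite expr0n eqn0Ngt e10 mul0r; apply: subring0.
  - have [->|x0] := eqVneq x 0.
      rewrite sub0r -mulN1r exprMn -mulrA; apply: subringM => //.
      by apply: subringX => //; apply: subringN => //; apply: subring1.
    have [->|y0] := eqVneq y 0; first by rewrite subr0.
    have [Vxy|Vyx] := Vtot (x / y).
      rewrite (_ : x - y = (x / y - 1) * y); last by field.
      rewrite exprMn -mulrA; apply: subringM => //.
      by apply: subringX => //; apply: subringB => //; apply: subring1.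
    rewrite (_ : x - y = (1 - (x / y)^-1) * x); last by field; apply/andP.
    rewrite exprMn -mulrA; apply: subringM => //.
    by apply: subringX => //; apply: subringB => //; apply: subring1.
  - by rewrite exprMn exprD -mulf_div; apply: subringM => //; apply: emin.
move=> _ [m [a [Sa ->]]]; apply: (valuation_root vV e10).
by rewrite expr_div_n -exprM; apply: SV.
Qed.

End ProperCharts.

(** * The canonical model *)

Section CanonicalModel.
Variables (k K : fieldType) (iota : {rmorphism k -> K}) (X : set (set K)).
Hypotheses (vX : variety iota X) (nX : normal_variety X).
Variable delta : set K -> int.
Hypothesis generated : forall A, affine_ring iota A -> Spec A `<=` X ->
  exists G, generates_divisor A delta G.
Hypothesis finitely_generated : fg_divisorial_algebra iota X (fun E => (delta E)%:~R).
Implicit Types (A P E V : set K) (U : set (set K)) (Q : nat -> set K).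

Local Notation S A := (sections X delta (Spec A)).
Local Notation gS A := (sections_graded vX nX delta (Spec A)).

Definition Proj_point A P' : Prop := exists Q,
  [/\ graded_prime (S A) Q, relevant (S A) Q & P' = graded_localization (S A) Q].

Local Notation model := (relative_Proj iota X (fun E => (delta E)%:~R)).

Lemma modelP P' : model P' <->
  exists A, [/\ affine_ring iota A, Spec A `<=` X & Proj_point A P'].
Proof.
split=> [[A [U [[aA -> [AX _]] /(Proj_total_ring (gS A)) AP]]]|[A [aA AX AP]]].
  by exists A.
exists A, (Spec A); split; first exact: affine_open_Spec.
exact/(Proj_total_ring (gS A)).
Qed.

Lemma Proj_point_local A P' : Proj_point A P' -> local_ring P'.
Proof. by move=> [Q [gQ _ ->]]; exact: graded_localization_local (gS A) gQ. Qed.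

Lemma Proj_point_sub A P' : affine_ring iota A -> Spec A `<=` X -> Proj_point A P' -> A `<=` P'.
Proof. by move=> aA AX [Q [gQ _ ->]] a Aa; exact: (sub_point vX nX aA AX gQ Aa). Qed.

Lemma Proj_point_center A P' : affine_ring iota A -> Spec A `<=` X -> Proj_point A P' ->
  exists2 P, Spec A P & dominates P' P.
Proof.
move=> aA AX [Q [gQ _ ->]]; have [AP dP] := point_centerP vX nX aA AX gQ.
by exists (point_center X delta A Q).
Qed.

Lemma center_unique (Q P R : set K) : local_ring Q -> range iota `<=` Q -> X P -> X R ->
  dominates Q P -> dominates Q R -> P = R.
Proof.
move=> lQ iQ XP XR QP QR; have [V vV VQ] := exists_dominating_valuation lQ iQ.
by apply: (variety_separated vX vV) => //; apply: dominates_trans VQ _.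
Qed.

(* Over the common point [P] both section rings have the same localization, so [Q]
   corresponds to the [a] such that [c * a] is in [Q] for some [c] outside [maxideal P]. *)
Lemma Proj_point_transport A A' P P' :
  affine_ring iota A -> Spec A `<=` X -> affine_ring iota A' -> Spec A' `<=` X ->
  Proj_point A P' -> Spec A' P -> dominates P' P -> Proj_point A' P'.
Proof.
move=> aA AX aA' AX' pt A'P P'P; have [Q [gQ rQ P'E]] := pt.
have sA := affine_subring aA; have sA' := affine_subring aA'.
have [S0 SB S1 SM] := gS A; have [QS Q0 QM Q1 QP] := gQ.
have lP' := Proj_point_local pt; have AP' := Proj_point_sub aA AX pt.
have PE : point_center X delta A Q = P.
  have [AP dP] := point_centerP vX nX aA AX gQ; rewrite -P'E in dP.
  apply: (center_unique lP') => //; [|exact: AX|exact: AX'].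
  by apply: subset_trans AP'; apply: affine_iota.
have AP : Spec A P by rewrite -PE; case: (point_centerP vX nX aA AX gQ).
have mPQ c : A c -> maxideal P c <-> Q 0%N c.
  by rewrite -PE; exact: (maxideal_point_center vX nX aA AX gQ).
have sP := Spec_subring sA AP; have lP := Spec_local sA AP.
have AsP := Spec_sub sA AP; have A'sP := Spec_sub sA' A'P.
have [_ _ mM m1 mP] := local_prime lP.
have mmul c e : P c -> P e -> ~ maxideal P c -> ~ maxideal P e -> ~ maxideal P (c * e).
  by move=> Pc Pe mc me /mP[].
have QA c m x : A c -> Q m x -> Q m (c * x).
  by move=> Ac; apply: (QM 0%N); apply/(sections_base vX nX delta aA AX).
have QnA c m x : A c -> ~ maxideal P c -> S A m x -> Q m (c * x) -> Q m x.
  move=> Ac mc Sx /(QP 0%N m c x)[] //; first exact/(sections_base vX nX delta aA AX).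
  by move/(mPQ c Ac).
(* The two affine opens have the same prime divisors through [P], so the bounds needed by
   [section_at_point] are known. *)
have down m a : S A' m a -> exists c, [/\ A c, ~ maxideal P c & S A m (c * a)].
  move=> /sectionsP S'a; have [G gG] := generated aA AX.
  apply: (section_at_point vX nX aA AX gG AP) => a0 E pE PsE.
  by apply: S'a => //; exact: (Spec_generization vX aA' AX' A'P pE PsE).
have up m a : S A m a -> exists c, [/\ A' c, ~ maxideal P c & S A' m (c * a)].
  move=> /sectionsP Sa; have [G gG] := generated aA' AX'.
  apply: (section_at_point vX nX aA' AX' gG A'P) => a0 E pE PsE.
  by apply: Sa => //; exact: (Spec_generization vX aA AX AP pE PsE).
pose Q' m := [set a | S A' m a /\ exists c, [/\ A c, ~ maxideal P c & Q m (c * a)]].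
have [S'0 S'B S'1 S'M] := gS A'.
have S'A m c a : A' c -> S A' m a -> S A' m (c * a) by exact: (mul_sections vX nX aA' AX').
have SAc m c a : A c -> S A m a -> S A m (c * a) by exact: (mul_sections vX nX aA AX).
have nQ' m f c : A' c -> ~ maxideal P c -> S A m f -> ~ Q m f -> ~ Q' m (c * f).
  move=> A'c mc Sf Qf [_ [e [Ae me Qecf]]]; apply: Qf.
  have [u [v [Au Av mv cE]]] := Spec_frac sA AP (A'sP _ A'c).
  have v0 : v != 0 by case/(nonmaxP sP (AsP _ Av)): mv.
  have cv : c * v = u by rewrite cE divfK.
  have mu : ~ maxideal P u by rewrite -cv; apply: (mmul) => //; [exact: A'sP|exact: AsP].
  apply: (QnA (e * u)) => //; first exact: subringM.
    by apply: (mmul) => //; apply: AsP.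
  rewrite (_ : e * u * f = v * (e * (c * f))); first apply: (QA) => //.
  by rewrite -cv; ring.
have gQ' : graded_prime (S A') Q'.
  split=> [m a []//|m|m l a x S'a [S'x [c [Ac mc Qcx]]]|[_ [c [Ac mc]]]|].
  - split.
      split; first exact: S'0.
      by exists 1; rewrite mulr0; split=> //; [apply: subring1|case: (Q0 m)].
    move=> x y [S'x [c [Ac mc Qcx]]] [S'y [e [Ae me Qey]]].
    split; first exact: (gradedD (gS A') S'x S'y).
    exists (c * e); split; first exact: subringM.
      by apply: (mmul) => //; apply: AsP.
    rewrite mulrDr [X in X + _]mulrAC [X in X + _]mulrC -[X in _ + X]mulrA.
    by case: (Q0 m) => _; apply; apply: (QA).
  - split; first exact: S'M.
    have [e [Ae me Sea]] := down _ _ S'a.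
    exists (e * c); split; [exact: subringM|by apply: (mmul) => //; apply: AsP|].
    by rewrite mulrACA; apply: QM.
  - by rewrite mulr1 => /(mPQ c Ac).
  - move=> m l a b S'a S'b [_ [c [Ac mc Qcab]]].
    have [e [Ae me Sea]] := down _ _ S'a; have [f [Af mf Sfb]] := down _ _ S'b.
    have : Q (m + l)%N ((e * a) * (f * b)).
      apply: (QnA c) => //; first exact: SM.
      rewrite (_ : c * _ = (e * f) * (c * (a * b))); last by ring.
      by apply: (QA) => //; apply: subringM.
    by move=> /QP[] // H; [left|right]; split=> //; [exists e|exists f].
exists Q'; split=> //.
  have [m [f [m0 Sf Qf]]] := rQ; have [c [A'c mc S'cf]] := up _ _ Sf.
  by exists m, (c * f); split=> //; apply: nQ'.
rewrite P'E; apply/seteqP; split=> [_ [m [a [b [Sa Sb Qb ->]]]]|_ [m [a [b [S'a S'b Q'b ->]]]]].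
  have [c [A'c mc S'ca]] := up _ _ Sa; have [e [A'e me S'eb]] := up _ _ Sb.
  have ce : ~ maxideal P (c * e) by apply: (mmul) => //; apply: A'sP.
  have ce0 : c * e != 0.
    by have /(nonmaxP sP)[] := ce; last by []; apply: subringM => //; apply: A'sP.
  have b0 := graded_prime_neq0 gQ Qb.
  exists m, (c * e * a), (c * e * b); split.
  - by rewrite mulrAC mulrC; apply: S'A.
  - by rewrite -mulrA; apply: S'A.
  - by apply: (nQ') => //; apply: subringM.
  - by rewrite -mulf_div divff // mul1r.
have [c [Ac mc Sca]] := down _ _ S'a; have [e [Ae me Seb]] := down _ _ S'b.
have ce : ~ maxideal P (c * e) by apply: (mmul) => //; apply: AsP.
have ce0 : c * e != 0.
  by have /(nonmaxP sP)[] := ce; last by []; apply: subringM => //; apply: AsP.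
exists m, (c * e * a), (c * e * b); split.
- by rewrite mulrAC mulrC; apply: SAc.
- by rewrite -mulrA; apply: SAc.
- by move=> Qceb; apply: Q'b; split=> //; exists (c * e); split=> //; apply: subringM.
- by rewrite -mulf_div divff // mul1r.
Qed.

End CanonicalModel.

(** * A dominating local ring determines the graded prime *)

Section Separation.
Variables (k K : fieldType) (iota : {rmorphism k -> K}) (S : nat -> set K).
Hypothesis gS : graded_ring S.
Implicit Types (Q : nat -> set K) (V : set K).

Lemma maxideal_dominated V Q m a b : local_ring V -> graded_prime S Q ->
  dominates V (graded_localization S Q) -> S m a -> S m b -> ~ Q m b ->
  maxideal V (a / b) <-> Q m a.
Proof.
move=> lV gQ VQ Sa Sb Qb; have lL := graded_localization_local gS gQ.
rewrite (dominates_maxideal lL lV VQ); last by exists m, a, b.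
exact: maxideal_graded_localization.
Qed.

Lemma graded_prime_pow Q m a n : graded_prime S Q -> S m a -> (0 < n)%N ->
  Q (m * n)%N (a ^+ n) <-> Q m a.
Proof.
move=> gQ Sa n0; split=> [|Qa].
  by apply: contraPP => Qa; apply: (graded_primeX gS gQ).
rewrite -(prednK n0) mulnS exprS mulrC addnC.
by case: gQ => _ _ QM _ _; apply: QM => //; apply: gradedX.
Qed.

(** If [R] contained [b], the degree 0 quotient [b ^+ l / c ^+ m] would lie in the maximal ideal of
    [V], although its inverse lies in the localization at [Q] and so in [V]. *)
Lemma dominated_prime_notin V Q R m l b c : local_ring V ->
  graded_prime S Q -> graded_prime S R ->
  dominates V (graded_localization S Q) -> dominates V (graded_localization S R) ->
  S m b -> ~ Q m b -> S l c -> ~ R l c -> (0 < l)%N -> ~ R m b.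
Proof.
move=> lV gQ gR VQ VR Sb Qb Sc Rc l0 Rb; have [sV _] := lV.
have Sbl : S (m * l)%N (b ^+ l) by apply: gradedX.
have Scm : S (m * l)%N (c ^+ m) by rewrite mulnC; apply: gradedX.
have Qbl : ~ Q (m * l)%N (b ^+ l) by apply: (graded_primeX gS gQ).
have Rcm : ~ R (m * l)%N (c ^+ m) by rewrite mulnC; apply: (graded_primeX gS gR).
have mz : maxideal V (b ^+ l / c ^+ m).
  by apply/(maxideal_dominated lV gR VR Sbl Scm Rcm)/(graded_prime_pow gR Sb l0).
have b0 := graded_prime_neq0 gQ Qbl; have c0 := graded_prime_neq0 gR Rcm.
move: (mz); apply/(nonmaxP sV (sub_maxideal mz)); split.
  by rewrite mulf_neq0 ?invr_eq0.
by rewrite invf_div; case: VQ => LV _; apply: LV; exists (m * l)%N, (c ^+ m), (b ^+ l).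
Qed.

(** Once [b] is outside both primes, membership of [a] in either is decided by the same test:
    whether [a ^+ m / b ^+ j] is in the maximal ideal of [V]. *)
Lemma dominated_graded_prime_sub V Q R : local_ring V ->
  graded_prime S Q -> graded_prime S R -> relevant S Q -> relevant S R ->
  dominates V (graded_localization S Q) -> dominates V (graded_localization S R) ->
  forall j, Q j `<=` R j.
Proof.
move=> lV gQ gR [m [b [m0 Sb Qb]]] [l [c [l0 Sc Rc]]] VQ VR j a Qa.
have Rb := dominated_prime_notin lV gQ gR VQ VR Sb Qb Sc Rc l0.
have Sa : S j a by case: gQ => QS _ _ _ _; apply: QS.
have Sam : S (j * m)%N (a ^+ m) by apply: gradedX.
have Sbj : S (j * m)%N (b ^+ j) by rewrite mulnC; apply: gradedX.
apply/(graded_prime_pow gR Sa m0)/(maxideal_dominated lV gR VR Sam Sbj).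
  by rewrite mulnC; apply: (graded_primeX gS gR).
apply/(maxideal_dominated lV gQ VQ Sam Sbj).
  by rewrite mulnC; apply: (graded_primeX gS gQ).
exact/(graded_prime_pow gQ Sa m0).
Qed.

Lemma dominated_graded_prime_eq V Q R : local_ring V ->
  graded_prime S Q -> graded_prime S R -> relevant S Q -> relevant S R ->
  dominates V (graded_localization S Q) -> dominates V (graded_localization S R) ->
  Q = R.
Proof.
move=> lV gQ gR rQ rR VQ VR; apply/funext => j; apply/seteqP; split.
  exact: dominated_graded_prime_sub lV gQ gR rQ rR VQ VR j.
exact: dominated_graded_prime_sub lV gR gQ rR rQ VR VQ j.
Qed.

End Separation.

(** * The model is a normal variety, proper and small over X *)

Section ModelGeometry.
Variables (k K : fieldType) (iota : {rmorphism k -> K}) (X : set (set K)).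
Hypotheses (vX : variety iota X) (nX : normal_variety X).
Variable delta : set K -> int.
Hypothesis generated : forall A, affine_ring iota A -> Spec A `<=` X ->
  exists G, generates_divisor A delta G.
Hypothesis finitely_generated : fg_divisorial_algebra iota X (fun E => (delta E)%:~R).
Implicit Types (A P E V : set K) (U : set (set K)) (Q : nat -> set K).

Local Notation S A := (sections X delta (Spec A)).
Local Notation gS A := (sections_graded vX nX delta (Spec A)).
Local Notation model := (relative_Proj iota X (fun E => (delta E)%:~R)).

Lemma sections_generators A : affine_ring iota A -> Spec A `<=` X ->
  exists L, homogeneous_generators A (S A) L /\ L <> [::].
Proof.
move=> aA AX; have sA := affine_subring aA.
have [L gL] : exists L, homogeneous_generators A (S A) L.
  apply: (homogeneous_generators_exist (gS A) sA).
    exact: (sections_base vX nX delta aA AX).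
  have [s sE] := finitely_generated (affine_open_Spec vX aA AX).
  by exists s; rewrite -[X in polyC @` X](regular_functions_Spec aA).
(* Without generators all positive degrees would vanish, but an element of [G] is a nonzero section
   of degree 1. *)
exists L; split=> // L0.
have [G gG] := generated aA AX; have [[g Gg] Gn0 _] := gG.
have /gL.2 := generator_section vX nX gG Gg.
suff H m x : homogeneous_span A L m x -> (0 < m)%N -> x = 0.
  by move=> /H /(_ isT)/eqP; rewrite (negbTE (Gn0 g Gg)).
elim=> {m x} [//|//|m x y _ IHx _ IHy m0|m x e].
  by rewrite IHx // IHy // subrr.
by rewrite L0.
Qed.

(** Separatedness of [X] makes the two centers equal; transport to a common affine open then reduces
    to graded primes of one ring. *)
Lemma model_separated V P' R' : valuation_ring iota V -> model P' -> model R' ->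
  dominates V P' -> dominates V R' -> P' = R'.
Proof.
move=> vV /(modelP vX nX)[A [aA AX ptP]] /(modelP vX nX)[A2 [aA2 A2X ptR]] VP VR.
have [P AP dP] := Proj_point_center vX nX aA AX ptP.
have [R A2R dR] := Proj_point_center vX nX aA2 A2X ptR.
have PR : P = R.
  apply: (variety_separated vX vV (AX _ AP) (A2X _ A2R)).
    exact: dominates_trans VP dP.
  exact: dominates_trans VR dR.
rewrite -PR in dR.
have {ptR} [R1 [gR rR R'E]] :=
  Proj_point_transport vX nX generated aA2 A2X aA AX ptR AP dR.
have [Q [gQ rQ P'E]] := ptP; rewrite P'E R'E in VP VR *.
by rewrite (dominated_graded_prime_eq (gS A) (valuation_local vV) gQ gR rQ rR VP VR).
Qed.

(** A graded prime containing every generator would contain all elements of positive degree, against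
    relevance. *)
Lemma Proj_point_chart A L P' : affine_ring iota A -> Spec A `<=` X ->
  homogeneous_generators A (S A) L -> Proj_point X delta A P' ->
  exists2 e, e \in L & Spec (chart (S A) e.1 e.2) P'.
Proof.
move=> aA AX gL [Q [gQ [m [b [m0 Sb Qb]]] ->]].
have [e eL Qe] : exists2 e, e \in L & ~ Q e.1 e.2.
  apply: contrapT => H; apply: Qb.
  have [QS Q0 QM Q1 QP] := gQ; have [S0 SB S1 SM] := gS A.
  suff [_] : S A m b /\ ((0 < m)%N -> Q m b) by apply.
  elim: (gL.2 _ _ Sb) => [a Aa|j|j x y _ [Sx Qx] _ [Sy Qy]|j x e eL _ [Sx _]].
  - by split=> //; apply/(sections_base vX nX delta aA AX).
  - by split=> // _; case: (Q0 j).
  - split=> [|j0]; first exact: SB.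
    case: (Q0 j) => _; apply; first exact: Qx.
    by rewrite -mulN1r; apply: (QM 0%N); [apply: (gradedN (gS A))|apply: Qy].
  - have [_ _ Se] := gL.1 _ eL; split=> [|_]; first exact: SM.
    rewrite mulrC addnC; apply: QM => //.
    by apply: contrapT => Qe; apply: H; exists e.
exists e => //; have [e1 e2 Se] := gL.1 _ eL.
exact: (graded_localization_chart (gS A) e1 e2 Se gQ Qe).
Qed.

Lemma chart_Proj_point A L e P' : homogeneous_generators A (S A) L -> e \in L ->
  Spec (chart (S A) e.1 e.2) P' -> Proj_point X delta A P'.
Proof.
move=> gL eL BP; have [e1 e2 Se] := gL.1 _ eL.
exact: (chart_graded_localization (gS A) e1 e2 Se BP).
Qed.

(** The charts over one finite affine cover of [X] suffice: a point given over any affine open is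
    transported to the member of the cover containing its center. *)
Lemma model_variety : variety iota model.
Proof.
split; last by move=> V P' R' vV mP mR; apply: model_separated vV mP mR.
have [[m [A [aA XE]]] _] := vX.
have AX i : Spec (A i) `<=` X by move=> P AP; rewrite XE; exists i.
have [L LP] := choice (fun i => sections_generators (aA i) (AX i)).
pose charts := flatten [seq [seq chart (S (A i)) e.1 e.2 | e <- L i] | i <- enum 'I_m.+1].
have chartsP B : B \in charts <-> exists i e, e \in L i /\ B = chart (S (A i)) e.1 e.2.
  split=> [/flattenP[_ /mapP[i _ ->] /mapP[e eL ->]]|[i [e [eL ->]]]]; first by exists i, e.
  apply/flattenP; exists [seq chart (S (A i)) e.1 e.2 | e <- L i].
    by apply/mapP; exists i; rewrite ?mem_enum.
  by apply/mapP; exists e.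
have charts0 : (0 < size charts)%N.
  have [_] := LP ord0; case LE: (L ord0) => [//|e l] _.
  suff : chart (S (A ord0)) e.1 e.2 \in charts by case: charts {chartsP}.
  by apply/chartsP; exists ord0, e; rewrite LE mem_head.
(* The cover in [variety] is indexed by ['I_m.+1], hence the predecessor and the need for
   [charts0]. *)
exists (size charts).-1, (fun j => nth set0 charts j); split.
  move=> j; have jlt : (j < size charts)%N by rewrite -[X in (_ < X)%N](prednK charts0).
  have /chartsP[i [e [eL ->]]] := mem_nth set0 jlt; case: e eL => d b eL.
  apply: (chart_affine (aA i) (gS (A i)) _ (LP i).1 eL).
  exact: (sections_base vX nX delta (aA i) (AX i)).
apply/seteqP; split=> [P' mP'|P' [j _ jP']]; last first.
  have jlt : (j < size charts)%N by rewrite -[X in (_ < X)%N](prednK charts0).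
  have /chartsP[i [e [eL jE]]] := mem_nth set0 jlt; rewrite jE in jP'.
  apply/(modelP vX nX); exists (A i); split=> //.
  exact: chart_Proj_point (LP i).1 eL jP'.
have /(modelP vX nX)[A2 [aA2 A2X pt]] := mP'.
have [P A2P dP] := Proj_point_center vX nX aA2 A2X pt.
have [i _ AiP] : (\bigcup_i Spec (A i)) P by rewrite -XE; apply: A2X.
have pti := Proj_point_transport vX nX generated aA2 A2X (aA i) (AX i) pt AiP dP.
have [e eL eP'] := Proj_point_chart (aA i) (AX i) (LP i).1 pti.
have /chartsP/(nthP set0)[j jlt jE] : exists i0 e0, e0 \in L i0 /\
    chart (S (A i)) e.1 e.2 = chart (S (A i0)) e0.1 e0.2 by exists i, e.
have jlt' : (j < (size charts).-1.+1)%N by rewrite prednK.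
by exists (Ordinal jlt') => //=; rewrite jE.
Qed.

Lemma model_normal : normal_variety model.
Proof.
move=> P' /(modelP vX nX)[A [aA AX [Q [gQ rQ ->]]]].
exact: (point_integrally_closed vX nX aA AX gQ).
Qed.

(** For a valuation ring over a point of [Spec A], the required point is its center on the chart of
    the generator of least slope. *)
Lemma model_proper : proper_birational iota model X.
Proof.
split=> [P' /(modelP vX nX)[A [aA AX pt]]|V vV [P XP VP]].
  have [P AP dP] := Proj_point_center vX nX aA AX pt.
  by exists P => //; apply: AX.
have [A [aA AP AX]] := variety_affine vX XP.
have [L [gL L0]] := sections_generators aA AX.
have sA := affine_subring aA; have AsP := Spec_sub sA AP.
have AV : A `<=` V by apply: subset_trans AsP _; case: VP.
have [e eL emin] := minimal_generator gL L0 vV.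
have BV := chart_sub_valuation gL vV AV eL emin.
have [e1 e2 Se] := gL.1 _ eL.
have sB := chart_subring (gS A) e2 Se.
have [BP' dP'] := center_Spec sB (valuation_local vV) BV.
exists (localization (chart (S A) e.1 e.2) (chart (S A) e.1 e.2 `&` maxideal V)) => //.
apply/(modelP vX nX); exists A; split=> //; exact: chart_Proj_point gL eL BP'.
Qed.

(** As a valuation ring, [E] dominates a point [P'] of the model, which lies over a point of [X]
    dominated by [E]. By separatedness that point is [E], so [P'] is squeezed between [E] and
    itself. *)
Lemma prime_divisor_model E : prime_divisor X E -> prime_divisor model E.
Proof.
move=> pE; have vE := prime_divisor_valuation vX nX pE; have [XE m0 Eprime] := pE.
have domE : dominates E E by split.
have [P' mP' EP'] : exists2 P', model P' & dominates E P'.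
  by case: model_proper => _; apply=> //; exists E.
have [P XP P'P] : exists2 P, X P & dominates P' P by case: model_proper => + _; apply.
have PE : P = E := variety_separated vX vE XP XE (dominates_trans EP' P'P) domE.
suff P'E : P' = E by rewrite -{1}P'E in m0 Eprime *; split; rewrite ?P'E // -P'E.
apply/seteqP; split; first by case: EP'.
by rewrite -PE; case: P'P.
Qed.

(* [X_can -> X] is small. *)
Lemma model_prime_divisor E : prime_divisor model E -> prime_divisor X E.
Proof.
move=> [mE m0 Eprime]; have lE := variety_local model_variety mE; have [sE _] := lE.
have /(modelP vX nX)[A [aA AX [Q [gQ rQ EE]]]] := mE.
(* If no prime divisor contained [E], [point_intersection] would place the inverse of every nonzero
   non-unit in [E]. *)
have [F pF EF] : exists2 F, prime_divisor X F & E `<=` F.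
  apply: contrapT => H; apply: m0; apply/seteqP; split=> [x mx|_ ->]; last exact: maxideal0.
  apply: contrapT => /= /eqP x0; move: (mx); apply/(nonmaxP sE (sub_maxideal mx)).
  split=> //; rewrite EE; apply: (point_intersection vX nX aA AX gQ) => F pF EF.
  by case: H; exists F; rewrite // EE.
have dF := prime_divisor_dvr vX nX pF; have lF := dvr_local dF; have [sF _] := lF.
(* The contraction is not 0, as it contains the numerator of a uniformizer of [F] written as a
   fraction over [E]. If it is the maximal ideal, [F] dominates both [E] and itself, and
   separatedness identifies them. *)
case: (Eprime _ (cap_maxideal_prime sE lF EF)) => [E0|EmE].
  have [t [t0 mF] _] := dvr_uniformizer dF.
  have mt : maxideal F t by rewrite mF; exists 1; rewrite ?mulr1 //; apply: subring1.
  have [a [b [Ea Eb b0 tE]]] : fraction_field E t.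
    by rewrite (variety_fraction model_variety mE).
  have : (E `&` maxideal F) a.
    split=> //; rewrite (_ : a = b * t); last by rewrite tE mulrC divfK.
    by apply: maxidealM => //; apply: EF.
  by rewrite E0 => /= a0; rewrite tE a0 mul0r eqxx in t0.
suff -> : E = F by [].
have [mF _ _] := prime_divisor_model pF.
apply: (model_separated (prime_divisor_valuation vX nX pF)) => //.
  by split=> // x; rewrite -EmE => -[].
by split.
Qed.

End ModelGeometry.

(** * Valuations of the canonical divisor *)

Section Valuation.
Variables (K : fieldType) (X : set (set K)).
Implicit Types (F P E : set K) (U : set (set K)) (I : set (set K) -> set K).

Lemma mem_center_on F P U : X P -> dominates F P -> U P -> U `&` center_on X F !=set0.
Proof. by move=> XP FP UP; exists P; split=> //; exists P. Qed.

Lemma zopen_center_on F U : zopen X U -> U `&` center_on X F !=set0 ->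
  exists P, [/\ X P, dominates F P & U P].
Proof. by move=> oU [Q [UQ [P [XP FP] [XQ QP]]]]; exists P; split=> //; apply: QP. Qed.

Lemma val_sheafE F I U phi : zopen X U -> U `&` center_on X F !=set0 -> I U phi ->
  phi != 0 -> (forall U' psi, zopen X U' -> U' `&` center_on X F !=set0 ->
    I U' psi -> psi != 0 -> ord F phi <= ord F psi) ->
  val_sheaf X F I = ord F phi.
Proof.
move=> oU UF Iphi phi0 phimin; apply: xget_subset1.
  split; first by exists U, phi.
  by move=> _ [U' [psi [oU' U'F Ipsi psi0 <-]]]; apply: phimin oU' U'F Ipsi psi0.
move=> m l [m_val mmin] [l_val lmin].
by apply/eqP; rewrite eq_le mmin //= lmin.
Qed.

(** The sign in [val_natural] cancels the one in -K, so the valuation is read off from sections of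
    positive multiples of K. *)
Lemma sheaf_multipleP (delta : set K -> int) (M : nat) U phi :
  sheaf_O X (fun E => - (M%:R * - (delta E)%:~R)) U phi <->
  (phi != 0 -> forall E, prime_divisor X E -> U E -> 0 <= ord E phi + M%:Z * delta E).
Proof.
suff -> : (fun E => - (M%:R * - (delta E)%:~R)) = (fun E => M%:R * (delta E)%:~R : rat).
  exact: sectionsP.
by apply/funext => E; rewrite mulrN opprK.
Qed.

End Valuation.

(** The two image filters coincide, so the values of [lim] agree even in the absence of
    convergence. *)
Lemma eventually_eq_lim (T : ptopologicalType) (u v : nat -> T) (N : nat) :
  (forall j, (N <= j)%N -> u j = v j) -> lim (u @ \oo) = lim (v @ \oo).
Proof.
move=> uv; suff -> : u @ \oo = v @ \oo by [].
apply/seteqP; split=> A [m _ mA]; exists (maxn m N) => // j /=;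
  rewrite geq_max => /andP[mj Nj]; [rewrite /= -uv|rewrite /= uv] => //; exact: mA.
Qed.

Section CanonicalValuation.
Variables (k K : fieldType) (iota : {rmorphism k -> K}) (X : set (set K)).
Hypotheses (vX : variety iota X) (nX : normal_variety X).
Variables (delta delta' : set K -> int) (h : K).
Hypothesis generated : forall A, affine_ring iota A -> Spec A `<=` X ->
  exists G, generates_divisor A delta G.
Hypothesis finitely_generated : fg_divisorial_algebra iota X (fun E => (delta E)%:~R).
Hypothesis h0 : h != 0.
Hypothesis delta'E : forall E, prime_divisor X E -> delta' E = ord E h + delta E.

Local Notation S A := (sections X delta (Spec A)).
Local Notation gS A := (sections_graded vX nX delta (Spec A)).
Local Notation model := (relative_Proj iota X (fun E => (delta E)%:~R)).
Local Notation multiple M := (fun E => M%:R * - (delta' E)%:~R).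

(* With [d] the degree of a homogeneous [b] not vanishing at the center of [F], both
   sides are the order of [b^(M/d) / h^M], which generates O(M delta') at that center. *)
Lemma val_natural_model F P' : dvr F -> valuation_ring iota F -> model P' ->
  dominates F P' -> exists2 d, (0 < d)%N & forall M, (d %| M)%N ->
    val_natural X F (multiple M) = val_natural model F (multiple M).
Proof.
move=> dF vF mP' FP'.
have vm := model_variety vX nX generated finitely_generated.
have nm := model_normal vX nX (delta := delta).
have mdiv := model_prime_divisor vX nX generated finitely_generated.
have divm := prime_divisor_model vX nX generated finitely_generated.
have dvrX E (pE : prime_divisor X E) := prime_divisor_dvr vX nX pE.
have [A [aA AX pt]] := (modelP vX nX delta P').1 mP'.
have [G gG] := generated aA AX.
have [P AP dP] := Proj_point_center vX nX aA AX pt; have XP := AX _ AP.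
have FP := dominates_trans FP' dP.
have sA := affine_subring aA; have sP := Spec_subring sA AP.
have lP := Spec_local sA AP; have AsP := Spec_sub sA AP.
have lF := dvr_local dF; have [sF _] := lF.
have AP' := Proj_point_sub vX nX aA AX pt.
have [Q [gQ [d [b [d0 Sb Qb]]] P'E]] := pt.
have b0 := graded_prime_neq0 gQ Qb.
exists d => // _ /dvdnP[j ->]; set M := (j * d)%N.
pose beta := b ^+ j / h ^+ M.
have beta0 : beta != 0 by rewrite mulf_neq0 ?invr_eq0 ?expf_neq0.
have obeta E : dvr E -> ord E beta = j%:Z * ord E b - M%:Z * ord E h.
  move=> dE; rewrite (ordM dE) ?invr_eq0 ?expf_neq0 // (ordV dE) ?expf_neq0 //.
  by rewrite !(ordX dE) // -[ord E b *+ _]mulr_natl -[ord E h *+ _]mulr_natl !natz.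
have beta_section E : prime_divisor X E -> Spec A E -> 0 <= ord E beta + M%:Z * delta' E.
  move=> pE AE; have /sectionsP/(_ b0 E pE AE) := Sb.
  rewrite (obeta E (dvrX E pE)) (delta'E pE) => /(mulr_ge0 (ler0n _ j)).
  by rewrite natz /M PoszM; lia.
have Sbj : S A M (b ^+ j) by rewrite /M mulnC; apply: (gradedX (gS A)).
have Qbj : ~ Q M (b ^+ j) by rewrite /M mulnC; apply: (graded_primeX (gS A) gQ).
have leF x : x != 0 -> F (x / beta) -> ord F beta <= ord F x.
  move=> x0 /(ord_ge0 dF); rewrite mulf_neq0 ?invr_eq0 // => /(_ isT).
  by rewrite (ordM dF) ?invr_eq0 // (ordV dF) // subr_ge0.
rewrite /val_natural (@val_sheafE _ X F _ (Spec A) beta) //.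
(* This open set is the preimage of [Spec A] in the model. *)
- rewrite (@val_sheafE _ model F _ [set R | model R /\ A `<=` R] beta) //.
  + split=> [R []//|R [mR AR]]; have [[s AE] _] := aA; exists s.
      by apply: subset_trans AR; rewrite AE; apply: sub_gen_subalg.
    move=> T mT sT; split=> //; rewrite AE; apply: gen_subalg_min => //.
      exact (variety_subring vm mT).
    exact (variety_iota vm mT).
  + exact: mem_center_on mP' FP' (conj mP' AP').
  + apply/sheaf_multipleP => _ E /mdiv pE [_ AE]; apply: beta_section => //.
    by apply: (variety_mem_Spec vX aA AX) => //; case: pE.
  + move=> U phi oU /(zopen_center_on oU)[R [mR FR UR]] /sheaf_multipleP phiP phi0.
    have FF : dominates F F by split.
    have RP' : R = P' := variety_separated vm vF mR mP' FR FP'.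
    subst R; apply: leF => //; case: FP' => P'F _; apply: P'F; rewrite P'E.
    apply: (point_intersection vX nX aA AX gQ) => E pE; rewrite -P'E => P'sE.
    have dE := dvrX E pE; have mE := divm _ pE.
    have AE : Spec A E.
      apply: (variety_mem_Spec vX aA AX); first by case: pE.
      exact: subset_trans P'sE.
    have UE : U E by apply: (zopen_generization oU UR) => //; case: mE.
    (* At a prime divisor through [P'], take [g] in [G] of least order: [g ^+ d / b] lies in [P']
       and hence in [E], which bounds the order of [b] from above; being a section bounds it from
       below. *)
    have bE : ord E b + d%:Z * delta E = 0.
      apply/eqP; rewrite eq_le; apply/andP; split; last first.
        by have /sectionsP := Sb; apply.
      have [_ Gn0 GE] := gG; have [_ [g Gg gE]] := GE E AE dE; have g0 := Gn0 g Gg.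
      have : E (g ^+ d / b).
        apply: P'sE; rewrite P'E; exists d, (g ^+ d), b; split=> //.
        have := gradedX (gS A) d (generator_section vX nX gG Gg).
        by rewrite mul1n.
      move=> /(ord_ge0 dE); rewrite mulf_neq0 ?invr_eq0 ?expf_neq0 // => /(_ isT).
      rewrite (ordM dE) ?invr_eq0 ?expf_neq0 // (ordV dE) // (ordX dE) // -mulr_natl natz.
      have -> : delta E = - ord E g by lia.
      by rewrite mulrN; lia.
    apply/(ord_ge0 dE); first by rewrite mulf_neq0 ?invr_eq0.
    rewrite (ordM dE) ?invr_eq0 // (ordV dE) // (obeta E dE).
    have := phiP phi0 E mE UE; rewrite (delta'E pE) /M PoszM.
    have -> : ord E b = - (d%:Z * delta E) by lia.
    by lia.
- by case: (affine_open_Spec vX aA AX).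
- exact: mem_center_on XP FP AP.
- by apply/sheaf_multipleP => _ E pE AE; apply: beta_section.
move=> U phi oU /(zopen_center_on oU)[R [XR FR UR]] /sheaf_multipleP phiP phi0.
have RP : R = P := variety_separated vX vF XR XP FR FP.
subst R; apply: leF => //.
(* The factor [h ^+ M] passes from [delta'] to [delta], and [c] extends a section near the center to
   all of [Spec A]. As [c] is a unit at [P], it is a unit of [F] and does not affect the order. *)
have [c [Ac mc Sc]] : exists c, [/\ A c, ~ maxideal P c & S A M (c * (phi * h ^+ M))].
  apply: (section_at_point vX nX aA AX gG AP) => _ E pE PE; have dE := dvrX E pE.
  have UE : U E by apply: (zopen_generization oU UR) => //; case: pE.
  have := phiP phi0 E pE UE; rewrite (delta'E pE) (ordM dE) ?expf_neq0 // (ordX dE) //.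
  by rewrite -mulr_natl natz; lia.
have Fc := (FP.1 _ (AsP _ Ac)).
have [c0 Fcv] : c != 0 /\ F c^-1.
  by apply/(nonmaxP sF Fc); rewrite (dominates_maxideal lP lF FP) //; apply: AsP.
rewrite (_ : phi / beta = c^-1 * (c * (phi * h ^+ M) / b ^+ j)); last first.
  by rewrite /beta; field; rewrite c0 !expf_neq0.
apply: subringM => //; case: FP' => P'F _; apply: P'F; rewrite P'E.
by exists M, (c * (phi * h ^+ M)), (b ^+ j).
Qed.

End CanonicalValuation.

Lemma complex_subfield_char0 (R : realType) (K : fieldType) (iota : {rmorphism R[i] -> K}) m :
  m.+1%:R != 0 :> K.
Proof. by rewrite -(rmorph_nat iota) fmorph_eq0 pnatr_eq0. Qed.

Theorem proposition4p4 (R : realType) (K : fieldType)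
    (iota : {rmorphism R[i] -> K}) (n : nat) (X : set (set K))
    (w : diff_form iota n) :
  variety iota X -> normal_variety X -> quasi_projective iota X ->
  has_dimension iota n ->
  canonical_singularities iota R n X ->
  rational_form w ->
  let K_X := canonical_divisor w in
  fg_divisorial_algebra iota X K_X ->
  let X_can := relative_Proj iota X K_X in
  [/\ variety iota X_can, normal_variety X_can,
      proper_birational iota X_can X
    & canonical_singularities iota R n X_can].
Proof.
move=> vX nX _ [x [_ alg]] canX rw K_X fg X_can.
have xT := diff_span_algebraic (complex_subfield_char0 iota) alg.
pose delta E := ord_form E w.
have gen A : affine_ring iota A -> Spec A `<=` X -> exists G, generates_divisor A delta G.
  by move=> aA _; exact (canonical_divisor_generated xT aA rw).
have vm : variety iota X_can := model_variety vX nX gen fg.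
have nm : normal_variety X_can := model_normal vX nX (delta := delta).
have pm : proper_birational iota X_can X := model_proper vX nX gen fg.
split=> // w' rw' Y F vY nY pY pF excF.
have [h h0 hE] := canonical_divisor_ratio xT rw rw'.
have delta'E E : prime_divisor X E -> ord_form E w' = ord E h + delta E.
  move=> pE; have [XE _ _] := pE; have [A [aA AE _]] := variety_affine vX XE.
  exact: hE aA AE (prime_divisor_dvr vX nX pE).
have dF := prime_divisor_dvr vY nY pF; have vF := prime_divisor_valuation vY nY pF.
have YF : Y F by case: pF.
have [P' mP' FP'] : exists2 P', X_can P' & dominates F P' by case: pY => + _; apply.
have pYX : proper_birational iota Y X.
  split=> [E YE|V vV VX].
    have [T mT ET] := pY.1 E YE; have [P XP TP] := pm.1 T mT.
    by exists P => //; apply: dominates_trans ET TP.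
  exact: pY.2 vV (pm.2 V vV VX).
(* A prime divisor of [X] dominated by [F] would also be one of the model. *)
have excX : exceptional X F.
  move=> [P pP FP]; apply: excF; exists P => //.
  exact (prime_divisor_model vX nX gen fg pP).
have [d d0 dM] := val_natural_model vX nX gen fg h0 delta'E dF vF mP' FP'.
suff <- : relative_canonical_divisor R w' X F = relative_canonical_divisor R w' X_can F.
  exact: canX rw' Y F vY nY pYX pF excX.
rewrite /relative_canonical_divisor; congr (_ + _).
(* From [j = d] on, [d] divides j!, so the sequences defining the two valuations agree term by
   term. *)
apply: (@eventually_eq_lim _ _ _ d) => j dj.
by rewrite dM //; apply: dvdn_fact; rewrite d0.
Qed.
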